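(* Suppose the Markov chain $\Xi$ on $\mathbb X\subseteq\mathbb R$ satisfies (N$'$), $(\mathrm T^{\mathrm{out}}_{\alpha,\beta,c})$ and $(\mathrm D'_{\gamma,b})$. Then: (i) if $\gamma>\alpha-1$, $\Xi$ is null recurrent; (ii) if $\gamma<\alpha-1$ and $b<0$, $\Xi$ is positive recurrent; (iii) if $\gamma<\alpha-1$ and $b>0$, $\Xi$ is directional transient; (iv) if $\gamma=\alpha-1$ and $b<c\pi|\csc(\pi\alpha)|$, $\Xi$ is null recurrent; (v) if $\gamma=\alpha-1$ and $b>c\pi|\csc(\pi\alpha)|$, $\Xi$ is directional transient.
   Context: $\Xi=(\xi_n)_{n\ge0}$ is a time-homogeneous Markov chain on an infinite, unbounded, measurable $\mathbb X\subseteq\mathbb R$. $\mathbb P_x,\mathbb E_x$ refer to the chain started at $x$; $\theta:=\xi_1-\xi_0$; $y_+:=y\mathbf 1\{y\ge0\}$, $y_-:=-y\mathbf 1\{y<0\}$; $\mu(x):=\mathbb E_x[\theta]$; $\tau_a:=\min\{n\ge0:|\xi_n|\le a\}$. $\Xi$ is transient if $|\xi_n|\to\infty$ a.s.; recurrent if $\liminf_n|\xi_n|\le r_0$ a.s. for some deterministic $r_0$; positive recurrent if $\mathbb E_x[\tau_a]<\infty$ for all large $a$ and all $x$; null recurrent if recurrent and $\mathbb E_x[\tau_a]=\infty$ for all large $a$ and all $|x|>a$; directional transient if $\lim_n\xi_n\in\{-\infty,+\infty\}$ a.s. (N$'$): $\limsup_n|\xi_n|=+\infty$ a.s. $(\mathrm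 T^{\mathrm{out}}_{\alpha,\beta,c})$: there exist $\alpha\in(1,2)$, $\beta>\alpha$, $c>0$, $x_0\in\mathbb R_+$ with $\lim_{y\to\infty}\sup_{x\ge x_0}|y^\alpha\mathbb P_x[\theta_+>y]-c|=\lim_{y\to\infty}\sup_{x\le -x_0}|y^\alpha\mathbb P_x[\theta_->y]-c|=0$, $\sup_{x\ge x_0}\mathbb E_x[\theta_-^\beta]<\infty$, and $\sup_{x\le-x_0}\mathbb E_x[\theta_+^\beta]<\infty$. $(\mathrm D'_{\gamma,b})$: there exist $\gamma\ge0$, $b\in\mathbb R$ with $\lim_{x\to+\infty}x^\gamma\mu(x)=\lim_{x\to-\infty}(-|x|^\gamma\mu(x))=b$. *)

(* Defs.v *)
From HB Require Import structures.
From mathcomp Require Import all_boot all_order all_algebra.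
From mathcomp Require Import all_classical all_reals all_analysis.
Set Implicit Arguments. Unset Strict Implicit. Unset Printing Implicit Defensive.
Import Order.TTheory GRing.Theory Num.Theory.
Import numFieldNormedType.Exports.
Local Open Scope classical_set_scope.
Local Open Scope ring_scope.

Definition is_markov_chain (R : realType) (d : measure_display)
  (Omega : measurableType d) (X : set R)
  (K : R.-pker R ~> R) (Px : R -> probability Omega R) (xi : nat -> Omega -> R) :=
  (forall n, measurable_fun setT (xi n)) /\
  (forall x, X x -> K x (~` X) = 0%E) /\
  (forall x, X x -> Px x [set w | xi 0%N w = x] = 1%E) /\
  (forall x, X x -> forall (n : nat) (A : nat -> set R) (B : set R),
     (forall i, measurable (A i)) -> measurable B ->
     Px x [set w | (forall i, (i <= n)%N -> A i (xi i w)) /\ B (xi n.+1 w)] =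
     (\int[Px x]_(w in [set w | forall i, (i <= n)%N -> A i (xi i w)])
        K (xi n w) B)%E).

Section Defs.
Context (R : realType) (d : measure_display) (Omega : measurableType d)
  (X : set R) (Px : R -> probability Omega R) (xi : nat -> Omega -> R).

Definition theta (w : Omega) : R := xi 1%N w - xi 0%N w.
Definition posp (y : R) : R := if 0 <= y then y else 0.
Definition negp (y : R) : R := if y < 0 then - y else 0.

Definition mu (x : R) : \bar R := (\int[Px x]_w (theta w)%:E)%E.

Definition tau (a : R) (w : Omega) : \bar R :=
  ereal_inf [set (n%:R)%:E | n in [set n : nat | `|xi n w| <= a]].

Definition transient : Prop :=
  forall x, X x -> {ae Px x, forall w,
    (fun n => `|xi n w|) @ \oo --> +oo}.

Definition recurrent : Prop :=
  exists r0 : R, forall x, X x -> {ae Px x, forall w,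
    (limn_einf (fun n => (`|xi n w|)%:E) <= r0%:E)%E}.

Definition positive_recurrent : Prop :=
  exists a0 : R, forall a, a0 <= a -> forall x, X x ->
    (\int[Px x]_w tau a w < +oo)%E.

Definition null_recurrent : Prop :=
  recurrent /\
  exists a0 : R, forall a, a0 <= a -> forall x, X x -> a < `|x| ->
    (\int[Px x]_w tau a w)%E = +oo%E.

Definition directional_transient : Prop :=
  forall x, X x -> {ae Px x, forall w,
    ((fun n => xi n w) @ \oo --> +oo) \/ ((fun n => xi n w) @ \oo --> -oo)}.

Definition condN' : Prop :=
  forall x, X x -> {ae Px x, forall w,
    limn_esup (fun n => (`|xi n w|)%:E) = +oo%E}.

Definition condTout (alpha beta c : R) : Prop :=
  1 < alpha < 2 /\ alpha < beta /\ 0 < c /\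
  exists x0 : R, 0 <= x0 /\
  (forall eps : R, 0 < eps -> exists Y : R, forall y, Y <= y ->
     forall x, X x -> x0 <= x ->
       `| y `^ alpha * fine (Px x [set w | y < posp (theta w)]) - c | <= eps) /\
  (forall eps : R, 0 < eps -> exists Y : R, forall y, Y <= y ->
     forall x, X x -> x <= - x0 ->
       `| y `^ alpha * fine (Px x [set w | y < negp (theta w)]) - c | <= eps) /\
  (exists M : R, forall x, X x -> x0 <= x ->
     (\int[Px x]_w ((negp (theta w)) `^ beta)%:E <= M%:E)%E) /\
  (exists M : R, forall x, X x -> x <= - x0 ->
     (\int[Px x]_w ((posp (theta w)) `^ beta)%:E <= M%:E)%E).

Definition condD' (gamma b : R) : Prop :=
  0 <= gamma /\
  ((fun x => ((x `^ gamma)%:E * mu x)%E) @ within X (pinfty_nbhs R) --> b%:E) /\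
  ((fun x => (- ((`|x| `^ gamma)%:E * mu x))%E) @ within X (ninfty_nbhs R) --> b%:E).

End Defs.

(* Main.v *)
Require Import Defs.
From HB Require Import structures.
From mathcomp Require Import all_boot all_order all_algebra.
From mathcomp Require Import all_classical all_reals all_analysis.
From mathcomp Require Import measurable_realfun ring lra.
Import Order.TTheory GRing.Theory Num.Theory.
Import numFieldNormedType.Exports.
Local Open Scope classical_set_scope.
Local Open Scope ring_scope.

(**
Every case reads off the drift of a Lyapunov function under the outward jump
[T = sgn(x) theta] from [r = |x|]. With [psi t = t - ln (1 + t)], the layer-cake
formula and the tail asymptotics give [E psi(T_+ / r) ~ c J r^-al], where [J] is
the integral of [e^(s x) / (1 + e^x)] over the line at [s = 2 - al]. The
difference [h s = J - pi / sin (pi s)] is bounded, is [O(s)] at [0], and satisfies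
[3 h(s) = h(s/3) - h((s+1)/3) + h((s+2)/3)]; iterating this at the supremum of
[|h|] forces [h = 0], so [J = pi / |sin (pi al)|].

- Recurrence: [ln |x|] has nonpositive drift far out when [r^(al-1) E T] stays
  below [c J]; the probability of reaching level [N] before returning to a fixed
  interval is then [O(1 / ln N)], whereas the chain does reach every level.
- Transience: [|x|^-nu], set to [1] behind the starting half-line, has nonpositive
  drift far out for small [nu > 0] when [r^(al-1) E T] stays above [c J]. A jump
  across the origin counts as a return, so the limit has a constant sign.
- Positive recurrence: [|x|^nu] has drift at most [-1] far out for
  [1 + gamma < nu < al].
- Null recurrence: the first jump exceeds [z] with probability of order [z^-al],
  and the cut-off [phi(|x| / z)], whose drift is at most [C z^-al], bounds by
  [C n z^-al] the probability of then returning below [z / 2] within [n] steps.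
  With [z^al = 2 C n] this gives [P(tau > n) >= k' / n], which is not summable.

Instead of martingale convergence, the first two cases use a maximal inequality
weighted by the event that the path followed a prescribed history up to time [m].
*)

Set Implicit Arguments. Unset Strict Implicit. Unset Printing Implicit Defensive.

(** * The integral of e^(sx)/(1+e^x) *)

Section csc_trig.
Context {R : realType}.
Implicit Types x s : R.

(** The function [psi] collects what the drift condition does not control. Since
    [ln (1 + t) = t - psi t], the linear term is the mean, while [psi], quadratic at 0 and linear at
    infinity, is integrable against power tails of index between 1 and 2. A step thus changes [ln r]
    on average by about [m / r - c J r^-al]; with [m] near [b r^-gamma] the two terms balance at
    [gamma = al - 1], [b = c J]. For [r^-nu] the coefficient of [psi] is [nu (1 + nu)], against [nu]
    for the mean, so the threshold of transience is [c J (1 + nu)] and meets that of recurrence as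
    [nu] tends to 0.

    The equation for [h] is elementary: the factorisation of [1 + y^3] yields it for the integral,
    the product formula for [sin (3 x)] for the cosecant, and no contour integral occurs.

    The Markov property is available for one step after a history in a product of sets. Return and
    passage events are therefore split into such histories according to the time at which they
    happen, and the drift inequality is summed over them. *)

Lemma cos_pithird : cos (pi / 3) = 2^-1 :> R.
Proof.
set a := cos (pi / 3 : R).
have h : 4 * a ^+ 3 - 3 * a = -1.
  have -> : (-1 : R) = cos (pi / 3 + (pi / 3 + pi / 3)).
    by rewrite -cospi; congr cos; field.
  rewrite !cosD !sinD -/a; have := sin2cos2 (pi / 3 : R).
  rewrite -/a => e; rewrite -[X in X - 3 * a]addr0.
  set b := sin _ in e *.
  have -> : a * (a * a - b * b) - b * (b * a + a * b) = a ^+ 3 - 3 * a * b ^+ 2 by ring.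
  by rewrite e; ring.
have a0 : 0 < a.
  apply: cos_gt0_pihalf; have := pi_gt0 R; move=> p; apply/andP; split; lra.
(* The triple-angle polynomial plus 1 factors in this way; positivity of [a] excludes the root
   -1. *)
have : (a + 1) * (2 * a - 1) ^+ 2 = 0.
  have -> : (a + 1) * (2 * a - 1) ^+ 2 = (4 * a ^+ 3 - 3 * a) + 1 by ring.
  by rewrite h; ring.
move/eqP; rewrite mulf_eq0 => /orP[/eqP|]; first lra.
by rewrite expf_eq0 => /andP[_ /eqP]; lra.
Qed.

(** The product formula [sin (3 x) = 4 sin x sin (x + pi/3) sin (x + 2 pi/3)], which is [e4],
    supplies a common denominator; the combined numerator is then constant by [e6]. *)
Lemma sin3_csc x : 0 < x < pi / 3 ->
  3 / sin (3 * x) = 1 / sin x - 1 / sin (x + pi / 3) + 1 / sin (x + (pi / 3 + pi / 3)).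
Proof.
move=> /andP[x0 x1]; have p0 := pi_gt0 R.
have s1 : 0 < sin x by apply: sin_gt0_pi; apply/andP; split; lra.
have s2 : 0 < sin (x + pi / 3) by apply: sin_gt0_pi; apply/andP; split; lra.
have s3 : 0 < sin (x + (pi / 3 + pi / 3)) by apply: sin_gt0_pi; apply/andP; split; lra.
have s4 : 0 < sin (3 * x) by apply: sin_gt0_pi; apply/andP; split; lra.
have e3 : sin (3 * x) = 3 * sin x - 4 * sin x ^+ 3.
  have -> : 3 * x = x + (x + x) by ring.
  rewrite sinD cosD sinD.
  have -> : sin x * (cos x * cos x - sin x * sin x) +
    cos x * (sin x * cos x + cos x * sin x) = 3 * sin x * cos x ^+ 2 - sin x ^+ 3 by ring.
  by rewrite cos2sin2; ring.
have b2 : sin (pi / 3) ^+ 2 = 3 / 4 :> R by rewrite sin2cos2 cos_pithird; field.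
move: s2 s3 s4; rewrite e3 !sinD !cosD cos_pithird.
have := sin2cos2 x.
move: b2 s1; set b := sin (pi / 3); set S := sin x; set C := cos x => b2 s1 SC.
have -> : S * (2^-1 * 2^-1 - b * b) + C * (b * 2^-1 + 2^-1 * b) = C * b - S / 2.
  have bb : b * b = 3 / 4 by rewrite -expr2.
  by rewrite bb; field.
have -> : S * 2^-1 + C * b = C * b + S / 2 by field.
move=> s2 s3 s4.
have e4 : 3 * S - 4 * S ^+ 3 = 4 * S * (C * b + S / 2) * (C * b - S / 2).
  have -> : 4 * S * (C * b + S / 2) * (C * b - S / 2) = 4 * S * (C ^+ 2 * b ^+ 2) - S ^+ 3.
    by field.
  have -> : C ^+ 2 = 1 - S ^+ 2 by rewrite SC; ring.
  by rewrite b2; field.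
rewrite e4; have e5 : C ^+ 2 * b ^+ 2 = 3 / 4 - 3 / 4 * S ^+ 2.
  by rewrite b2; have -> : C ^+ 2 = 1 - S ^+ 2 by [rewrite SC; ring]; field.
have e6 : 4 * ((C * b + S / 2) * (C * b - S / 2) - S * (C * b - S / 2) + S * (C * b + S / 2)) = 3.
  have -> : 4 * ((C * b + S / 2) * (C * b - S / 2) - S * (C * b - S / 2) + S * (C * b + S / 2))
   = 4 * (C ^+ 2 * b ^+ 2) + 3 * S ^+ 2 by field.
  by rewrite e5; field.
rewrite -{1}e6; field.
by rewrite !gt_eqF//; lra.
Qed.

Lemma sin_le_id x : 0 <= x -> sin x <= x.
Proof.
rewrite le_eqVlt => /predU1P[<-|x0]; first by rewrite sin0.
have := @MVT R sin cos 0 x x0 (fun y _ => is_derive_sin y).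
case=> [|c _ ]; first by apply: continuous_subspaceT => z; exact: continuous_sin.
by rewrite sin0 !subr0 => ->; rewrite ler_piMl ?cos_le1// ltW.
Qed.

Lemma mul_cos_le_sin x : 0 <= x <= pi -> x * cos x <= sin x.
Proof.
move=> /andP[]; rewrite le_eqVlt => /predU1P[<-|x0 xpi]; first by rewrite sin0 mul0r.
have d y : y \in `]0, x[%R ->
    is_derive y (1:R) (fun y => sin y - y * cos y) (y * sin y).
  move=> _; apply: is_derive_eq; rewrite /GRing.scale/=; ring.
have := @MVT R (fun y => sin y - y * cos y) _ 0 x x0 d.
case=> [|c].
  apply: continuous_subspaceT => z; apply: cvgB; first exact: continuous_sin.
  by apply: cvgM; [exact: cvg_id|exact: continuous_cos].
rewrite in_itv/= => /andP[c0 cx].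
rewrite sin0 mul0r !subr0 => e; rewrite -subr_ge0 e.
by rewrite !mulr_ge0 ?(ltW c0) ?(ltW x0)// sin_ge0_pi// (ltW c0)/= (le_trans (ltW cx)).
Qed.

(** Halving the angle replaces a Taylor expansion. With [t = x / 2], the bound [t cos t <= sin t]
    gives [x (cos t)^2 <= sin x], so the difference is at most [(sin t)^2 / (x (cos t)^2)], and
    [x <= pi / 2] keeps [(cos t)^2] at or above 1/2. *)
Lemma csc_sub_inv x : 0 < x <= pi / 2 -> 0 <= 1 / sin x - 1 / x <= x / 2.
Proof.
move=> /andP[x0 x1]; have p0 := pi_gt0 R.
have s1 : 0 < sin x by apply: sin_gt0_pi; apply/andP; split; lra.
have s2 : sin x <= x by apply: sin_le_id; exact: ltW.
apply/andP; split; first by rewrite subr_ge0 !div1r lef_pV2.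
have ch : 0 <= cos x by apply: cos_ge0_pihalf; apply/andP; split; lra.
set t := x / 2.
have xe : x = t + t by rewrite /t; field.
have t0 : 0 < t by rewrite /t; lra.
have st : sin t <= t by apply: sin_le_id; exact: ltW.
have st0 : 0 <= sin t by apply: sin_ge0_pi; rewrite /t; apply/andP; split; lra.
have ct : t * cos t <= sin t by apply: mul_cos_le_sin; rewrite /t; apply/andP; split; lra.
have ct0 : 0 <= cos t by apply: cos_ge0_pihalf; rewrite /t; apply/andP; split; lra.
have sc := cos2Dsin2 t.
have c2 : cos t ^+ 2 >= 1 / 2.
  move: ch; rewrite {1}xe cosD -!expr2; lra.
have lb : x * cos t ^+ 2 <= sin x.
  have -> : sin x = 2 * (sin t * cos t) by rewrite {1}xe sinD; ring.
  have -> : x * cos t ^+ 2 = 2 * ((t * cos t) * cos t) by rewrite {1}xe; ring.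
  by rewrite ler_pM2l// ler_wpM2r.
have h : 1 / sin x <= 1 / x / cos t ^+ 2.
  have c20 : 0 < cos t ^+ 2 by lra.
  by rewrite -mulrA -invfM !div1r lef_pV2// ?posrE// mulr_gt0.
apply: (le_trans (y := 1 / x / cos t ^+ 2 - 1 / x)); first lra.
have S2 : sin t ^+ 2 <= t ^+ 2 by rewrite ler_pXn2r ?nnegrE// ltW.
have xn : x != 0 by rewrite gt_eqF.
have cn : cos t ^+ 2 != 0 by rewrite gt_eqF//; lra.
have -> : 1 / x / cos t ^+ 2 - 1 / x = (sin t ^+ 2) / (x * cos t ^+ 2).
  have -> : sin t ^+ 2 = 1 - cos t ^+ 2 by lra.
  have cn' : cos t != 0 by apply: contraNneq cn => ->; rewrite expr0n.
  by field; rewrite xn cn'.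
rewrite ler_pdivrMr; last by rewrite mulr_gt0//; lra.
have -> : t * (x * cos t ^+ 2) = 2 * t ^+ 2 * cos t ^+ 2 by rewrite {1}xe; ring.
nra.
Qed.

Lemma csc_pi_sub_inv s : 0 < s <= 2^-1 ->
  0 <= pi / sin (pi * s) - s^-1 <= 8 * s.
Proof.
move=> /andP[s0 s1]; have p0 := pi_gt0 R.
have p4 : (pi : R) < 4 by have := pihalf_02 R; lra.
have /csc_sub_inv/andP[h1 h2] : 0 < pi * s <= pi / 2 by nra.
have e : s^-1 = pi * (1 / (pi * s)) by rewrite div1r invfM mulrA divff ?mul1r// gt_eqF.
rewrite e -[pi / sin _]/(pi * (sin (pi * s))^-1) -div1r -mulrBr mulr_ge0 ?(ltW p0)//=.
(* The 8 of the statement is [pi^2 / 2], bounded through [pi < 4]. *)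
apply: (le_trans (y := pi * (pi * s / 2))); first by rewrite ler_pM2l.
have : pi * pi <= 16 :> R by nra.
nra.
Qed.

Lemma csc_triple s : 0 < s < 1 -> pi / sin (pi * s) =
  3^-1 * (pi / sin (pi * (s / 3)) - pi / sin (pi * ((s + 1) / 3)) +
          pi / sin (pi * ((s + 2) / 3))) :> R.
Proof.
move=> /andP[s0 s1]; have p0 := pi_gt0 R.
have /sin3_csc : 0 < pi * (s / 3) < pi / 3 by nra.
have -> : 3 * (pi * (s / 3)) = pi * s by field.
have -> : pi * (s / 3) + pi / 3 = pi * ((s + 1) / 3) by field.
have -> : pi * (s / 3) + (pi / 3 + pi / 3) = pi * ((s + 2) / 3) by field.
move=> e; have -> : pi / sin (pi * s) = pi * 3^-1 * (3 / sin (pi * s)).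
  field; rewrite gt_eqF// sin_gt0_pi//; nra.
by rewrite e !div1r; ring.
Qed.

End csc_trig.

(** * Symmetry, bounds and triplication of the integral *)

Section J_integral.
Context {R : realType}.
Local Notation mu := (@lebesgue_measure R).
Implicit Types (s x a : R).

(** With [u = e^x] this is the integrand of [u^(s-1) / (1 + u) du] over the half-line, the Mellin
    transform of [1 / (1 + u)]. In the exponential variable a power weight only shifts [s]. *)
Definition Jfun s x : R := expR (s * x) / (1 + expR x).

Lemma Jfun_ge0 s x : 0 <= Jfun s x.
Proof. by rewrite divr_ge0 ?expR_ge0// addr_ge0 ?expR_ge0. Qed.

Lemma continuous_Jfun s : continuous (Jfun s).
Proof.
move=> x; apply: cvgM.
  apply: (continuous_comp (f := fun x => s * x) (g := expR)); last exact: continuous_expR.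
  by apply: cvgM; [exact: cvg_cst|exact: cvg_id].
apply: cvgV; first by rewrite gt_eqF// addr_gt0 ?expR_gt0.
by apply: cvgD; [exact: cvg_cst|exact: continuous_expR].
Qed.

Lemma continuous_expRM a : continuous (fun x : R => expR (a * x)).
Proof.
move=> x; apply: (continuous_comp (f := fun x => a * x) (g := expR)); last exact: continuous_expR.
by apply: cvgM; [exact: cvg_cst|exact: cvg_id].
Qed.

Lemma integral_expRN a : 0 < a ->
  (\int[mu]_(x in `[0%R, +oo[) (expR (- a * x))%:E = (a^-1)%:E)%E.
Proof.
move=> a0.
have dF x : is_derive x 1 (fun x => - a^-1 * expR (- a * x)) (expR (- a * x)).
  apply: is_derive_eq; rewrite /GRing.scale/=.
  by field; rewrite gt_eqF.
rewrite (@ge0_continuous_FTC2y _ _ (fun x => - a^-1 * expR (- a * x)) 0 0).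
- by rewrite mulr0 expR0 mulr1 EFinN sub0e oppeK.
- by move=> *; exact: expR_ge0.
- by apply: continuous_subspaceT; exact: continuous_expRM.
- rewrite -[X in _ --> X](mulr0 (- a^-1)); apply: cvgM; first exact: cvg_cst.
  have : (fun x => expR (- x)) \o (fun x => a * x) @ +oo --> (0:R).
    apply: cvg_comp; last exact: cvgr_expR.
    by apply: gt0_cvgMry => //; exact: cvg_id.
  by rewrite (_ : _ \o _ = fun x => expR (- a * x)) //; apply/funext => x /=; rewrite mulNr.
- by move=> x _; have [] := dF x.
- apply: cvg_at_right_filter; apply: cvgM; first exact: cvg_cst.
  exact: continuous_expRM.
- by move=> x _; rewrite derive1E; have [_ ->] := dF x.
Qed.

Lemma continuous_measurable_EFin (f : R -> R) (D : set (measurableTypeR R)) :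
  continuous f -> measurable_fun D (fun x => (f x)%:E).
Proof.
move=> cf; apply/measurable_EFinP; apply: measurable_funTS.
exact: continuous_measurable_fun.
Qed.

Lemma ge0_integralT_split (f : R -> R) : continuous f -> (forall x, 0 <= f x) ->
  (\int[mu]_x (f x)%:E =
   \int[mu]_(x in `[0%R, +oo[) (f x)%:E + \int[mu]_(x in `[0%R, +oo[) (f (- x))%:E)%E.
Proof.
move=> cf f0.
have mf : measurable_fun [set: R] f by exact: continuous_measurable_fun.
have cfN : continuous (fun x => f (- x)).
  by move=> x; apply: (continuous_comp (f := -%R) (g := f)); [exact: continuousN|exact: cf].
have mfN : measurable_fun [set: R] (fun x => f (- x)) by exact: continuous_measurable_fun.
have -> : (\int[mu]_(x in `[0%R, +oo[) (f (- x))%:E = \int[mu]_(x in `]-oo, 0%R]) (f x)%:E)%E.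
  rewrite (@ge0_integration_by_substitution0 _ (fun x => (f (- x))%:E)).
  - by under eq_integral do rewrite opprK.
  - exact/measurable_EFinP.
  - by move=> r; rewrite lee_fin.
rewrite -[in RHS]integral_itv_bndo_bndc; last exact/measurable_EFinP/measurable_funTS.
rewrite -ge0_integral_setU//=.
- by rewrite -[in LHS](setUv `[0%R, +oo[%classic) setCitvr.
- by rewrite -setCitvr setUv; exact/measurable_EFinP.
- by move=> x _; rewrite lee_fin.
- by rewrite -setCitvr; exact/disj_setPCl.
Qed.

Lemma ge0_integralT_scale (f : R -> R) (k : R) : continuous f -> (forall x, 0 <= f x) ->
  0 < k -> (\int[mu]_x (f (k * x))%:E = k^-1%:E * \int[mu]_x (f x)%:E)%E.
Proof.
move=> cf f0 k0.
have d x : is_derive x (1:R) (fun x => k * x) k.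
  by apply: is_derive_eq; rewrite /GRing.scale/= mulr1.
have d1 : derive1 (fun x : R => k * x) = cst k.
  by apply/funext => x; rewrite derive1E; have [_ ->] := d x.
have cfk : continuous (fun x => f (k * x)).
  move=> x; apply: (continuous_comp (f := fun x => k * x) (g := f)); last exact: cf.
  by apply: cvgM; [exact: cvg_cst|exact: cvg_id].
rewrite [in RHS](@increasing_ge0_integration_by_substitutionT R (fun x => k * x))//.
- rewrite d1 -ge0_integralZl//=.
  + by apply: eq_integral => x _; rewrite -EFinM; congr EFin; rewrite !fctE/=; field; rewrite gt_eqF.
  + apply: continuous_measurable_EFin => x.
    by apply: cvgM; [exact: cfk|exact: cvg_cst].
  + by move=> x _; rewrite lee_fin !fctE mulr_ge0// ltW.
  + by rewrite lee_fin invr_ge0 ltW.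
- by move=> x y xy; rewrite ltr_pM2l.
- by rewrite d1; exact: cst_continuous.
- by rewrite d1; exact: is_cvg_cst.
- by rewrite d1; exact: is_cvg_cst.
- by apply: gt0_cvgMrNy => //; exact: cvg_id.
- by apply: gt0_cvgMry => //; exact: cvg_id.
Qed.

Definition Jint s : \bar R := (\int[mu]_x (Jfun s x)%:E)%E.

Lemma JfunN s x : Jfun s (- x) = Jfun (1 - s) x.
Proof.
rewrite /Jfun expRN mulrN expRN mulrBl mul1r expRB.
have := expR_gt0 x; have := expR_gt0 (s * x).
move: (expR x) (expR (s * x)) => a b b0 a0; field.
by rewrite !gt_eqF// addr_gt0.
Qed.

Lemma Jint_sym s : Jint (1 - s) = Jint s.
Proof.
have sp t := ge0_integralT_split (@continuous_Jfun t) (@Jfun_ge0 t).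
have spN t : (\int[mu]_(x in `[0%R, +oo[) (Jfun t (- x))%:E =
    \int[mu]_(x in `[0%R, +oo[) (Jfun (1 - t) x)%:E)%E.
  by apply: eq_integral => x _; rewrite JfunN.
pose I t := (\int[mu]_(x in `[0%R, +oo[) (Jfun t x)%:E)%E.
have JI t : Jint t = (I t + I (1 - t)%R)%E.
  by rewrite /I -[X in (_ + X)%E]spN; exact: sp.
by rewrite !JI subKr addeC.
Qed.

(** Folding the line at 0 leaves [e^(-s x) + g x] on the half-line. The first term integrates to
    [1/s]; replacing [1 + e^x] by [e^x] in [g] gives the upper bound. Near 0 the integral thus
    differs from [1/s] by [O(s)], as the cosecant term does. *)
Lemma Jint_bounds s : 0 < s < 1 ->
  ((s^-1)%:E <= Jint s <= (s^-1 + ((1 - s)^-1 - (1 + s)^-1))%:E)%E.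
Proof.
move=> /andP[s0 s1].
have m a : measurable_fun (`[0%R, +oo[%classic : set (measurableTypeR R))
    (fun x : R => (expR (a * x))%:E).
  by apply: continuous_measurable_EFin; exact: continuous_expRM.
pose g x : R := (expR (s * x) - expR (- s * x)) / (1 + expR x).
have cg : continuous g.
  move=> x; apply: cvgM.
    by apply: cvgB; exact: continuous_expRM.
  apply: cvgV; first by rewrite gt_eqF// addr_gt0 ?expR_gt0.
  by apply: cvgD; [exact: cvg_cst|exact: continuous_expR].
have g0 x : x \in (`[0%R, +oo[%classic : set R) -> 0 <= g x.
  rewrite inE/= in_itv/= andbT => x0.
  apply: divr_ge0; last by rewrite addr_ge0 ?expR_ge0.
  by rewrite subr_ge0 ler_expR; nra.
have mg : measurable_fun (`[0%R, +oo[%classic : set (measurableTypeR R)) (fun x => (g x)%:E).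
  exact: continuous_measurable_EFin.
have JE : Jint s = ((s^-1)%:E + \int[mu]_(x in `[0%R, +oo[) (g x)%:E)%E.
  rewrite -integral_expRN// -ge0_integralD//=; last first.
    by move=> x x0; rewrite lee_fin g0// inE.
  rewrite /Jint ge0_integralT_split; [|exact: continuous_Jfun|exact: Jfun_ge0].
  have mJ t : measurable_fun (`[0%R, +oo[%classic : set (measurableTypeR R))
      (fun x : R => (Jfun t x)%:E).
    by apply: continuous_measurable_EFin; exact: continuous_Jfun.
  rewrite -ge0_integralD; [|exact: measurable_itv|
    by move=> x _; rewrite lee_fin Jfun_ge0|exact: mJ|
    by move=> x _; rewrite lee_fin Jfun_ge0|
    by rewrite (_ : (fun x => _) = (fun x => (Jfun (1 - s) x)%:E));
       [exact: mJ|apply/funext => x; rewrite JfunN]].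
    apply: eq_integral => x _; rewrite -!EFinD JfunN; congr EFin.
    rewrite /g /Jfun mulrBl mul1r expRB mulNr expRN.
    have := expR_gt0 x; have := expR_gt0 (s * x).
    move: (expR x) (expR (s * x)) => a b b0 a0; field.
    by rewrite !gt_eqF// addr_gt0.
rewrite JE EFinD; apply/andP; split.
  by rewrite leeDl// integral_ge0// => x x0; rewrite lee_fin g0// inE.
rewrite leeD2l// EFinB leeBrDr// -[X in (_ + X)%E]integral_expRN; last by rewrite addr_gt0.
rewrite -[X in (_ <= X)%E]integral_expRN ?subr_gt0// -ge0_integralD//=; last first.
  by move=> x x0; rewrite lee_fin g0// inE.
apply: ge0_le_integral => //=.
- by move=> x x0; rewrite adde_ge0// lee_fin ?expR_ge0// g0// inE.
- by apply: emeasurable_funD.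
- move=> x /=; rewrite in_itv/= andbT => x0.
  rewrite -EFinD lee_fin.
  rewrite mulNr opprB mulrDl mulrBl !mul1r opprD expRB expRD !expRN -[in leLHS]/(g x) /g mulNr expRN.
  have := expR_gt0 x; have := expR_gt0 (s * x).
  have : 1 <= expR (s * x) by rewrite -expR0 ler_expR mulr_ge0// ltW.
  move: (expR x) (expR (s * x)) => a b b1 b0 a0.
  have -> : a^-1 * b^-1 = b^-1 / a by rewrite mulrC.
  have h1 : b^-1 <= b by rewrite (le_trans _ b1)// invf_le1.
  have h2 : (1 + a)^-1 <= a^-1 by rewrite lef_pV2 ?posrE ?addr_gt0// lerDr.
  by rewrite -lerBrDr -mulrBl; apply: ler_wpM2l => //; rewrite subr_ge0.
Qed.

Lemma Jint_fin_num s : 0 < s < 1 -> Jint s \is a fin_num.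
Proof.
move=> s01; have /andP[h1 h2] := Jint_bounds s01.
by rewrite fin_numE; apply/andP; split; apply/eqP => e; rewrite e in h1 h2.
Qed.

(** This is [1 + y^3 = (1 + y) (1 - y + y^2)] at [y = e^x]. The negative term is moved to the left
    so that both sides integrate as nonnegative functions. *)
Lemma Jfun_triple s x : Jfun s x + Jfun ((s + 1) / 3) (3 * x) =
  Jfun (s / 3) (3 * x) + Jfun ((s + 2) / 3) (3 * x).
Proof.
rewrite /Jfun; have -> : s / 3 * (3 * x) = s * x by field.
have -> : (s + 1) / 3 * (3 * x) = s * x + x by field.
have -> : (s + 2) / 3 * (3 * x) = s * x + (x + x) by field.
have -> : 3 * x = x + (x + x) by ring.
rewrite !expRD.
have := expR_gt0 x; have := expR_gt0 (s * x).
move: (expR x) (expR (s * x)) => a b b0 a0; field.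
rewrite !gt_eqF//= ?addr_gt0// mulr_gt0// mulr_gt0//.
Qed.

Lemma Jint_triple s : 0 < s < 1 -> fine (Jint s) = 3^-1 *
  (fine (Jint (s / 3)) - fine (Jint ((s + 1) / 3)) + fine (Jint ((s + 2) / 3))).
Proof.
move=> /andP[s0 s1].
have m (t k : R) : measurable_fun [set: measurableTypeR R] (fun x : R => (Jfun t (k * x))%:E).
  apply: continuous_measurable_EFin => x.
  apply: (continuous_comp (f := fun x => k * x) (g := Jfun t)); last exact: continuous_Jfun.
  by apply: cvgM; [exact: cvg_cst|exact: cvg_id].
have sc t : (\int[mu]_x (Jfun t (3 * x))%:E = 3^-1%:E * Jint t)%E.
  by apply: ge0_integralT_scale => //; [exact: continuous_Jfun|exact: Jfun_ge0].
have e : (Jint s + 3^-1%:E * Jint ((s + 1) / 3) =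
   3^-1%:E * Jint (s / 3) + 3^-1%:E * Jint ((s + 2) / 3))%E.
  rewrite -(sc ((s + 1) / 3)) -(sc (s / 3)) -(sc ((s + 2) / 3)).
  have m1 t : measurable_fun [set: measurableTypeR R] (fun x : R => (Jfun t x)%:E).
    by apply: continuous_measurable_EFin; exact: continuous_Jfun.
  have J0 t (k x : R) : (0 <= (Jfun t (k * x))%:E)%E by rewrite lee_fin Jfun_ge0.
  have J1 t (x : R) : (0 <= (Jfun t x)%:E)%E by rewrite lee_fin Jfun_ge0.
  transitivity (\int[mu]_x ((Jfun s x)%:E + (Jfun ((s + 1) / 3) (3 * x))%:E))%E.
    by apply/esym/ge0_integralD.
  transitivity (\int[mu]_x ((Jfun (s / 3) (3 * x))%:E + (Jfun ((s + 2) / 3) (3 * x))%:E))%E.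
    by apply: eq_integral => x _; rewrite -!EFinD Jfun_triple.
  by apply: ge0_integralD.
have f1 : Jint s \is a fin_num by apply: Jint_fin_num; apply/andP; split.
have f2 : Jint ((s + 1) / 3) \is a fin_num by apply: Jint_fin_num; apply/andP; split; lra.
have f3 : Jint ((s + 2) / 3) \is a fin_num by apply: Jint_fin_num; apply/andP; split; lra.
have f4 : Jint (s / 3) \is a fin_num by apply: Jint_fin_num; apply/andP; split; lra.
move: f1 f2 f3 f4 e; clear.
move: (Jint s) (Jint ((s + 1) / 3)) (Jint ((s + 2) / 3)) (Jint (s / 3)).
move=> [a| |] [b| |] [c| |] [d| |] //= _ _ _ _.
rewrite -!EFinM -!EFinD => -[]; lra.
Qed.

Lemma fine_Jint_bounds s : 0 < s <= 2^-1 -> 0 <= fine (Jint s) - s^-1 <= 8 * s.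
Proof.
move=> /andP[s0 s1]; have s01 : 0 < s < 1 by apply/andP; split; lra.
have := Jint_bounds s01; rewrite -(fineK (Jint_fin_num s01)) !lee_fin.
move=> /andP[h1 h2]; apply/andP; split; first lra.
rewrite lerBlDl (le_trans h2)// lerD2l.
have -> : (1 - s)^-1 - (1 + s)^-1 = 2 * s / ((1 - s) * (1 + s)).
  by field; rewrite !gt_eqF//; lra.
rewrite ler_pdivrMr; nra.
Qed.

Lemma fine_JintE s : 0 < s < 1 -> fine (Jint s) = pi / sin (pi * s).
Proof.
pose h t : R := fine (Jint t) - pi / sin (pi * t).
have h1 t : 0 < t <= 2^-1 -> `|h t| <= 8 * t.
  move=> t0; have := fine_Jint_bounds t0; have := csc_pi_sub_inv t0.
  by move=> /andP[? ?] /andP[? ?]; rewrite ler_norml /h; apply/andP; split; lra.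
have hsym t : h (1 - t) = h t.
  rewrite /h Jint_sym; congr (_ - _ / _).
  rewrite mulrBr mulr1 sinB sinpi cospi; ring.
(* The symmetry [t -> 1 - t] carries the bound to the upper half of the interval, so [|h|] has a
   finite supremum. *)
have hb t : 0 < t < 1 -> `|h t| <= 4.
  move=> /andP[t0 t1]; have [t2|t2] := leP t 2^-1.
    by rewrite (le_trans (h1 _ _))//; [rewrite t0|lra].
  by rewrite -hsym (le_trans (h1 _ _))//; [apply/andP; split; lra|lra].
have aux (a b c a' b' c' : R) : 3^-1 * (a - b + c) - 3^-1 * (a' - b' + c') =
    3^-1 * ((a - a') - (b - b') + (c - c')) by ring.
have htri t : 0 < t < 1 -> h t = 3^-1 * (h (t / 3) - h ((t + 1) / 3) + h ((t + 2) / 3)).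
  move=> t01; rewrite /h (Jint_triple t01) (csc_triple t01).
  exact: aux.
(* Only the term at [t / 3] is expanded again; the two others are bounded by [M]. Their weight 2/3
   accumulates to [1 - 3^-k], while the argument of the remaining term goes to 0. *)
have step M : (forall t, 0 < t < 1 -> `|h t| <= M) -> forall k t, 0 < t < 1 ->
    `|h t| <= (1 - 3^-1 ^+ k) * M + 3^-1 ^+ k * `|h (3^-1 ^+ k * t)|.
  move=> hM; elim=> [|k IH] t t01; first by rewrite !expr0 subrr mul0r !mul1r add0r.
  have [t0 t1] := andP t01.
  have t3 : 0 < t / 3 < 1 by apply/andP; split; lra.
  have := IH _ t3; rewrite exprSr -mulrA [3^-1 * t]mulrC => IH3.
  have M1 : `|h ((t + 1) / 3)| <= M by apply: hM; apply/andP; split; lra.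
  have M2 : `|h ((t + 2) / 3)| <= M by apply: hM; apply/andP; split; lra.
  rewrite (htri _ t01) normrM ger0_norm//.
  have := ler_normD (h (t / 3) - h ((t + 1) / 3)) (h ((t + 2) / 3)).
  have := ler_normB (h (t / 3)) (h ((t + 1) / 3)).
  lra.
move=> s01; apply/eqP; rewrite -subr_eq0 -[_ - _]/(h s) -normr_le0.
pose S := [set `|h t| | t in [set t : R | 0 < t < 1]].
have supS : has_sup S.
  split; first by exists `|h s|, s.
  by exists 4 => _ [t /= t01 <-]; exact: hb.
have hS t : 0 < t < 1 -> `|h t| <= sup S.
  by move=> t01; apply: ub_le_sup; [case: supS|exists t].
(* With [M = sup S], only the share [3^-(k+1)] of the supremum survives cancellation, and the right
   side has that factor twice, once more from the linear bound [h1]. The exponent [k.+1] brings the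
   argument below 1/2, where [h1] applies. *)
have Sk k : sup S <= 8 * 3^-1 ^+ k.+1.
  have q0 : 0 < (3^-1 : R) ^+ k.+1 by rewrite exprn_gt0.
  have q3 : (3^-1 : R) ^+ k.+1 <= 3^-1.
    by rewrite exprS ler_piMr// exprn_ile1//; lra.
  have : sup S <= (1 - 3^-1 ^+ k.+1) * sup S + 3^-1 ^+ k.+1 * (8 * 3^-1 ^+ k.+1).
    apply: ge_sup; first by case: supS.
    move=> _ [t /= t01 <-]; rewrite (le_trans (step _ hS k.+1 _ t01))// lerD2l ler_pM2l//.
    have [t0 t1] := andP t01.
    rewrite (le_trans (h1 _ _))//; last by rewrite ler_pM2l// ler_piMr// ltW.
    apply/andP; split; first exact: mulr_gt0.
    by rewrite (le_trans (y := 3^-1))//; [rewrite (le_trans _ q3)// ler_piMr// ltW|lra].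
  rewrite mulrBl mul1r -lerBlDl opprB addrC subrK ler_pM2l//.
rewrite (le_trans (hS _ s01))//.
have : (fun k => 8 * 3^-1 ^+ k.+1 : R) @ \oo --> (8 * 0 : R).
  apply: cvgM; first exact: cvg_cst.
  rewrite (cvg_shiftS (fun k => (3^-1 : R) ^+ k)); apply: cvg_expr.
  by rewrite ger0_norm//; lra.
rewrite mulr0 => c; rewrite -(cvg_lim _ c)//; apply: limr_ge; first by apply/cvg_ex; exists 0.
by near=> k; exact: Sk.
Unshelve. all: by end_near.
Qed.

End J_integral.

(** * Layer-cake formula and regularly varying tails *)

Section layer_cake.
Context {R : realType}.
Local Notation mu := (@lebesgue_measure R).

Lemma ge0_integral_FTCNy (h H : R -> R) (y : R) : (forall x, 0 <= h x) ->
  continuous h -> (forall x : R, is_derive x (1 : R) H (h x)) -> H x @[x --> -oo] --> (0 : R) ->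
  (\int[mu]_(x in `]-oo, y]) (h x)%:E = (H y)%:E)%E.
Proof.
move=> h0 ch dH H0; rewrite -[y in LHS]opprK ge0_integration_by_substitutionNy.
- have dF x : is_derive x (1 : R) (fun x => - H (- x)) (h (- x)).
    have dN : is_derive x (1 : R) (-%R : R -> R) (-1) by apply: is_derive_eq.
    have := is_derive1_comp (dH (- x)) dN.
    by move=> d1; have := is_deriveN d1; rewrite mulrN1 opprK.
  rewrite (@ge0_continuous_FTC2y _ _ (fun x => - H (- x)) (- y) 0).
  + by rewrite opprK EFinN sub0e oppeK.
  + by move=> x _; exact: h0.
  + apply: continuous_subspaceT => x.
    by apply: (continuous_comp (f := -%R) (g := h)); [exact: continuousN|exact: ch].
  + rewrite -oppr0; apply: cvgN.
    apply: (cvg_comp (-%R) H _ H0); exact/cvgNrNy.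
  + by move=> x _; have [] := dF x.
  + have cF : {for (- y), continuous (fun x : R => - H (- x))}.
      by apply: differentiable_continuous; apply/derivable1_diffP; have [] := dF (- y).
    exact: cvg_at_right_filter.
  + by move=> x _; rewrite derive1E; have [_ ->] := dF x.
- exact: continuous_subspaceT.
- by move=> x _; exact: h0.
Qed.

Context d (Omega : measurableType d) (P : probability Omega R) (T : Omega -> R).
Hypothesis mT : measurable_fun setT T.

(** [H (ln (T / r))] is the integral of [h] up to [ln (T / r)], and Tonelli exchanges it with the
    expectation. On the logarithmic scale a power tail at [r e^x] factors into a power of [r] and an
    exponential of [x]. *)
Lemma layer_cake (h H : R -> R) (r : R) : 0 < r -> (forall x, 0 <= h x) ->
  continuous h -> (forall x : R, is_derive x (1 : R) H (h x)) -> H x @[x --> -oo] --> (0 : R) ->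
  (\int[P]_w (if 0 < T w then H (ln (T w / r)) else 0)%:E =
   \int[mu]_x ((h x)%:E * P [set w | r * expR x < T w]%R))%E.
Proof.
move=> r0 h0 ch dH H0.
pose A : set (Omega * measurableTypeR R) := [set p | r * expR p.2 < T p.1].
have mA : measurable A.
  have : measurable_fun setT (fun p : Omega * measurableTypeR R => r * expR p.2 < T p.1).
    apply: measurable_fun_ltr.
      apply: measurable_funM => //; apply: measurableT_comp; last exact: measurable_snd.
      exact: measurable_expR.
    by apply: measurableT_comp; [exact: mT|exact: measurable_fst].
  by move=> /(_ measurableT [set true]); rewrite setTI; apply.
pose f (p : Omega * measurableTypeR R) : \bar R := ((h p.2)%:E * (\1_A p)%:E)%E.
have f0 p : (0 <= f p)%E by rewrite mule_ge0// lee_fin.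
have mf : measurable_fun setT f.
  apply: emeasurable_funM.
    apply/measurable_EFinP; apply: (measurableT_comp (f := h)); last exact: measurable_snd.
    exact: continuous_measurable_fun.
  by apply/measurable_EFinP/measurable_indic.
transitivity (\int[P]_w \int[mu]_x f (w, x))%E.
  apply: eq_integral => w _.
  have [Tw|Tw] := ltP 0 (T w); last first.
    rewrite integral0_eq// => x _; rewrite /f indicE memNset ?mule0//.
    rewrite /A/= => Hlt; have : 0 < T w by rewrite (lt_trans _ Hlt)// mulr_gt0// expR_gt0.
    by rewrite ltNge Tw.
  transitivity (\int[mu]_(x in `]-oo, ln (T w / r)]) (h x)%:E)%E.
    by rewrite (ge0_integral_FTCNy _ h0 ch dH H0).
  rewrite -integral_itv_bndo_bndc; last first.
    exact: continuous_measurable_EFin.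
  rewrite integral_mkcond; apply: eq_integral => x _.
  rewrite patchE /f indicE.
  have e : ((w, x) \in A) = (x \in (`]-oo, ln (T w / r)[%classic : set R)).
    apply/idP/idP; rewrite !inE /A/= in_itv/=.
      by rewrite -{2}(expRK x) ltr_ln ?posrE ?expR_gt0 ?divr_gt0// ltr_pdivlMr// mulrC.
    by rewrite -{1}(expRK x) ltr_ln ?posrE ?expR_gt0 ?divr_gt0// ltr_pdivlMr// mulrC.
  by rewrite e; case: ifP => _; rewrite ?mule1 ?mule0.
rewrite (fubini_tonelli f)//; apply: eq_integral => x _.
rewrite /f /= ge0_integralZl_EFin//.
- rewrite integral_indic ?setIT//.
    by have := measurable_ysection x mA; rewrite ysectionE.
- have mp : measurable_fun setT (fun w : Omega => (w, x) : Omega * measurableTypeR R).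
    by apply/measurable_fun_pairP; split; [exact: measurable_id|exact: measurable_cst].
  have := measurableT_comp (@measurable_indic _ _ R setT _ mA) mp.
  by move=> /measurable_EFinP.
Qed.

End layer_cake.

Section psi.
Context {R : realType}.
Local Notation mu := (@lebesgue_measure R).
Implicit Types t r x a : R.

Definition psi t : R := t - ln (1 + t).

Lemma psi0 : psi 0 = 0. Proof. by rewrite /psi addr0 ln1 subrr. Qed.

Lemma psi_ge0 t : 0 <= t -> 0 <= psi t.
Proof. by move=> t0; rewrite subr_ge0 le_ln1Dx// (lt_le_trans _ t0). Qed.

(** With [s = sqrt (1 + t)], [ln s <= s - 1] gives [psi t >= (s - 1)^2], while
    [t^2 = (s + 1)^2 (s - 1)^2]. It lets [psi] dominate the quadratic error of the cut-off on
    outward jumps. *)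
Lemma sqr_le_psi t : 0 <= t -> t ^+ 2 <= 4 * (1 + t) * psi t.
Proof.
move=> t0; set s := Num.sqrt (1 + t).
have s2 : s ^+ 2 = 1 + t by rewrite sqr_sqrtr// addr_ge0.
have s1 : 1 <= s by rewrite -sqrtr1 ler_wsqrtr// lerDl.
have ls : ln s <= s - 1 by have := @le_ln1Dx R (s - 1); rewrite addrCA subrr addr0; apply; lra.
have -> : psi t = s ^+ 2 - 1 - 2 * ln s.
  by rewrite /psi -s2 lnXn ?(lt_le_trans _ s1)// mulr2n; lra.
have -> : t = s ^+ 2 - 1 by lra.
apply: (@le_trans _ _ (4 * s ^+ 2 * (s - 1) ^+ 2)).
  have -> : (s ^+ 2 - 1) ^+ 2 = (s + 1) ^+ 2 * (s - 1) ^+ 2 by ring.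
  by rewrite ler_wpM2r ?sqr_ge0//; nra.
have -> : 1 + (s ^+ 2 - 1) = s ^+ 2 by ring.
apply: ler_wpM2l; first by rewrite mulr_ge0 ?sqr_ge0.
have -> : (s - 1) ^+ 2 = s ^+ 2 - 1 - 2 * (s - 1) by ring.
lra.
Qed.

(** This is [psi] on the logarithmic scale of the layer-cake formula. Its derivative is [Jfun 2],
    which a tail of index [s] turns into [Jfun (2 - s)]. *)
Definition psie x : R := expR x - ln (1 + expR x).

Lemma is_derive_psie x : is_derive x (1 : R) psie (Jfun 2 x).
Proof.
have e1 : 0 < 1 + expR x by rewrite addr_gt0 ?expR_gt0.
have d1 : is_derive x (1 : R) (fun x : R => 1 + expR x) (expR x).
  by have := is_deriveD (is_derive_cst (1 : R) x (1 : R)) (is_derive_expR x); rewrite add0r.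
have d2 := is_derive1_ln e1.
have d3 := @is_derive1_comp R (@ln R) (fun x => 1 + expR x) x _ _ d2 d1.
have d4 := is_deriveB (is_derive_expR x) d3.
apply: is_derive_eq d4 _.
rewrite /Jfun mulrDl mul1r expRD /GRing.scale/=; field.
by rewrite gt_eqF.
Qed.

Lemma cvg_expRNy : expR x @[x --> -oo] --> (0 : R).
Proof. by apply/cvgyNP; exact: cvgr_expR. Qed.

Lemma psie_cvgNy : psie x @[x --> -oo] --> (0 : R).
Proof.
rewrite -[X in _ --> X]psi0.
suff : (psi \o expR) x @[x --> -oo] --> psi (0 : R) by [].
apply: continuous_cvg cvg_expRNy.
apply: cvgB; first exact: cvg_id.
suff : (@ln R \o (fun t => 1 + t)) t @[t --> (0 : R)] --> ln (1 + 0 : R) by [].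
apply: (@continuous_cvg _ _ _ _ _ (fun t : R => 1 + t) (@ln R) (1 + 0)).
  by apply: continuous_ln; rewrite addr0.
by apply: cvgD; [exact: cvg_cst|exact: cvg_id].
Qed.

Lemma Jfun_expRM s a x : Jfun s x * expR (a * x) = Jfun (s + a) x.
Proof. by rewrite /Jfun mulrDl expRD mulrAC. Qed.

Lemma measurable_ZJfun (s a : R) (D : set (measurableTypeR R)) :
  measurable_fun D (fun x : R => (a * Jfun s x)%:E).
Proof.
apply: continuous_measurable_EFin => x.
by apply: cvgM; [exact: cvg_cst|exact: continuous_Jfun].
Qed.

Lemma measurable_psi : measurable_fun setT psi.
Proof. by apply: measurable_funB => //; apply: measurableT_comp; [exact: measurable_ln|exact: measurable_funD]. Qed.

Lemma powR_expR a x r : 0 < r -> (r * expR x) `^ a = r `^ a * expR (a * x).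
Proof. by move=> r0; rewrite powRM ?expR_ge0 ?(ltW r0)//; rewrite [X in _ * X = _]/powR gt_eqF ?expR_gt0// expRK. Qed.

End psi.

(** * Expectations of [psi] and of powers under an asymptotic power tail *)

Section tail_estimates.
Context {R : realType} d (Omega : measurableType d) (P : probability Omega R)
  (T : Omega -> R).
Local Notation mu := (@lebesgue_measure R).
Hypothesis mT : measurable_fun setT T.
Local Notation p y := (fine (P [set w | y < T w]%R)).

Lemma measurable_gt (y : R) : measurable [set w | y < T w].
Proof.
have := measurable_fun_ltr (measurable_cst y) mT.
by move=> /(_ measurableT [set true]); rewrite setTI; apply.
Qed.

Lemma P_gtE (y : R) : P [set w | y < T w]%R = (p y)%:E.
Proof. by rewrite fineK// fin_num_measure//; exact: measurable_gt. Qed.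

Lemma p_le1 (y : R) : p y <= 1.
Proof. by rewrite -lee_fin -P_gtE probability_le1//; exact: measurable_gt. Qed.

Lemma p_ge0 (y : R) : 0 <= p y.
Proof. exact/fine_ge0/measure_ge0. Qed.

Variables (al c eps Y : R).
Hypothesis (Y0 : 0 < Y) (c0 : 0 < c) (eps0 : 0 <= eps).
Hypothesis tail : forall y, Y <= y -> `|y `^ al * p y - c| <= eps.

(** The tail is known only beyond [Y]; before it, [1 <= Y^k y^-k] bounds a probability. For [k > al]
    the added term is of lower order in the scale [r]. *)
Lemma p_upper (k y : R) : 0 <= k -> 0 < y ->
  p y <= (c + eps) * y `^ (- al) + Y `^ k * y `^ (- k).
Proof.
move=> k0 y0; have [yY|Yy] := leP Y y.
  have := tail yY; rewrite ler_norml => /andP[_ h].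
  have -> : p y = (y `^ al * p y) * y `^ (- al).
    by rewrite mulrAC powRN divff ?mul1r// gt_eqF// powR_gt0.
  rewrite (le_trans (y := (c + eps) * y `^ (- al)))//.
    by rewrite ler_wpM2r ?powR_ge0//; lra.
  by rewrite lerDl mulr_ge0 ?powR_ge0.
apply: (le_trans (p_le1 y)); rewrite -[leLHS]add0r; apply: lerD.
  by apply: mulr_ge0; [have := eps0; have := c0; lra|exact: powR_ge0].
rewrite powRN ler_pdivlMr ?powR_gt0// mul1r ge0_ler_powR// ?nnegrE ?ltW//.
Qed.

(** Before [Y] the missing mass is made up by [c y^-al <= c Y^(k - al) y^-k], again of lower order
    in the scale when [k > al]. *)
Lemma p_lower (k y : R) : al <= k -> 0 < y ->
  (c - eps) * y `^ (- al) <= p y + c * Y `^ (k - al) * y `^ (- k).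
Proof.
move=> k0 y0; have [yY|Yy] := leP Y y.
  have := tail yY; rewrite ler_norml => /andP[h _].
  have -> : p y = (y `^ al * p y) * y `^ (- al).
    by rewrite mulrAC powRN divff ?mul1r// gt_eqF// powR_gt0.
  rewrite (le_trans (y := y `^ al * p y * y `^ (- al)))//.
    by rewrite ler_wpM2r ?powR_ge0//; lra.
  by rewrite lerDl !mulr_ge0 ?powR_ge0 ?(ltW c0).
apply: (le_trans (y := c * y `^ (- al))).
  by apply: ler_wpM2r; [exact: powR_ge0|have := eps0; lra].
rewrite (le_trans (y := c * Y `^ (k - al) * y `^ (- k)))//; last by rewrite lerDr p_ge0.
rewrite -mulrA ler_pM2l//.
have -> : y `^ (- al) = y `^ (k - al) * y `^ (- k).
  have e : - al = (k - al) + - k by ring.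
  by rewrite {1}e powRD// (gt_eqF y0) implybT.
by rewrite ler_wpM2r ?powR_ge0// ge0_ler_powR ?subr_ge0 ?nnegrE ?(ltW Yy) ?(ltW y0) ?(ltW Y0).
Qed.

Definition posT (w : Omega) : R := Num.max (T w) 0.

Lemma measurable_posT : measurable_fun setT posT.
Proof. exact: measurable_maxr. Qed.

Lemma posT_ge0 w : 0 <= posT w. Proof. by rewrite le_max lexx orbT. Qed.

Lemma integral_psi_posT (r : R) : 0 < r -> (\int[P]_w (psi (posT w / r))%:E =
  \int[mu]_x ((Jfun 2 x)%:E * P [set w | r * expR x < T w]%R))%E.
Proof.
move=> r0; rewrite -(layer_cake P mT r0 (@Jfun_ge0 R 2) (@continuous_Jfun R 2) (@is_derive_psie R) psie_cvgNy).
apply: eq_integral => w _; rewrite /posT; case: ltP => Tw.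
  by rewrite /psie lnK ?posrE ?divr_gt0.
by rewrite mul0r psi0.
Qed.

Lemma measurable_Jfun_ccdf s (r : R) : measurable_fun [set: measurableTypeR R]
  (fun x : R => ((Jfun s x)%:E * P [set w | r * expR x < T w]%R)%E).
Proof.
apply: emeasurable_funM.
  by apply: continuous_measurable_EFin; exact: continuous_Jfun.
pose q (y : R) : R := p y.
suff mq : measurable_fun [set: measurableTypeR R] q.
  under eq_fun do rewrite P_gtE.
  apply/measurable_EFinP; apply: (measurableT_comp (f := q)) => //.
  by apply: measurable_funM => //; exact: measurable_expR.
apply: nonincreasing_measurable => // x y xy.
rewrite -lee_fin -!P_gtE le_measure ?inE//; try exact: measurable_gt.
by move=> w /=; exact: le_lt_trans.
Qed.

Lemma le_integral_psi (r k : R) : 0 < r -> 1 < al < 2 -> 1 < k < 2 ->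
  (\int[P]_w (psi (posT w / r))%:E <= ((c + eps) * r `^ (- al) * fine (Jint (2 - al)) +
     Y `^ k * r `^ (- k) * fine (Jint (2 - k)))%:E)%E.
Proof.
move=> r0 al12 k12; rewrite integral_psi_posT//.
have Jf (s : R) : 1 < s < 2 -> Jint (2 - s) = (fine (Jint (2 - s)))%:E.
  by move=> /andP[? ?]; rewrite fineK// Jint_fin_num//; apply/andP; split; lra.
have mJ s : measurable_fun [set: measurableTypeR R] (fun x : R => (Jfun s x)%:E).
  by apply: continuous_measurable_EFin; exact: continuous_Jfun.
have Z (s a : R) : 0 <= a -> (\int[mu]_x (a * Jfun s x)%:E = a%:E * Jint s)%E.
  move=> a0; under eq_integral do rewrite EFinM.
  by rewrite ge0_integralZl_EFin// => x _; rewrite lee_fin Jfun_ge0.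
set A := (c + eps) * r `^ (- al); set B := Y `^ k * r `^ (- k).
have A0 : 0 <= A by rewrite mulr_ge0 ?powR_ge0// addr_ge0// ltW.
have B0 : 0 <= B by rewrite mulr_ge0 ?powR_ge0.
rewrite EFinD (EFinM A) (EFinM B) -Jf// -Jf// -!Z// -ge0_integralD//=; first last.
- exact: measurable_ZJfun.
- by move=> x _; rewrite lee_fin mulr_ge0// Jfun_ge0.
- exact: measurable_ZJfun.
- by move=> x _; rewrite lee_fin mulr_ge0// Jfun_ge0.
apply: ge0_le_integral => //.
- by move=> x _; rewrite mule_ge0// lee_fin Jfun_ge0.
- exact: measurable_Jfun_ccdf.
- by apply: emeasurable_funD; exact: measurable_ZJfun.
- move=> x _; rewrite P_gtE -EFinM -EFinD lee_fin.
  have e0 : 0 < r * expR x by rewrite mulr_gt0 ?expR_gt0.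
  have k0 : 0 <= k by lra.
  have := p_upper k0 e0; rewrite !powR_expR// => h.
  have := ler_wpM2l (Jfun_ge0 2 x) h; move/le_trans; apply.
  rewrite -!Jfun_expRM /A /B le_eqVlt; apply/orP; left; apply/eqP; ring.
Qed.

Lemma ge_integral_psi (r k : R) : 0 < r -> 1 < al < 2 -> al <= k < 2 -> eps <= c ->
  (((c - eps) * r `^ (- al) * fine (Jint (2 - al)))%:E <= \int[P]_w (psi (posT w / r))%:E +
     (c * Y `^ (k - al) * r `^ (- k) * fine (Jint (2 - k)))%:E)%E.
Proof.
move=> r0 al12 k12 epsc; rewrite integral_psi_posT//.
have k12' : 1 < k < 2 by lra.
have Jf (s : R) : 1 < s < 2 -> Jint (2 - s) = (fine (Jint (2 - s)))%:E.
  by move=> /andP[? ?]; rewrite fineK// Jint_fin_num//; apply/andP; split; lra.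
have mJ s : measurable_fun [set: measurableTypeR R] (fun x : R => (Jfun s x)%:E).
  by apply: continuous_measurable_EFin; exact: continuous_Jfun.
have mZ s a : measurable_fun [set: measurableTypeR R] (fun x : R => (a * Jfun s x)%:E).
  exact: measurable_ZJfun.
have Z (s a : R) : 0 <= a -> (\int[mu]_x (a * Jfun s x)%:E = a%:E * Jint s)%E.
  move=> a0; under eq_integral do rewrite EFinM.
  by rewrite ge0_integralZl_EFin// => x _; rewrite lee_fin Jfun_ge0.
set A := (c - eps) * r `^ (- al); set B := c * Y `^ (k - al) * r `^ (- k).
have A0 : 0 <= A by rewrite mulr_ge0 ?powR_ge0// subr_ge0.
have B0 : 0 <= B by rewrite !mulr_ge0 ?powR_ge0// ltW.
rewrite (EFinM A) (EFinM B) -Jf// -Jf// -!Z// -ge0_integralD//=; first last.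
- by move=> x _; rewrite lee_fin mulr_ge0// Jfun_ge0.
- exact: measurable_Jfun_ccdf.
- by move=> x _; rewrite mule_ge0// lee_fin Jfun_ge0.
apply: ge0_le_integral => //.
- by move=> x _; rewrite lee_fin mulr_ge0// Jfun_ge0.
- by apply: emeasurable_funD => //; exact: measurable_Jfun_ccdf.
- move=> x _; rewrite P_gtE -EFinM -EFinD lee_fin.
  have e0 : 0 < r * expR x by rewrite mulr_gt0 ?expR_gt0.
  have k0 : al <= k by lra.
  have := p_lower k0 e0; rewrite !powR_expR// => h.
  have := ler_wpM2l (Jfun_ge0 2 x) h; rewrite -!Jfun_expRM /A /B; lra.
Qed.

(** The layer-cake integrand is dominated by a multiple of [Jfun (1 + nu - al)], whose integral is
    known to be finite: for [x <= 0] by [p <= 1] and [al > 1], for [x > 0] by [p <= D e^(-al x)].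
    The factor 2 compares [1 + e^x] with the larger of its two terms. *)
Lemma le_integral_posT_powR (nu : R) : 1 < al < 2 -> 1 < nu < al ->
  (\int[P]_w (posT w `^ nu)%:E <=
    (2 * nu * (1 + c + eps + Y `^ al) * fine (Jint (1 + nu - al)))%:E)%E.
Proof.
move=> al12 nu1.
have nu0 : 0 < nu by lra.
have s01 : 0 < 1 + nu - al < 1 by lra.
have -> : (\int[P]_w (posT w `^ nu)%:E =
    \int[mu]_x ((nu * expR (nu * x))%:E * P [set w | 1 * expR x < T w]%R))%E.
  have h0 x : 0 <= nu * expR (nu * x) by rewrite mulr_ge0 ?expR_ge0// ltW.
  have hc : continuous (fun x : R => nu * expR (nu * x)).
    by move=> x; apply: cvgM; [exact: cvg_cst|exact: continuous_expRM].
  have hd (x : R) : is_derive x (1 : R) (fun x : R => expR (nu * x)) (nu * expR (nu * x)).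
    by apply: is_derive_eq; rewrite /GRing.scale/= mulr1 mulrC.
  have hl : expR (nu * x) @[x --> -oo] --> (0 : R).
    apply: (@cvg_comp _ _ _ (fun x : R => nu * x) expR); last exact: cvg_expRNy.
    by apply: gt0_cvgMrNy => //; exact: cvg_id.
  rewrite -(layer_cake P mT ltr01 h0 hc hd hl).
  apply: eq_integral => w _; rewrite /posT divr1; case: ltP => Tw.
    by rewrite /powR gt_eqF.
  by rewrite powR0// gt_eqF.
set C := 2 * nu * _.
have C0 : 0 <= C.
  apply: mulr_ge0; first by apply: mulr_ge0; rewrite ?ltW.
  by have := powR_ge0 Y al; have := c0; have := eps0; lra.
have mJ s : measurable_fun [set: measurableTypeR R] (fun x : R => (Jfun s x)%:E).
  by apply: continuous_measurable_EFin; exact: continuous_Jfun.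
rewrite EFinM fineK ?Jint_fin_num// /Jint -ge0_integralZl_EFin//; last first.
  by move=> x _; rewrite lee_fin Jfun_ge0.
apply: ge0_le_integral => //.
- by move=> x _; rewrite mule_ge0// lee_fin mulr_ge0 ?expR_ge0// ltW.
(* Measurability is taken from the product with [Jfun 2], by dividing out that positive factor. *)
- have := measurable_Jfun_ccdf 2 1.
  have me : measurable_fun [set: measurableTypeR R]
     (fun x : R => (nu * expR (nu * x) / Jfun 2 x)%:E).
    apply: continuous_measurable_EFin => x.
    apply: cvgM.
      by apply: cvgM; [exact: cvg_cst|exact: continuous_expRM].
    apply: cvgV; last exact: continuous_Jfun.
    by rewrite /Jfun mulf_neq0// ?invr_eq0 gt_eqF ?addr_gt0 ?expR_gt0.
  move=> /(emeasurable_funM me); apply: eq_measurable_fun => x _.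
  rewrite muleA -EFinM divfK//.
  by rewrite /Jfun mulf_neq0// ?invr_eq0 gt_eqF ?addr_gt0 ?expR_gt0.
- by apply: measurable_funeM.
- move=> x _; rewrite P_gtE mul1r -!EFinM lee_fin.
  set D := 1 + c + eps + Y `^ al.
  have D1 : 1 <= D by rewrite /D; have := powR_ge0 Y al; have := c0; have := eps0; lra.
  have ex := expR_gt0 x.
  have hp : p (expR x) <= D * expR (- al * x).
    have al0 : 0 <= al by lra.
    have := p_upper al0 ex; rewrite -!expRM (_ : x * - al = - al * x); last by ring.
    move=> /le_trans; apply; rewrite -mulrDl ler_wpM2r ?expR_ge0// /D.
    by have := c0; have := eps0; lra.
  have hx : expR (nu * x) * p (expR x) <= 2 * D * Jfun (1 + nu - al) x.
    rewrite /Jfun mulrA ler_pdivlMr ?addr_gt0//.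
    have [x0|x0] := leP x 0.
      have e1 : expR x <= 1 by rewrite expR_le1.
      have h1 : expR (nu * x) <= expR ((1 + nu - al) * x).
        by rewrite ler_expR; have [? ?] := andP nu1; have [? ?] := andP al12; nra.
      have h2 := p_le1 (expR x); have h3 := p_ge0 (expR x).
      have h4 := expR_gt0 (nu * x); have h5 := expR_gt0 ((1 + nu - al) * x).
      apply: (@le_trans _ _ (expR (nu * x) * 1 * (1 + 1))).
        apply: ler_pM; rewrite ?mulr_ge0 ?addr_ge0 ?(ltW h4) ?(ltW ex)//.
          by rewrite ler_pM2l.
        by rewrite lerD2l.
      rewrite mulr1 mulrC -[1 + 1]/(2 : R) -mulrA ler_pM2l//.
      by rewrite (le_trans h1)// ler_peMl// ltW.
    have e1 : 1 <= expR x by rewrite -expR0 ler_expR ltW.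
    have E1 : expR ((1 + nu - al) * x) = expR x * expR (nu * x) * expR (- al * x).
      by rewrite -!expRD; congr expR; ring.
    rewrite E1; have h4 := expR_gt0 (nu * x); have h5 := expR_gt0 (- al * x).
    apply: (@le_trans _ _ (expR (nu * x) * (D * expR (- al * x)) * (2 * expR x))).
      apply: ler_pM; rewrite ?mulr_ge0 ?addr_ge0 ?(ltW h4) ?(ltW ex) ?p_ge0//.
        by rewrite ler_pM2l.
      lra.
    by rewrite le_eqVlt; apply/orP; left; apply/eqP; ring.
  rewrite /C -/D.
  have -> : 2 * nu * D * Jfun (1 + nu - al) x = nu * (2 * D * Jfun (1 + nu - al) x) by ring.
  by rewrite -[leLHS]mulrA ler_pM2l.
Qed.

End tail_estimates.

(** * Power functions and their expansions *)

Section powR_aux.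
Context {R : realType}.
Implicit Types a x y t r nu : R.

Lemma powR_eventually_ge a (D : R) : 0 < a ->
  exists R0 : R, 1 <= R0 /\ forall r, R0 <= r -> D <= r `^ a.
Proof.
move=> a0; pose D1 := Num.max D 1.
have D10 : 0 <= D1 by rewrite le_max ler01 orbT.
exists (Num.max 1 (D1 `^ a^-1)); split; first by rewrite le_max lexx.
move=> r; rewrite ge_max => /andP[r1 h].
rewrite (le_trans (y := D1)) ?le_max ?lexx//.
have -> : D1 = (D1 `^ a^-1) `^ a by rewrite -powRrM mulVf ?gt_eqF// powRr1.
by rewrite ge0_ler_powR ?(ltW a0) ?nnegrE ?powR_ge0// (le_trans _ r1).
Qed.

Lemma powRN_eventually_le a (D : R) : 0 < a -> 0 < D ->
  exists R0 : R, 1 <= R0 /\ forall r, R0 <= r -> r `^ (- a) <= D.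
Proof.
move=> a0 D0; have [R0 [R01 h]] := @powR_eventually_ge a D^-1 a0.
exists R0; split=> // r rR; have := h _ rR => h1.
have r0 : 0 < r by rewrite (lt_le_trans _ rR)// (lt_le_trans _ R01).
by rewrite powRN -[leRHS]invrK lef_pV2// ?posrE ?invr_gt0 ?powR_gt0.
Qed.

(** With [x = e^y], tangent lines of the exponential give [e^y >= e^(nu y) (1 + (1 - nu) y)] and
    [1 >= e^(nu y) (1 - nu y)]; averaging with weights [nu] and [1 - nu] cancels [y]. *)
Lemma powR_bernoulli_le x nu : 0 <= x -> 0 <= nu <= 1 -> x `^ nu <= 1 + nu * (x - 1).
Proof.
move=> x0 /andP[nu0 nu1]; have [->|xn] := eqVneq x 0.
  have [->|nun] := eqVneq nu 0; first by rewrite powRr0 mul0r addr0.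
  by rewrite powR0//; lra.
have xp : 0 < x by rewrite lt_neqAle eq_sym xn.
rewrite /powR (negbTE xn) -{2}(lnK xp); move: (ln x) => y.
have h1 := expR_ge1Dx (y - nu * y); have h2 := expR_ge1Dx (- (nu * y)).
have e1 : expR y = expR (y - nu * y) * expR (nu * y) by rewrite -expRD subrK.
have e2 : expR (- (nu * y)) * expR (nu * y) = 1 by rewrite -expRD addNr expR0.
have m0 := expR_gt0 (nu * y); rewrite e1.
suff : 1 <= nu * expR (y - nu * y) + (1 - nu) * expR (- (nu * y)).
  by move=> /(ler_wpM2r (ltW m0)); rewrite mulrDl -!mulrA e2; lra.
have := ler_wpM2l nu0 h1; have nu1' : 0 <= 1 - nu by lra.
by have := ler_wpM2l nu1' h2; nra.
Qed.

Lemma expR_ge1Dx2 x : 0 <= x -> 1 + x + x ^+ 2 / 2 <= expR x.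
Proof.
rewrite le_eqVlt => /predU1P[<-|x0]; first by rewrite expr0n/= mul0r !addr0 expR0.
have d y : y \in `]0, x[%R ->
  is_derive y (1:R) (fun y : R => expR y - y - y ^+ 2 / 2) (expR y - 1 - y).
  by move=> _; apply: is_derive_eq; rewrite /GRing.scale/=; field.
have [|c] := MVT x0 d.
  apply: continuous_subspaceT => z; apply: cvgB; last first.
    by apply: cvgM; [apply: exprn_continuous|exact: cvg_cst].
  by apply: cvgB; [exact: continuous_expR|exact: cvg_id].
rewrite expR0 expr0n/= mul0r !subr0 => _ e.
have h := expR_ge1Dx c.
have : 0 <= (expR c - 1 - c) * x by apply: mulr_ge0; lra.
by rewrite -e; lra.
Qed.

(** In terms of [s = ln (1 + t)] the right side is [1 - nu s + nu^2 psi t], and [psi t >= s^2 / 2],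
    so this follows from the second-order bound on [e^(-nu s)]. Relative to the linear term, [psi]
    carries the factor [1 + nu], as close to 1 as desired. *)
Lemma powRN_1D_le t nu : 0 <= t -> 0 <= nu ->
  (1 + t) `^ (- nu) <= 1 - nu * t + nu * (1 + nu) * psi t.
Proof.
move=> t0 nu0; set s := ln (1 + t).
have t1 : 0 < 1 + t by lra.
have s0 : 0 <= s by apply: ln_ge0; lra.
have es : 1 + t = expR s by rewrite lnK.
have ts : 1 + s + s ^+ 2 / 2 <= 1 + t by rewrite es expR_ge1Dx2.
have -> : (1 + t) `^ (- nu) = (expR (nu * s))^-1.
  by rewrite /powR gt_eqF// -/s mulNr expRN.
set a := nu * s; have a0 : 0 <= a by rewrite mulr_ge0.
have e2 := expR_ge1Dx2 a0.
apply: (@le_trans _ _ (1 - a + a ^+ 2 / 2)).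
  have q0 : 0 < 1 + a + a ^+ 2 / 2 by nra.
  apply: (@le_trans _ _ (1 + a + a ^+ 2 / 2)^-1); first by rewrite lef_pV2 ?posrE ?expR_gt0.
  rewrite -div1r ler_pdivrMr//.
  have -> : (1 - a + a ^+ 2 / 2) * (1 + a + a ^+ 2 / 2) = 1 + a ^+ 4 / 4 by field.
  by rewrite lerDl divr_ge0// exprn_ge0.
rewrite /psi -/s /a; nra.
Qed.

Lemma powRN_1B_le t nu : 0 <= t <= 2^-1 -> 0 <= nu <= 1 ->
  (1 - t) `^ (- nu) <= 1 + nu * t + 2 * t ^+ 2.
Proof.
move=> /andP[t0 t1] nu01; have [nu0 nu1] := andP nu01.
have u0 : 0 < 1 - t by lra.
have -> : (1 - t) `^ (- nu) = ((1 - t)^-1) `^ nu.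
  by rewrite -(powR_inv1 (ltW u0)) -powRrM mulN1r.
apply: (le_trans (powR_bernoulli_le _ nu01)); first by rewrite invr_ge0 ltW.
rewrite -addrA lerD2l.
have -> : (1 - t)^-1 - 1 = t + t ^+ 2 / (1 - t) by field; rewrite gt_eqF.
have h : t ^+ 2 / (1 - t) <= 2 * t ^+ 2 by rewrite ler_pdivrMr//; nra.
have : 0 <= t ^+ 2 / (1 - t) by rewrite divr_ge0 ?sqr_ge0// ltW.
nra.
Qed.

(** For [|t| > 1] the last term dominates; otherwise [(1 + t)^nu = (1 + t) (1 + t)^(nu - 1)] reduces
    to Bernoulli's inequality. *)
Lemma powR_1D_le t nu : 1 <= nu <= 2 ->
  `|1 + t| `^ nu <= 1 + nu * t + 4 * `|t| `^ nu.
Proof.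
move=> /andP[nu1 nu2]; have nu0 : 0 < nu by lra.
have [t1|t1] := ltP t (-1).
  have -> : `|1 + t| = - (1 + t) by rewrite ltr0_norm//; lra.
  have -> : `|t| = - t by rewrite ltr0_norm//; lra.
  have h : (- (1 + t)) `^ nu <= (- t) `^ nu.
    by rewrite ge0_ler_powR ?nnegrE; lra.
  have h2 : - t <= (- t) `^ nu by apply: le1r_powR; lra.
  have : - t * nu <= (- t) * 2 by rewrite ler_pM2l//; lra.
  lra.
have [t2|t2] := leP t 1; last first.
  have -> : `|1 + t| = 1 + t by rewrite gtr0_norm//; lra.
  have -> : `|t| = t by rewrite gtr0_norm//; lra.
  apply: (@le_trans _ _ ((2 * t) `^ nu)); first by rewrite ge0_ler_powR ?nnegrE; lra.
  rewrite powRM//; last by lra.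
  have : 2 `^ nu <= 4 :> R.
    have -> : (4 : R) = 2 `^ 2 by rewrite powR_mulrn//; ring.
    by rewrite ler_powR//; lra.
  have := powR_ge0 t nu; nra.
have -> : `|1 + t| = 1 + t by rewrite ger0_norm//; lra.
have [e|tn] := eqVneq (1 + t) 0.
  have {e}-> : t = -1 by lra.
  by rewrite subrr powR0 ?gt_eqF// normrN1 powR1; lra.
have -> : (1 + t) `^ nu = (1 + t) * (1 + t) `^ (nu - 1).
  by rewrite mulr_powRB1//; lra.
have nub : 0 <= nu - 1 <= 1 by lra.
have h1 : 0 <= 1 + t by lra.
have h := powR_bernoulli_le h1 nub.
have t2le : t ^+ 2 <= `|t| `^ nu.
  rewrite -real_normK ?num_real// -powR_mulrn//.
  have [->|tt] := eqVneq `|t| 0; first by rewrite !powR0// gt_eqF.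
  apply: ger_powR => //; rewrite lt_neqAle eq_sym tt normr_ge0/= ler_norml; lra.
have := ler_wpM2l h1 h; nra.
Qed.

(** Outward, [ln (1 + t) = t - psi t] is exact, hence the sharp constant. Inward, concavity suffices
    for jumps shorter than [r]; beyond, the last term pays for reaching or crossing the origin. *)
Lemma ln_max_drift_le (r T : R) : expR 1 <= r ->
  ln (Num.max `|r + T| 1) <= ln r + T / r - psi (Num.max T 0 / r) +
     2 * (if 1 <= - T / r then - T / r else 0).
Proof.
move=> re; have r0 : 0 < r by rewrite (lt_le_trans _ re)// expR_gt0.
have r1 : 1 <= r by rewrite (le_trans _ re)// ltW// expR_gt1.
(* Serves the case where the maximum is 1: there [0 <= ln r - t] is needed for [t < 1]. *)
have lr : 1 <= ln r by rewrite -(expRK 1) ler_ln ?posrE ?expR_gt0.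
have [T0|T0] := leP 0 T.
  have rT : 1 <= `|r + T| by rewrite ger0_norm; lra.
  rewrite max_l// /psi.
  have q : 0 < 1 + T / r by rewrite ltr_wpDr// divr_ge0// ltW.
  have -> : `|r + T| = r * (1 + T / r).
    rewrite ger0_norm; last by lra.
    by field; rewrite gt_eqF.
  rewrite lnM ?posrE//.
  case: ifP => [|_]; last by rewrite mulr0; lra.
  rewrite mulNr => h; have : 0 <= T / r by rewrite divr_ge0// ltW.
  lra.
rewrite mul0r psi0 subr0.
set t := - T / r.
have Te : T = - (t * r) by rewrite /t; field; rewrite gt_eqF.
have t0 : 0 < t by rewrite divr_gt0// oppr_gt0.
have -> : T / r = - t by rewrite /t mulNr opprK.
clearbody t.
have -> : `|r + T| = r * `|1 - t|.
  by rewrite -{2}(gtr0_norm r0) -normrM; congr `|_|; rewrite Te; ring.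
case: ifP => [t1|/negbT]; last rewrite -ltNge => t1.
  apply: (@le_trans _ _ (ln (r * t))).
    rewrite ler_ln ?posrE ?lt_max ?ltr01 ?orbT ?mulr_gt0//.
    rewrite ge_max; apply/andP; split; last by nra.
    by rewrite ler_pM2l// ler_norml; apply/andP; split; lra.
  rewrite lnM ?posrE//; have := @le_ln1Dx R (t - 1); rewrite addrCA subrr addr0.
  by move=> h; have := h _; lra.
rewrite mulr0 addr0.
have [h|h] := leP 1 (r * `|1 - t|).
  rewrite ger0_norm; last by lra.
  rewrite lnM ?posrE//; last by lra.
  by rewrite lerD2l; have := @le_ln1Dx R (- t); apply; lra.
rewrite ln1; lra.
Qed.

(** A cut-off equal to 1 below 1/2 and to 0 above 1. Its quadratic contact with 0 at 1 leaves only a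
    second-order error after the mean, and the bound 1 tames long inward jumps. *)
Definition phi (u : R) : R := Num.min 1 (4 * Num.max (1 - u) 0 ^+ 2).

Lemma phi_ge0 u : 0 <= phi u.
Proof. by rewrite le_min ler01 mulr_ge0// sqr_ge0. Qed.

Lemma phi_le1 u : phi u <= 1. Proof. by rewrite ge_min lexx. Qed.

Lemma phi_eq0 u : 1 <= u -> phi u = 0.
Proof. by move=> u1; rewrite /phi [X in 4 * X ^+ 2]max_r ?subr_le0// expr0n/= mulr0 min_r. Qed.

Lemma phi_eq1 u : u <= 2^-1 -> phi u = 1.
Proof.
move=> u1; rewrite /phi [X in 4 * X ^+ 2]max_l; last by lra.
by rewrite min_l//; nra.
Qed.

(** The square of a positive part obeys the quadratic bound [sq]. Its term [v^2] is absorbed by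
    [psi v] for [0 <= v <= 1] and by [|v|^be] for [-1 <= v < 0]. For [v > 1] the linear term is
    absorbed by [psi v], and for [v < -1] the bound [phi <= 1] is enough. *)
Lemma phi_drift_le (u v be : R) : 2^-1 <= u -> 1 <= be <= 2 ->
  phi `|u + v| <= phi u - 8 * Num.max (1 - u) 0 * v + 32 * psi (Num.max v 0)
    + 4 * (Num.max (- v) 0) `^ be.
Proof.
move=> u1 /andP[be1 be2]; set a := 1 - u.
have ha : Num.max a 0 <= 2^-1 by rewrite ge_max /a; apply/andP; split; lra.
have ha0 : 0 <= Num.max a 0 by rewrite le_max lexx orbT.
have pu : phi u = 4 * Num.max a 0 ^+ 2.
  by rewrite /phi min_r// -/a; nra.
have p1 : phi `|u + v| <= 1 by exact: phi_le1.
have pq : phi `|u + v| <= 4 * Num.max (a - v) 0 ^+ 2.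
  have -> : a - v = 1 - (u + v) by rewrite /a; ring.
  have [uv|uv] := leP 0 (u + v); first by rewrite ger0_norm// /phi ge_min lexx orbT.
  rewrite (le_trans p1)// [X in 4 * X ^+ 2]max_l; last by lra.
  nra.
have sq : Num.max (a - v) 0 ^+ 2 <= Num.max a 0 ^+ 2 - 2 * Num.max a 0 * v + v ^+ 2.
  by have [a0|a0] := leP 0 a; have [h|h] := leP 0 (a - v); nra.
have [v0|v0] := leP 0 v.
  rewrite [X in X `^ be]max_r; last by lra.
  rewrite powR0 ?mulr0 ?addr0; last by rewrite gt_eqF//; lra.
  have ps := sqr_le_psi v0; have ps0 := psi_ge0 v0.
  rewrite pu; have [v1|v1] := leP v 1.
    have : v ^+ 2 <= 8 * psi v by nra.
    nra.
  have vps : v <= 8 * psi v.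
    have h : v * v <= v * (8 * psi v) by nra.
    by rewrite -(ler_pM2l (x := v))//; lra.
  have : Num.max (a - v) 0 <= Num.max a 0.
    by rewrite ge_max !le_max lexx orbT andbT; apply/orP; left; lra.
  have : 0 <= Num.max (a - v) 0 by rewrite le_max lexx orbT.
  nra.
rewrite psi0 mulr0 addr0 [X in X `^ be]max_l; last by lra.
rewrite pu; have [v1|v1] := leP (- v) 1.
  have : v ^+ 2 <= (- v) `^ be.
    rewrite -sqrrN -powR_mulrn; last by lra.
    by apply: ger_powR => //; lra.
  nra.
have : 1 <= (- v) `^ be by rewrite -(powRr0 (- v)) ler_powR//; lra.
nra.
Qed.

End powR_aux.

(** * Drifts of the Lyapunov functions *)

Section affine_bound.
Context {R : realType} d (Omega : measurableType d) (P : probability Omega R).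

Lemma ge0_integrable_EFin (f : Omega -> R) (C : R) : measurable_fun setT f ->
  (forall w, 0 <= f w) -> (\int[P]_w (f w)%:E <= C%:E)%E ->
  P.-integrable setT (EFin \o f) /\ exists2 e : R, (\int[P]_w (f w)%:E = e%:E)%E & 0 <= e <= C.
Proof.
move=> mf f0 fC.
have i0 : (0 <= \int[P]_w (f w)%:E)%E by apply: integral_ge0 => w _; rewrite lee_fin.
split.
  apply/integrableP; split; first exact/measurable_EFinP.
  under eq_integral do rewrite /= ger0_norm//.
  by rewrite (le_lt_trans fC)// ltry.
exists (fine (\int[P]_w (f w)%:E)); last first.
  have fi : (\int[P]_w (f w)%:E)%E \is a fin_num.
    by rewrite ge0_fin_numE// (le_lt_trans fC)// ltry.
  by rewrite -!lee_fin fineK// i0.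
by rewrite fineK// ge0_fin_numE// (le_lt_trans fC)// ltry.
Qed.

(** Common form of the drift estimates: [U] carries the outward jumps beyond the linear term, [N]
    the inward ones. *)
Lemma le_integral_affine (g T U N : Omega -> R) (a b k l m e n : R) :
  measurable_fun setT g -> (forall w, 0 <= g w) ->
  P.-integrable setT (EFin \o T) -> (\int[P]_w (T w)%:E = m%:E)%E ->
  P.-integrable setT (EFin \o U) -> (\int[P]_w (U w)%:E = e%:E)%E ->
  P.-integrable setT (EFin \o N) -> (\int[P]_w (N w)%:E = n%:E)%E ->
  (forall w, g w <= a + b * T w + k * U w + l * N w) ->
  (\int[P]_w (g w)%:E <= (a + b * m + k * e + l * n)%:E)%E.
Proof.
move=> mg g0 iT mE iU eE iN nE gle.
have Z (c : R) (f : Omega -> R) (v : R) : P.-integrable setT (EFin \o f) ->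
    (\int[P]_w (f w)%:E = v%:E)%E ->
    P.-integrable setT (fun w => (c * f w)%:E) /\
    (\int[P]_w (c * f w)%:E = (c * v)%:E)%E.
  move=> fi fv; split.
    by have := integrableZl measurableT c fi; apply: eq_integrable => // w _; rewrite EFinM.
  under eq_integral do rewrite EFinM.
  by rewrite (@integralZl _ _ _ P _ measurableT _ fi c) fv.
have A (f h : Omega -> R) (u v : R) : P.-integrable setT (fun w => (f w)%:E) ->
    (\int[P]_w (f w)%:E = u%:E)%E -> P.-integrable setT (fun w => (h w)%:E) ->
    (\int[P]_w (h w)%:E = v%:E)%E ->
    P.-integrable setT (fun w => (f w + h w)%:E) /\
    (\int[P]_w (f w + h w)%:E = (u + v)%:E)%E.
  move=> fi fu hi hv; split.
    by have := integrableD measurableT fi hi; apply: eq_integrable => // w _; rewrite EFinD.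
  under eq_integral do rewrite EFinD.
  by rewrite (@integralD _ _ _ P _ measurableT _ _ fi hi) fu hv.
have [i1 e1] := Z b _ _ iT mE; have [i2 e2] := Z k _ _ iU eE; have [i3 e3] := Z l _ _ iN nE.
have i0 : P.-integrable setT (fun w : Omega => (a)%:E).
  by apply: finite_measure_integrable_cst.
have e0 : (\int[P]_(w in setT) a%:E = a%:E)%E.
  by rewrite integral_cst//= probability_setT mule1.
have [i4 e4] := A _ _ _ _ i0 e0 i1 e1.
have [i5 e5] := A _ _ _ _ i4 e4 i2 e2.
have [i6 e6] := A _ _ _ _ i5 e5 i3 e3.
rewrite -e6; apply: ge0_le_integral => //.
- by move=> w _; rewrite lee_fin.
- exact/measurable_EFinP.
- exact: measurable_int i6.
- by move=> w _; rewrite lee_fin.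
Qed.

End affine_bound.

(** * Drift estimates uniform over a family of jumps, indexed in use by the starting point *)

Section jump_family.
Context {R : realType} d (Omega : measurableType d) (I : Type) (D : set I)
  (P : I -> probability Omega R) (T : I -> Omega -> R) (al be c M : R).
Hypothesis mT : forall i, measurable_fun setT (T i).
Hypothesis al12 : 1 < al < 2.
Hypothesis albe : al < be <= 2.
Hypothesis c0 : 0 < c.
Hypothesis tail : forall eps : R, 0 < eps -> exists Y : R, forall y, Y <= y ->
  forall i, D i -> `|y `^ al * fine (P i [set w | y < T i w]) - c| <= eps.
Definition negT (U : Omega -> R) (w : Omega) : R := Num.max (- U w) 0.
Hypothesis neg_moment : forall i, D i -> (\int[P i]_w (negT (T i) w `^ be)%:E <= M%:E)%E.

Definition Jc : R := fine (Jint (2 - al)).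

Lemma tail_pos (eps : R) : 0 < eps -> exists2 Y : R, 0 < Y & forall y, Y <= y ->
  forall i, D i -> `|y `^ al * fine (P i [set w | y < T i w]) - c| <= eps.
Proof.
move=> /tail[Y h]; exists (Num.max Y 1); first by rewrite lt_max ltr01 orbT.
by move=> y; rewrite ge_max => /andP[Yy _]; exact: h.
Qed.

Lemma measurable_psi_posT i (r : R) : measurable_fun setT (fun w => psi (posT (T i) w / r)).
Proof.
apply: (measurableT_comp measurable_psi); apply: measurable_funM => //.
exact: measurable_posT.
Qed.

Lemma psi_posT_ge0 i (r : R) w : 0 < r -> 0 <= psi (posT (T i) w / r).
Proof. by move=> r0; rewrite psi_ge0// divr_ge0 ?posT_ge0// ltW. Qed.

Lemma psi_posT_asymp (eta : R) : 0 < eta -> exists R0 : R, 1 <= R0 /\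
  forall r, R0 <= r -> forall i, D i ->
    (P i).-integrable setT (EFin \o (fun w => psi (posT (T i) w / r))) /\
    exists2 e : R, (\int[P i]_w (psi (posT (T i) w / r))%:E = e%:E)%E &
      `|r `^ al * e - c * Jc| <= eta.
Proof.
move=> eta0; have [al1 al2] := andP al12.
(* Between [al] and 2: the correction of order [r^-k] is then negligible against [r^-al], and
   [Jint (2 - k)] is finite. *)
pose k := (al + 2) / 2; have alk : al < k by rewrite /k; lra.
have k2 : k < 2 by rewrite /k; lra.
have J0 s : 0 <= fine (Jint (R := R) s).
  by apply: fine_ge0; apply: integral_ge0 => x _; rewrite lee_fin Jfun_ge0.
(* Half of [eta] goes to the tail error [eps * Jc], half to the correction. The lower bound requires
   [eps <= c], and [Jc + 1] keeps the denominator positive. *)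
pose eps := Num.min c (eta / (2 * (Jc + 1))).
have J1 : 0 < 2 * (Jc + 1) by have := J0 (2 - al); rewrite -/Jc; lra.
have eps0 : 0 < eps by rewrite lt_min c0 divr_gt0.
have epsc : eps <= c by rewrite ge_min lexx.
have epsJ : eps * Jc <= eta / 2.
  have : eps <= eta / (2 * (Jc + 1)) by rewrite ge_min lexx orbT.
  rewrite ler_pdivlMr// => h; have := J0 (2 - al); rewrite -/Jc; nra.
have [Y Y0 hY] := tail_pos eps0.
pose B := (Y `^ k + c * Y `^ (k - al)) * fine (Jint (2 - k)) + 1.
have B0 : 0 < B.
  rewrite /B ltr_wpDl// mulr_ge0// addr_ge0 ?powR_ge0// mulr_ge0 ?powR_ge0//.
  exact: ltW.
have ka : 0 < k - al by lra.
have eB : 0 < eta / 2 / B by rewrite !divr_gt0.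
have [R0 [R01 hR]] := powRN_eventually_le ka eB.
exists R0; split=> // r rR i Di.
have r0 : 0 < r by rewrite (lt_le_trans _ rR)// (lt_le_trans _ R01).
have k12 : 1 < k < 2 by lra.
have alk2 : al <= k < 2 by lra.
have up := le_integral_psi (P := P i) (mT i) Y0 c0 (ltW eps0) (fun y yY => hY y yY i Di) r0 al12 k12.
have lo := ge_integral_psi (P := P i) (mT i) Y0 c0 (ltW eps0) (fun y yY => hY y yY i Di) r0 al12 alk2 epsc.
have [ig [e eE e0]] := ge0_integrable_EFin (measurable_psi_posT i r)
  (fun w => psi_posT_ge0 i w r0) up.
split=> //; exists e => //.
rewrite eE lee_fin -/Jc in up; rewrite eE -EFinD lee_fin -/Jc in lo.
have ra : r `^ al * r `^ (- al) = 1 by rewrite powRN divff// gt_eqF// powR_gt0.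
have rk : r `^ al * r `^ (- k) = r `^ (- (k - al)).
  have -> : - (k - al) = al + - k by ring.
  by rewrite powRD// (gt_eqF r0) implybT.
have a0 := powR_ge0 r al.
have := ler_wpM2l a0 up; have := ler_wpM2l a0 lo.
have -> : r `^ al * ((c - eps) * r `^ (- al) * Jc) = (c - eps) * Jc.
  by rewrite -[RHS]mul1r -ra; ring.
have -> : r `^ al * ((c + eps) * r `^ (- al) * Jc + Y `^ k * r `^ (- k) * fine (Jint (2 - k))) =
   (c + eps) * Jc + r `^ (- (k - al)) * (Y `^ k * fine (Jint (2 - k))).
  by rewrite -rk -[X in _ = X + _]mul1r -ra; ring.
have -> : r `^ al * (e + c * Y `^ (k - al) * r `^ (- k) * fine (Jint (2 - k))) =
   r `^ al * e + r `^ (- (k - al)) * (c * Y `^ (k - al) * fine (Jint (2 - k))).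
  by rewrite -rk; ring.
have q0 := powR_ge0 r (- (k - al)).
have hq : r `^ (- (k - al)) * B <= eta / 2 by have := hR _ rR; rewrite -ler_pdivlMr.
have y1 : Y `^ k * fine (Jint (2 - k)) <= B.
  rewrite /B mulrDl; set a := Y `^ k * _; have -> x : a + x + 1 = a + (x + 1) by ring.
  by rewrite lerDl addr_ge0// !mulr_ge0 ?powR_ge0 ?J0// ltW.
have y2 : c * Y `^ (k - al) * fine (Jint (2 - k)) <= B.
  rewrite /B mulrDl; set a := c * _ * _; have -> x : x + a + 1 = a + (x + 1) by ring.
  by rewrite lerDl addr_ge0// mulr_ge0 ?powR_ge0 ?J0.
have := ler_wpM2l q0 y1; have := ler_wpM2l q0 y2.
rewrite ler_norml => h1 h2 h3 h4.
clear al1 al2 alk k2 J1 eps0 epsc Y0 B0 ka eB R01 rR r0 k12 alk2 up lo eE e0 ra rk a0 q0 y1 y2.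
by apply/andP; split; lra.
Qed.

Lemma posT_powR_bound (nu : R) : 1 < nu < al -> exists2 C : R, 0 <= C & forall i, D i ->
  (\int[P i]_w (posT (T i) w `^ nu)%:E <= C%:E)%E.
Proof.
move=> nu1; have [Y Y0 hY] := tail_pos ltr01.
have [? ?] := andP nu1.
exists (2 * nu * (1 + c + 1 + Y `^ al) * fine (Jint (1 + nu - al))); last first.
  move=> i Di.
  exact: (le_integral_posT_powR (P := P i) (mT i) Y0 c0 ler01 (fun y yY => hY y yY i Di) al12 nu1).
apply: mulr_ge0; last first.
  by apply: fine_ge0; apply: integral_ge0 => x _; rewrite lee_fin Jfun_ge0.
by have := powR_ge0 Y al; have := c0; nra.
Qed.

Lemma measurable_negT_powR i : measurable_fun setT (fun w => negT (T i) w `^ be).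
Proof.
apply: (measurableT_comp (measurable_powR be)); apply: measurable_maxr => //.
exact: measurableT_comp.
Qed.

Lemma negT_ge0 (U : Omega -> R) w : 0 <= negT U w. Proof. by rewrite le_max lexx orbT. Qed.

Lemma neg_integrable i : D i ->
  (P i).-integrable setT (EFin \o (fun w => negT (T i) w `^ be)) /\
  exists2 n : R, (\int[P i]_w (negT (T i) w `^ be)%:E = n%:E)%E & 0 <= n <= M.
Proof.
move=> Di; apply: ge0_integrable_EFin (neg_moment Di) => //.
  exact: measurable_negT_powR.
by move=> w; exact: powR_ge0.
Qed.

Lemma T_integrable i : D i -> (P i).-integrable setT (EFin \o T i) /\
  exists m : R, (\int[P i]_w (T i w)%:E = m%:E)%E.
Proof.
move=> Di; have [al1 al2] := andP al12.
have nu1 : 1 < (1 + al) / 2 < al by lra.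
have [C C0 hC] := posT_powR_bound nu1.
have [ip [ep _ _]] : (P i).-integrable setT (EFin \o (fun w => posT (T i) w `^ ((1 + al) / 2))) /\
   exists2 e : R, (\int[P i]_w (posT (T i) w `^ ((1 + al) / 2))%:E = e%:E)%E & 0 <= e <= C.
  apply: ge0_integrable_EFin (hC _ Di); last by move=> w; exact: powR_ge0.
  by apply: (measurableT_comp (measurable_powR _)); exact: measurable_posT.
have [iN _] := neg_integrable Di.
have i0 : (P i).-integrable setT (fun w : Omega => (1 : R)%:E).
  by apply: finite_measure_integrable_cst.
have iT : (P i).-integrable setT (EFin \o T i).
  have := integrableD measurableT (integrableD measurableT i0 ip) iN.
  apply: le_integrable => //; first exact/measurable_EFinP.
  move=> w _ /=; rewrite lee_fin.
  have h0 (x p : R) : 0 <= x -> 1 <= p -> x <= 1 + x `^ p.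
    move=> x0 p1; have [x1|x1] := leP x 1; first by have := powR_ge0 x p; lra.
    by have := le1r_powR (ltW x1) p1; lra.
  have [b1 b2] := andP albe.
  have p1 : posT (T i) w <= 1 + posT (T i) w `^ ((1 + al) / 2).
    by apply: h0; [exact: posT_ge0|lra].
  have n1 : negT (T i) w <= 1 + negT (T i) w `^ be by apply: h0; [exact: negT_ge0|lra].
  have pp := powR_ge0 (posT (T i) w) ((1 + al) / 2).
  have np := powR_ge0 (negT (T i) w) be.
  rewrite [leRHS]ger0_norm; last by rewrite !addr_ge0.
  have pT : T i w <= posT (T i) w by rewrite le_max lexx.
  have nT : - T i w <= negT (T i) w by rewrite le_max lexx.
  by rewrite ler_norml; apply/andP; split; lra.
split=> //; exists (fine (\int[P i]_w (T i w)%:E)); rewrite fineK//.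
exact: integrable_fin_num.
Qed.

Lemma normr_M_gt0 : 0 < `|M| + 1. Proof. by rewrite ltr_wpDl. Qed.

Lemma powR_div_negT i (r : R) w : 0 < r ->
  (negT (T i) w / r) `^ be = r `^ (- be) * negT (T i) w `^ be.
Proof.
move=> r0; rewrite powRM ?negT_ge0 ?invr_ge0 ?(ltW r0)// mulrC.
by rewrite -(powR_inv1 (ltW r0)) -powRrM mulN1r.
Qed.

Lemma drift_ln (kappa : R) : kappa < c * Jc -> exists R0 : R, 1 <= R0 /\
  forall r, R0 <= r -> forall i, D i -> forall m : R,
    (\int[P i]_w (T i w)%:E = m%:E)%E -> r `^ (al - 1) * m <= kappa ->
    (\int[P i]_w (ln (Num.max `|r + T i w| 1))%:E <= (ln r)%:E)%E.
Proof.
move=> kJ; have [al1 al2] := andP al12; have [b1 b2] := andP albe.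
(* One half of the gap absorbs the error in the asymptotics of [psi], the other the inward jumps,
   which are of order [r^-be]. *)
pose eta := (c * Jc - kappa) / 2; have eta0 : 0 < eta by rewrite /eta; lra.
have [R1 [R11 h1]] := psi_posT_asymp eta0.
have M0 := normr_M_gt0.
have D0 : 0 < eta / (2 * (`|M| + 1)) by rewrite divr_gt0// mulr_gt0.
have ba : 0 < be - al by lra.
have [R2 [R21 h2]] := powRN_eventually_le ba D0.
exists (Num.max (expR 1) (Num.max R1 R2)); split; first by rewrite !le_max R11 orbT.
move=> r; rewrite !ge_max => /and3P[re rR1 rR2] i Di m mE rm.
have r0 : 0 < r by rewrite (lt_le_trans _ re)// expR_gt0.
have [iU [e eE he]] := h1 _ rR1 _ Di.
have [iN [n nE /andP[n0 nM]]] := neg_integrable Di.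
have [iT _] := T_integrable Di.
apply: (@le_trans _ _ (ln r + r^-1 * m + (-1) * e + (2 * r `^ (- be)) * n)%:E); last first.
  rewrite lee_fin.
  have ra0 : 0 < r `^ al by rewrite powR_gt0.
  rewrite -(ler_pM2l ra0).
  have E1 : r `^ al * r^-1 = r `^ (al - 1).
    by rewrite -(mulr_powRB1 (ltW r0)); [rewrite mulrC mulKf// gt_eqF|lra].
  have E2 : r `^ al * r `^ (- be) = r `^ (- (be - al)).
    have -> : - (be - al) = al + - be by ring.
    by rewrite powRD// (gt_eqF r0) implybT.
  have -> : r `^ al * (ln r + r^-1 * m + (-1) * e + 2 * r `^ (- be) * n) =
    r `^ al * ln r + ((r `^ al * r^-1) * m - r `^ al * e + 2 * (r `^ al * r `^ (- be)) * n) by ring.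
  rewrite E1 E2 gerDl.
  move: he; rewrite ler_norml => /andP[he1 he2].
  have h3 := h2 _ rR2; have q0 := powR_ge0 r (- (be - al)).
  have nM1 : n <= `|M| + 1 by rewrite (le_trans nM)// (le_trans (ler_norm M))// lerDl.
  have : r `^ (- (be - al)) * n <= eta / 2.
    apply: (@le_trans _ _ (eta / (2 * (`|M| + 1)) * (`|M| + 1))); first exact: ler_pM.
    by rewrite le_eqVlt; apply/orP; left; apply/eqP; field; rewrite gt_eqF.
  rewrite /eta in he1 *; lra.
apply: (le_integral_affine _ _ iT mE iU eE iN nE).
- apply: (measurableT_comp (@measurable_ln R)); apply: measurable_maxr => //.
  by apply: measurableT_comp => //; exact: measurable_funD.
- by move=> w; rewrite ln_ge0// le_max lexx orbT.
- move=> w; apply: (le_trans (ln_max_drift_le (T i w) re)).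
  rewrite -/(posT (T i) w) -!mulrA -(powR_div_negT i w r0) [r^-1 * _]mulrC mulN1r lerD2l.
  rewrite ler_pM2l//; case: ifP => [t1|_]; last exact: powR_ge0.
  have -> : negT (T i) w = - T i w.
    rewrite /negT max_l//; have : 0 <= - T i w / r by rewrite (le_trans _ t1).
    by rewrite pmulr_lge0// invr_gt0.
  by apply: le1r_powR => //; lra.
Qed.

(** The argument is the position measured in the starting direction, so a jump across the origin
    lands where the value is 1. *)
Definition outpow (nu A y : R) : R := if y <= A then 1 else (y / A) `^ (- nu).

Lemma outpow_ge0 nu A y : 0 <= outpow nu A y.
Proof. by rewrite /outpow; case: ifP => // _; exact: powR_ge0. Qed.

Lemma measurable_outpow nu A : measurable_fun setT (outpow nu A).
Proof.
apply: measurable_fun_ifT => //; first exact: measurable_fun_ler.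
by apply: (measurableT_comp (measurable_powR _)); exact: measurable_funM.
Qed.

Lemma outpow_le1 nu A y : 0 < A -> 0 <= nu -> outpow nu A y <= 1.
Proof.
move=> A0 nu0; rewrite /outpow; case: ifP => // /negbT; rewrite -ltNge => Ay.
by rewrite -(powRr0 (y / A)) ler_powR ?oppr_le0// ler_pdivlMr// mul1r ltW.
Qed.

(** An inward jump longer than [r / 2] may raise the value to 1, that is by a factor
    [(r / A)^nu <= r^nu]. Hence the [r^nu] in the inward term, and the condition [nu < be - al] when
    that term has to be negligible. The constant 6 exceeds [2^be]. *)
Lemma outpow_drift_le (nu A r t : R) : 0 < nu <= 1 -> 1 <= A -> A <= r ->
  1 <= be <= 2 ->
  outpow nu A (r + t) <= (r / A) `^ (- nu) * (1 - nu * (t / r) +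
    nu * (1 + nu) * psi (Num.max t 0 / r) + 6 * r `^ nu * (Num.max (- t) 0 / r) `^ be).
Proof.
move=> /andP[nu0 nu1] A1 Ar /andP[be1 be2].
have A0 : 0 < A by lra.
have r0 : 0 < r by lra.
have rA0 : 0 < r / A by rewrite divr_gt0.
have rn1 : 1 <= r `^ nu by rewrite -(powRr0 r) ler_powR; lra.
have [t0|t0] := leP 0 t.
  rewrite max_r; last by lra.
  rewrite mul0r powR0 ?mulr0 ?addr0; last by rewrite gt_eqF//; lra.
  have tr0 : 0 <= t / r by rewrite divr_ge0// ltW.
  have b := powRN_1D_le tr0 (ltW nu0).
  apply: (@le_trans _ _ ((r / A) `^ (- nu) * (1 + t / r) `^ (- nu))); last first.
    by rewrite ler_wpM2l ?powR_ge0.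
  rewrite -powRM ?(ltW rA0)//; last by lra.
  have -> : r / A * (1 + t / r) = (r + t) / A by field; rewrite !gt_eqF.
  rewrite /outpow; case: ifP => // h.
  have e : t = 0 by lra.
  by rewrite e addr0 (_ : r = A) ?divff ?powR1 ?gt_eqF//; lra.
rewrite mul0r psi0 mulr0 addr0 max_l; last by lra.
set u := - t / r; have u0 : 0 < u by rewrite divr_gt0// oppr_gt0.
have -> : t / r = - u by rewrite /u mulNr opprK.
have te : t = - (u * r) by rewrite /u; field; rewrite gt_eqF.
rewrite mulrN opprK.
have ub0 : 0 <= u `^ be by exact: powR_ge0.
have [u1|u1] := leP u 2^-1.
  have nu01 : 0 <= nu <= 1 by lra.
  have u01 : 0 <= u <= 2^-1 by lra.
  have b := powRN_1B_le u01 nu01.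
  have u2 : u ^+ 2 <= u `^ be by rewrite -powR_mulrn ?(ltW u0)// ger_powR//; lra.
  have : (r / A) `^ (- nu) * (1 - u) `^ (- nu) <= (r / A) `^ (- nu) *
      (1 + nu * u + 6 * r `^ nu * u `^ be).
    by rewrite ler_wpM2l ?powR_ge0//; nra.
  apply: le_trans; rewrite -powRM ?(ltW rA0)//; last by lra.
  have -> : r / A * (1 - u) = (r + t) / A by rewrite te; field; rewrite gt_eqF.
  rewrite /outpow; case: ifP => // h.
  have q0 : 0 < (r + t) / A by rewrite divr_gt0// te; nra.
  have q1 : (r + t) / A <= 1 by rewrite ler_pdivrMr// mul1r.
  rewrite -(powRr0 ((r + t) / A)); apply: ger_powR; first by rewrite q0 q1.
  by lra.
apply: (le_trans (outpow_le1 _ A0 (ltW nu0))).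
have e1 : (r / A) `^ (- nu) * (r / A) `^ nu = 1.
  by rewrite powRN mulVf// gt_eqF// powR_gt0.
rewrite -[leLHS]e1 ler_wpM2l ?powR_ge0//.
apply: (@le_trans _ _ (r `^ nu)).
  rewrite ge0_ler_powR ?nnegrE ?(ltW nu0) ?(ltW rA0) ?(ltW r0)//.
  by rewrite ler_pdivrMr// ler_peMr// ltW.
have ub : 6^-1 <= u `^ be.
  apply: (@le_trans _ _ (2^-1 `^ be)); last by rewrite ge0_ler_powR ?nnegrE//; lra.
  apply: (@le_trans _ _ (2^-1 `^ 2)); last by apply: ger_powR => //; lra.
  by rewrite powR_mulrn//; lra.
have : 0 <= nu * u by rewrite mulr_ge0// ltW.
nra.
Qed.

Lemma drift_powRN (kappa nu : R) : 0 < nu <= 1 -> nu < be - al ->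
  c * Jc * (1 + nu) < kappa -> exists R0 : R, 1 <= R0 /\
  forall A r, R0 <= A -> A <= r -> forall i, D i -> forall m : R,
    (\int[P i]_w (T i w)%:E = m%:E)%E -> kappa <= r `^ (al - 1) * m ->
    (\int[P i]_w (outpow nu A (r + T i w))%:E <= ((r / A) `^ (- nu))%:E)%E.
Proof.
move=> nu01 nub kJ; have [al1 al2] := andP al12; have [b1 b2] := andP albe.
have [nu0 nu1] := andP nu01.
(* After division by [nu], the asymptotics of [psi] cost [(1 + nu) eta <= 2 eta] and the inward
   jumps [eta], out of a gap of [4 eta]. *)
pose eta := (kappa - c * Jc * (1 + nu)) / 4; have eta0 : 0 < eta by rewrite /eta; lra.
have [R1 [R11 h1]] := psi_posT_asymp eta0.
have M0 := normr_M_gt0.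
have D0 : 0 < nu * eta / (6 * (`|M| + 1)) by rewrite divr_gt0// mulr_gt0.
have ba : 0 < be - al - nu by lra.
have [R2 [R21 h2]] := powRN_eventually_le ba D0.
exists (Num.max R1 R2); split; first by rewrite !le_max R11.
move=> A r; rewrite !ge_max => /andP[AR1 AR2] Ar i Di m mE rm.
have A1 : 1 <= A by lra.
have r0 : 0 < r by lra.
have rR1 : R1 <= r by lra.
have rR2 : R2 <= r by lra.
have [iU [e eE he]] := h1 _ rR1 _ Di.
have [iN [n nE /andP[n0 nM]]] := neg_integrable Di.
have [iT _] := T_integrable Di.
set G := (r / A) `^ (- nu).
have G0 : 0 < G by rewrite powR_gt0// divr_gt0// (lt_le_trans ltr01).
apply: (@le_trans _ _ (G + (- (G * nu / r)) * m + (G * (nu * (1 + nu))) * e +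
    (G * (6 * r `^ nu * r `^ (- be))) * n)%:E); last first.
  rewrite lee_fin.
  have ra0 : 0 < r `^ al by rewrite powR_gt0.
  rewrite -(ler_pM2l ra0).
  have E1 : r `^ al * r^-1 = r `^ (al - 1).
    by rewrite -(mulr_powRB1 (ltW r0)); [rewrite mulrC mulKf// gt_eqF|lra].
  have E2 : r `^ al * r `^ nu * r `^ (- be) = r `^ (- (be - al - nu)).
    have -> : - (be - al - nu) = al + nu + - be by ring.
    by rewrite !powRD// (gt_eqF r0) implybT.
  have -> : r `^ al * (G + - (G * nu / r) * m + G * (nu * (1 + nu)) * e +
       G * (6 * r `^ nu * r `^ (- be)) * n) =
    r `^ al * G + G * (- (nu * ((r `^ al * r^-1) * m)) + nu * (1 + nu) * (r `^ al * e) +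
       6 * ((r `^ al * r `^ nu * r `^ (- be)) * n)) by ring.
  rewrite E1 E2 gerDl pmulr_rle0//.
  move: he; rewrite ler_norml => /andP[he1 he2].
  have h3 := h2 _ rR2; have q0 := powR_ge0 r (- (be - al - nu)).
  have nM1 : n <= `|M| + 1 by rewrite (le_trans nM)// (le_trans (ler_norm M))// lerDl.
  have k1 : 6 * (r `^ (- (be - al - nu)) * n) <= nu * eta.
    apply: (@le_trans _ _ (6 * (nu * eta / (6 * (`|M| + 1)) * (`|M| + 1)))).
      by rewrite ler_pM2l//; exact: ler_pM.
    by rewrite le_eqVlt; apply/orP; left; apply/eqP; field; rewrite gt_eqF.
  have k2 : nu * kappa <= nu * (r `^ (al - 1) * m) by rewrite ler_pM2l.
  have k3 : nu * (1 + nu) * (r `^ al * e) <= nu * (1 + nu) * (c * Jc + eta).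
    by rewrite ler_pM2l ?mulr_gt0 ?addr_gt0// -lerBlDl.
  have k4 : kappa = c * Jc * (1 + nu) + 4 * eta by rewrite /eta; field.
  have k5 : nu * nu * eta <= nu * eta by rewrite ler_pM2r// ler_piMr// ltW.
  have k6 : 0 < nu * eta by rewrite mulr_gt0.
  rewrite k4 in k2; lra.
apply: (le_integral_affine _ _ iT mE iU eE iN nE).
- by apply: (measurableT_comp (measurable_outpow nu A)); exact: measurable_funD.
- by move=> w; exact: outpow_ge0.
- move=> w; have be12 : 1 <= be <= 2 by lra.
  apply: (le_trans (outpow_drift_le (T i w) nu01 A1 Ar be12)).
  rewrite -/(posT (T i) w) -/(negT (T i) w) powR_div_negT// -/G.
  by rewrite le_eqVlt; apply/orP; left; apply/eqP; ring.
Qed.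

(** For [nu < al] the [nu]-th moment of the outward jump is bounded, so everything beyond the linear
    term is a constant. *)
Lemma drift_powR (nu : R) : 1 < nu < al -> exists C : R,
  forall r, 1 <= r -> forall i, D i -> forall m : R,
    (\int[P i]_w (T i w)%:E = m%:E)%E ->
    (\int[P i]_w (`|r + T i w| `^ nu)%:E <= (r `^ nu + nu * r `^ (nu - 1) * m + C)%:E)%E.
Proof.
move=> nu1al; have [al1 al2] := andP al12; have [b1 b2] := andP albe.
have [nu1 nual] := andP nu1al.
have [C C0 hC] := posT_powR_bound nu1al.
exists (4 + 4 * C + 4 * `|M|) => r r1 i Di m mE.
have r0 : 0 < r by lra.
have [iU [e eE /andP[e0 eC]]] : (P i).-integrable setT (EFin \o (fun w => posT (T i) w `^ nu)) /\
   exists2 e : R, (\int[P i]_w (posT (T i) w `^ nu)%:E = e%:E)%E & 0 <= e <= C.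
  apply: ge0_integrable_EFin (hC _ Di); last by move=> w; exact: powR_ge0.
  by apply: (measurableT_comp (measurable_powR _)); exact: measurable_posT.
have [iN [n nE /andP[n0 nM]]] := neg_integrable Di.
have [iT _] := T_integrable Di.
apply: (@le_trans _ _ ((r `^ nu + 4) + (nu * r `^ (nu - 1)) * m + 4 * e + 4 * n)%:E); last first.
  by rewrite lee_fin; have := ler_norm M; lra.
apply: (le_integral_affine _ _ iT mE iU eE iN nE).
- apply: (measurableT_comp (measurable_powR _)).
  by apply: measurableT_comp => //; exact: measurable_funD.
- by move=> w; exact: powR_ge0.
- move=> w; have nu12 : 1 <= nu <= 2 by lra.
  have -> : r + T i w = r * (1 + T i w / r) by field; rewrite gt_eqF.
  rewrite normrM (gtr0_norm r0) powRM ?(ltW r0)//.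
  have h := ler_wpM2l (powR_ge0 r nu) (powR_1D_le (T i w / r) nu12).
  apply: (le_trans h).
  rewrite !mulrDr mulr1.
  have -> : r `^ nu * (nu * (T i w / r)) = nu * r `^ (nu - 1) * T i w.
    rewrite -(mulr_powRB1 (ltW r0)); last by lra.
    by field; rewrite gt_eqF.
  have -> : r `^ nu * (4 * `|T i w / r| `^ nu) = 4 * `|T i w| `^ nu.
    rewrite mulrCA -powRM ?(ltW r0)//; congr (_ * _ `^ _).
    by rewrite normrM normfV (gtr0_norm r0) mulrC divfK// gt_eqF.
  suff : `|T i w| `^ nu <= 1 + posT (T i) w `^ nu + negT (T i) w `^ be by lra.
  have pp := powR_ge0 (posT (T i) w) nu; have np := powR_ge0 (negT (T i) w) be.
  have [t0|t0] := leP 0 (T i w).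
    have -> : posT (T i) w = `|T i w| by rewrite /posT max_l// ger0_norm.
    by have := powR_ge0 `|T i w| nu; lra.
  have -> : negT (T i) w = `|T i w| by rewrite /negT ltr0_norm// max_l// oppr_ge0 ltW.
  have [t1|t1] := leP `|T i w| 1.
    have : `|T i w| `^ nu <= 1 `^ nu by rewrite ge0_ler_powR ?nnegrE//; lra.
    by rewrite powR1; have := powR_ge0 `|T i w| be; lra.
  have : `|T i w| `^ nu <= `|T i w| `^ be by rewrite ler_powR ?(ltW t1)// ltW// (lt_trans nual).
  by move=> /le_trans; apply; rewrite lerDr addr_ge0.
Qed.

(** From [r >= z / 2] follows [r^(1 - al) <= 2 z^(1 - al)], so the mean contributes order [z^-al]
    after division by [z]. The asymptotics of [psi] at scale [z] and the inward moment give the same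
    order. *)
Lemma drift_phi (B : R) : 0 <= B -> exists C R0 : R, [/\ 0 < C, 1 <= R0 &
  forall z, R0 <= z -> forall r, z / 2 <= r -> forall i, D i -> forall m : R,
    (\int[P i]_w (T i w)%:E = m%:E)%E -> `|m| <= B * r `^ (1 - al) ->
    (\int[P i]_w (phi (`|r + T i w| / z))%:E <= (phi (r / z) + C * z `^ (- al))%:E)%E].
Proof.
move=> B0; have [al1 al2] := andP al12; have [b1 b2] := andP albe.
have [R1 [R11 h1]] := psi_posT_asymp ltr01.
have J0 : 0 <= Jc by apply: fine_ge0; apply: integral_ge0 => x _; rewrite lee_fin Jfun_ge0.
have cJ0 : 0 <= c * Jc by rewrite mulr_ge0// ltW.
exists (8 * B + 32 * (c * Jc + 1) + 4 * `|M|), R1; split=> //.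
  by have := normr_ge0 M; lra.
move=> z zR r zr i Di m mE mB.
have z0 : 0 < z by lra.
have z1 : 1 <= z by lra.
have [iU [e eE he]] := h1 _ zR _ Di.
have [iN [n nE /andP[n0 nM]]] := neg_integrable Di.
have [iT _] := T_integrable Di.
have u1 : 2^-1 <= r / z by rewrite ler_pdivlMr//; lra.
set u := r / z in u1 *.
set mx := Num.max (1 - u) 0.
apply: (@le_trans _ _ (phi u + (- (8 * mx / z)) * m + 32 * e + (4 * z `^ (- be)) * n)%:E); last first.
  rewrite lee_fin -!addrA lerD2l.
  have za0 : 0 < z `^ al by rewrite powR_gt0.
  have zna0 : 0 < z `^ (- al) by rewrite powR_gt0.
  have zz : z `^ al * z `^ (- al) = 1 by rewrite powRN divff// gt_eqF.
  have eb : e <= (c * Jc + 1) * z `^ (- al).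
    rewrite -(ler_pM2l za0) mulrCA zz mulr1.
    by move: he; rewrite ler_norml => /andP[_]; lra.
  have nb : z `^ (- be) * n <= z `^ (- al) * `|M|.
    apply: ler_pM => //; first exact: powR_ge0.
      by rewrite ler_powR//; lra.
    by have := ler_norm M; lra.
  have mx0 : 0 <= mx by rewrite le_max lexx orbT.
  have mx1 : mx <= 2^-1 by rewrite ge_max; apply/andP; split; lra.
  have r0 : 0 < r by lra.
  have rz : r `^ (1 - al) <= 2 * z `^ (1 - al).
    have -> : 1 - al = - (al - 1) by ring.
    rewrite !powRN ler_pdivlMr ?powR_gt0// mulrC -[_ / _]/(_ * _) ler_pdivrMr ?powR_gt0//.
    apply: (@le_trans _ _ ((2 * r) `^ (al - 1))).
      by rewrite ge0_ler_powR ?nnegrE ?subr_ge0 ?mulr_ge0 ?(ltW z0) ?(ltW r0) ?(ltW al1)// -ler_pdivrMl// mulrC.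
    rewrite powRM ?(ltW r0)//; apply: ler_wpM2r; first exact: powR_ge0.
    by apply: ler1_powR; lra.
  have mz : `|m| <= 2 * B * z `^ (1 - al).
    apply: (le_trans mB); rewrite -mulrA mulrCA [2 * _]mulrC.
    by rewrite ler_wpM2l// mulrC.
  have zz1 : z `^ (1 - al) / z = z `^ (- al).
    rewrite -(powR_inv1 (ltW z0)) -powRD ?(gt_eqF z0) ?implybT//.
    by congr (_ `^ _); ring.
  have mzz : `|m| / z <= 2 * B * z `^ (- al).
    by rewrite -zz1 mulrA ler_wpM2r// invr_ge0 ltW.
  have : - (8 * mx / z) * m <= 8 * B * z `^ (- al).
    apply: (@le_trans _ _ (8 * mx * (`|m| / z))).
      have : - m <= `|m| by rewrite -normrN ler_norm.
      have : 0 <= 8 * mx / z by rewrite !mulr_ge0// invr_ge0 ltW.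
      have -> : 8 * mx * (`|m| / z) = (8 * mx / z) * `|m| by field; rewrite gt_eqF.
      by rewrite mulNr -mulrN => p q; exact: ler_wpM2l.
    have -> : 8 * B * z `^ (- al) = 8 * 2^-1 * (2 * B * z `^ (- al)) by field.
    by apply: ler_pM => //; [exact: mulr_ge0|exact: divr_ge0 _ (ltW z0)|rewrite ler_pM2l].
  lra.
apply: (le_integral_affine _ _ iT mE iU eE iN nE).
- apply: (measurableT_comp (f := phi)); last first.
    apply: measurable_funM => //; apply: measurableT_comp => //; exact: measurable_funD.
  apply: measurable_minr => //; apply: measurable_funM => //; apply: measurable_funX.
  by apply: measurable_maxr => //; exact: measurable_funB.
- by move=> w; exact: phi_ge0.
- move=> w; have be12 : 1 <= be <= 2 by lra.
  have h := phi_drift_le (T i w / z) u1 be12.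
  have -> : `|r + T i w| / z = `|u + T i w / z|.
    by rewrite -{1}(gtr0_norm z0) -normfV -normrM /u mulrDl.
  apply: (le_trans h).
  have mxz (x : R) : Num.max (x / z) 0 = Num.max x 0 / z.
    by rewrite -{1}(mul0r z^-1) maxr_pMl// invr_ge0 ltW.
  rewrite -[- (T i w / z)]mulNr !mxz -/(posT (T i) w) -/(negT (T i) w) powR_div_negT// -/mx.
  by rewrite le_eqVlt; apply/orP; left; apply/eqP; ring.
Qed.

End jump_family.

(** * Paths of a Markov chain *)

Section integral_mixture.
Context {R : realType} d d' (S : measurableType d) (U : measurableType d').
Variables (m : {measure set S -> \bar R}) (E : set S) (nu : {measure set U -> \bar R})
  (k : S -> {measure set U -> \bar R}).
Hypothesis mE : measurable E.
Hypothesis mk : forall B, measurable B -> measurable_fun setT (fun w => k w B).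
Hypothesis nuE : forall B, measurable B -> (nu B = \int[m]_(w in E) k w B)%E.
Local Open Scope ereal_scope.

Import HBNNSimple.

Lemma integral_mixture_nnsfun (s : {nnsfun U >-> R}) :
  \int[nu]_y (s y)%:E = \int[m]_(w in E) \int[k w]_y (s y)%:E.
Proof.
rewrite integralT_nnsfun sintegralE.
under [RHS]eq_integral do rewrite integralT_nnsfun sintegralE.
rewrite /= ge0_integral_fsum//; last 2 first.
- by move=> r; apply: measurable_funeM; apply: measurable_funTS; exact: mk.
- by move=> r w _; exact: nnsfun_mulemu_ge0.
apply: eq_fsbigr => r /set_mem [y _ <-].
by rewrite nuE// ge0_integralZl_EFin//; exact/measurable_funTS/mk.
Qed.

(** The Markov property speaks of events; simple functions and monotone convergence extend it to
    nonnegative functions. *)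
Lemma integral_mixture (f : U -> \bar R) : (forall y, 0 <= f y) -> measurable_fun setT f ->
  \int[nu]_y f y = \int[m]_(w in E) \int[k w]_y f y.
Proof.
move=> f0 mf; pose g := nnsfun_approx measurableT mf.
have g0 n y : 0 <= (g n y)%:E by rewrite lee_fin.
have mg n : measurable_fun setT (fun y => (g n y)%:E) by exact/measurable_EFinP.
have ndg y : {homo (fun n => (g n y)%:E) : a b / (a <= b)%N >-> a <= b}.
  by move=> a b ab; rewrite lee_fin; exact/lefP/nd_nnsfun_approx.
have lim_g (l : {measure set U -> \bar R}) :
    \int[l]_y f y = limn (fun n => \int[l]_y (g n y)%:E).
  rewrite -monotone_convergence//.
  by apply: eq_integral => y _; apply/esym/cvg_lim => //; exact: cvg_nnsfun_approx.
rewrite lim_g; under [RHS]eq_integral do rewrite lim_g.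
rewrite monotone_convergence//.
- by congr (limn _); apply/funext => n; exact: integral_mixture_nnsfun.
- move=> n; apply: measurable_funTS.
  by apply: measurable_fun_integral_kernel => //; exact: mk.
- by move=> n w _; exact: integral_ge0.
- by move=> w _ a b ab; apply: ge0_le_integral => // y _; exact: ndg.
Qed.

End integral_mixture.

(** * Drift inequalities summed along histories *)

Section chain.
Context {R : realType} (d : measure_display) (Omega : measurableType d)
  (X : set R) (K : R.-pker R ~> R) (Px : R -> probability Omega R)
  (xi : nat -> Omega -> R).
Hypothesis mX : measurable X.
Hypothesis mc : is_markov_chain X K Px xi.
Local Open Scope ereal_scope.

Let mxi n : measurable_fun setT (xi n). Proof. by have [h _] := mc. Qed.

(** Histories are products of sets, the form in which the Markov property restricts the past. *)
Definition cylinder (A : nat -> set R) n := [set w | forall i, (i <= n)%N -> A i (xi i w)].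

Lemma measurable_xi n (B : set R) : measurable B -> measurable [set w | B (xi n w)].
Proof. by move=> mB; have := mxi n measurableT mB; rewrite setTI. Qed.

Lemma cylinderS A n : cylinder A n.+1 = cylinder A n `&` [set w | A n.+1 (xi n.+1 w)].
Proof.
apply/seteqP; split => [w h|w [h1 h2] i].
  by split => [i ni|]; apply: h => //; exact: leqW.
by rewrite leq_eqVlt => /predU1P[->//|]; exact: h1.
Qed.

Lemma measurable_cylinder A n : (forall i, measurable (A i)) -> measurable (cylinder A n).
Proof.
move=> mA; elim: n => [|n IH].
  rewrite (_ : cylinder A 0 = [set w | A 0%N (xi 0%N w)]); first exact: measurable_xi.
  apply/seteqP; split => [w h|w h i]; first exact: h.
  by rewrite leqn0 => /eqP ->.
by rewrite cylinderS; apply: measurableI => //; exact: measurable_xi.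
Qed.

Lemma xi0_ae x : X x -> {ae Px x, forall w, xi 0%N w = x}.
Proof.
move=> Xx; have [_ [_ [h _]]] := mc.
exists [set w | xi 0%N w != x]; split.
- rewrite (_ : [set w | _] = [set w | (~` [set x]) (xi 0%N w)]).
    by apply: measurable_xi; exact: measurableC.
  by apply/seteqP; split => w /= /eqP.
- have m1 : measurable [set w | xi 0%N w = x] by exact: (@measurable_xi 0 [set x]).
  have -> : [set w | xi 0%N w != x] = ~` [set w | xi 0%N w = x].
    by apply/seteqP; split => w /= /eqP.
  by rewrite probability_setC// h// subee.
- by move=> w /= /eqP.
Qed.

Lemma xi_ae x n : X x -> {ae Px x, forall w, X (xi n w)}.
Proof.
move=> Xx; elim: n => [|n IH].
  by have := xi0_ae Xx; apply: filterS => w ->.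
have [_ [KX [_ h]]] := mc.
have e := h x Xx n (fun _ => setT) (~` X) (fun=> measurableT) (measurableC mX).
exists [set w | (~` X) (xi n.+1 w)]; split; [exact/measurable_xi/measurableC| |by []].
transitivity (Px x [set w | (forall i, (i <= n)%N -> setT (xi i w)) /\ (~` X) (xi n.+1 w)]).
  by congr (Px x _); apply/seteqP; split => [w h'|w []].
rewrite e (_ : [set w | _] = setT); last by apply/seteqP; split.
rewrite (@ae_eq_integral _ _ _ (Px x) setT (cst 0))//; first by rewrite integral0.
- by apply: (measurableT_comp (measurable_kernel K _ _)) => //; exact: measurableC.
- by have := IH; apply: filterS => w Xw _; exact: KX.
Qed.

Lemma step_integral x A n (f : R -> \bar R) : X x -> (forall i, measurable (A i)) ->
  (forall y, 0 <= f y) -> measurable_fun setT f ->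
  \int[Px x]_(w in cylinder A n) f (xi n.+1 w) =
  \int[Px x]_(w in cylinder A n) \int[K (xi n w)]_y f y.
Proof.
move=> Xx mA f0 mf; have mE := measurable_cylinder n mA.
pose nu := pushforward (mrestr (Px x) mE) (xi n.+1).
have mk (B : set R) : measurable B -> measurable_fun setT (fun w => K (xi n w) B).
  by move=> mB; apply: (measurableT_comp (measurable_kernel K _ _)).
have md (B : set R) : measurable B -> measurable_fun setT (fun w => \d_(xi n.+1 w) B : \bar R).
  by move=> mB; apply/measurable_EFinP; exact: (measurableT_comp (@measurable_indic _ _ R setT _ mB) (mxi n.+1)).
(* The law [nu] of the next position on the history is written as a mixture twice: of Dirac masses,
   which gives the left side, and of the kernel. *)
transitivity (\int[nu]_y f y).
  rewrite (@integral_mixture _ _ _ _ _ (Px x) _ nu (fun w => \d_(xi n.+1 w)) mE md)//.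
    by apply: eq_integral => w _; rewrite integral_dirac// diracT mul1e.
  move=> B mB; rewrite /nu /pushforward/= /mrestr.
  rewrite (eq_integral (fun w => (\1_(xi n.+1 @^-1` B) w)%:E))//.
  by rewrite integral_indic//; have := mxi n.+1 measurableT mB; rewrite setTI.
apply: integral_mixture => //.
move=> B mB; have [_ [_ [_ h]]] := mc.
rewrite -h// /nu /pushforward/= /mrestr; congr (Px x _).
by apply/seteqP; split => w [].
Qed.

Lemma law_integral x (f : R -> \bar R) : X x ->
  (forall y, 0 <= f y) -> measurable_fun setT f ->
  \int[Px x]_w f (xi 1%N w) = \int[K x]_y f y.
Proof.
move=> Xx f0 mf.
have h := @step_integral x (fun=> setT) 0%N f Xx (fun=> measurableT) f0 mf.
rewrite (_ : cylinder _ _ = setT) in h; last by apply/seteqP; split.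
rewrite h (@ae_eq_integral _ _ _ (Px x) setT (cst (\int[K x]_y f y)))//.
- by rewrite integral_cst//= probability_setT mule1.
- apply: (measurableT_comp (f := fun z => \int[K z]_y f y)) => //.
  by apply: measurable_fun_integral_kernel => // U mU; exact: measurable_kernel.
- by have := xi0_ae Xx; apply: filterS => w -> _.
Qed.

(** The gain [g] and the loss [h] stand on opposite sides, so that no integral is subtracted. *)
Lemma step_le x A n (f : R -> R) (g h : R) : X x -> (forall i, measurable (A i)) ->
  (forall y, (0 <= f y)%R) -> measurable_fun setT f -> (0 <= g)%R -> (0 <= h)%R ->
  (forall y, X y -> A n y -> \int[Px y]_w (f (xi 1%N w))%:E + g%:E <= (f y)%:E + h%:E) ->
  \int[Px x]_(w in cylinder A n) (f (xi n.+1 w))%:E + g%:E * Px x (cylinder A n) <=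
  \int[Px x]_(w in cylinder A n) (f (xi n w))%:E + h%:E * Px x (cylinder A n).
Proof.
move=> Xx mA f0 mf g0 h0 H.
have mE := measurable_cylinder n mA.
have f0' y : 0 <= (f y)%:E by rewrite lee_fin.
have mf' : measurable_fun setT (EFin \o f) by exact/measurable_EFinP.
have mK : measurable_fun setT (fun w => \int[K (xi n w)]_y (f y)%:E).
  apply: (measurableT_comp (f := fun z => \int[K z]_y (f y)%:E)) => //.
  by apply: measurable_fun_integral_kernel => // U mU; exact: measurable_kernel.
rewrite (step_integral n Xx mA f0' mf') -!integral_cst// -!ge0_integralD//.
- apply: ae_ge0_le_integral => //.
  + by move=> w _; rewrite adde_ge0// ?lee_fin// integral_ge0.
  + by apply: emeasurable_funD => //; exact: measurable_funTS.
  + by move=> w _; rewrite adde_ge0// lee_fin.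
  + apply: emeasurable_funD => //; apply: measurable_funTS.
    by apply/measurable_EFinP; apply: measurableT_comp.
  + have := xi_ae n Xx; apply: filterS => w Xw Ew.
    rewrite -law_integral//; apply: H => //; exact: Ew.
- by apply: measurable_funTS; apply/measurable_EFinP; apply: measurableT_comp.
- by move=> w _; rewrite integral_ge0.
- exact: measurable_funTS.
Qed.

(* [A] constrains the path up to time [m], [C] from then on; [H] is the target. *)
Definition then_stay (A : nat -> set R) (m : nat) (C : set R) (i : nat) : set R :=
  if (i <= m)%N then A i else C.

(** In one step from [E n] the chain enters [H], where [f >= 1], or stays in [C] and the sum goes
    on; any other exit is dropped because [f >= 0]. The cases [g = h = 0], [g = 0] and
    [g = 1, h = 0] yield the maximal inequality, the survival bound and Foster's bound. *)
Lemma telescoped_drift_le x A m (C H : set R) (f : R -> R) (g h : R) : X x ->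
  (forall i, measurable (A i)) -> measurable C -> measurable H -> A m `<=` C ->
  C `&` H = set0 ->
  (forall y, (0 <= f y)%R) -> measurable_fun setT f -> (0 <= g)%R -> (0 <= h)%R ->
  (forall y, H y -> (1 <= f y)%R) ->
  (forall y, X y -> C y -> \int[Px y]_w (f (xi 1%N w))%:E + g%:E <= (f y)%:E + h%:E) ->
  let E := cylinder (then_stay A m C) in
  forall N, \sum_(m <= n < m + N) (Px x (E n `&` [set w | H (xi n.+1 w)]) + g%:E * Px x (E n)) +
    \int[Px x]_(w in E (m + N)%N) (f (xi (m + N) w))%:E <=
  \int[Px x]_(w in cylinder A m) (f (xi m w))%:E + (h *+ N)%:E * Px x (cylinder A m).
Proof.
move=> Xx mA mC mH AC CH f0 mf g0 h0 fH fC E.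
have mA' i : measurable (then_stay A m C i) by rewrite /then_stay; case: ifP.
have mE n : measurable (E n) by exact: measurable_cylinder.
have Em : E m = cylinder A m.
  by apply/seteqP; split => w Ew i im; have := Ew i im; rewrite /then_stay im.
have Emon n : E n.+1 `<=` E n by rewrite /E cylinderS => w [].
have mfx n : measurable_fun setT (fun w => (f (xi n w))%:E).
  by apply/measurable_EFinP; apply: measurableT_comp.
elim=> [|N IH]; first by rewrite addn0 big_geq// add0e mulr0n mul0e adde0 Em.
have mN : (m <= m + N)%N by exact: leq_addr.
rewrite addnS big_nat_recr//=.
set n := (m + N)%N in IH mN *.
have ACn : then_stay A m C n `<=` C.
  move: mN; move: n {IH}; clear -AC => n mn.
  rewrite /then_stay; case: ifP => [nm|_]; last by [].
  have e : n = m by apply: anti_leq; rewrite nm mn.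
  by rewrite e.
have s : \int[Px x]_(w in E n) (f (xi n.+1 w))%:E + g%:E * Px x (E n) <=
  \int[Px x]_(w in E n) (f (xi n w))%:E + h%:E * Px x (E n).
  by apply: step_le => // y Xy /ACn; exact: fC.
have PE : Px x (E n) <= Px x (cylinder A m).
  apply: le_measure; rewrite ?inE//; first exact: measurable_cylinder.
  rewrite -Em => w Ew i im; apply: Ew; exact: leq_trans im mN.
have mHn : measurable [set w | H (xi n.+1 w)] by exact: measurable_xi.
have split : Px x (E n `&` [set w | H (xi n.+1 w)]) +
    \int[Px x]_(w in E n.+1) (f (xi n.+1 w))%:E <= \int[Px x]_(w in E n) (f (xi n.+1 w))%:E.
  have dis : [disjoint (E n `&` [set w | H (xi n.+1 w)]) & E n.+1].
    apply/disj_setPS => w [[_ /= Hw]]; rewrite /E cylinderS => -[_ /=].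
    rewrite /then_stay leqNgt ltnS mN/= => Cw.
    by have : (C `&` H) (xi n.+1 w) by []; rewrite CH.
  have mI : measurable (E n `&` [set w | H (xi n.+1 w)]) by exact: measurableI.
  apply: (@le_trans _ _ (\int[Px x]_(w in (E n `&` [set w | H (xi n.+1 w)]) `|` E n.+1)
      (f (xi n.+1 w))%:E)).
    rewrite ge0_integral_setU//.
    - rewrite leeD2r// -[leLHS]mul1e -integral_cst//.
      apply: ge0_le_integral => //; [exact: measurable_funTS|].
      by move=> w [_ /= Hw]; rewrite lee_fin; exact: fH.
    - exact: measurable_funTS.
    - by move=> w _; rewrite lee_fin.
  apply: ge0_subset_integral => //.
  - exact: measurableU.
  - exact: measurable_funTS.
  - by move=> w _; rewrite lee_fin.
  - by move=> w [[]//|]; exact: Emon.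
apply: (@le_trans _ _ (\sum_(m <= n0 < n) (Px x (E n0 `&` [set w | H (xi n0.+1 w)]) + g%:E * Px x (E n0)) +
   \int[Px x]_(w in E n) (f (xi n w))%:E + h%:E * Px x (E n))).
  rewrite -addeA -[leRHS]addeA leeD2l//.
  apply: le_trans s; rewrite addeAC leeD2r//.
rewrite mulrSr EFinD ge0_muleDl ?lee_fin ?mulrn_wge0//.
rewrite [leRHS]addeA; apply: leeD; first exact: IH.
by apply: lee_wpmul2l => //; rewrite lee_fin.
Qed.

Lemma integral_le_cylinder x A m (f : R -> R) (q : R) : (forall i, measurable (A i)) ->
  (forall y, (0 <= f y)%R) -> measurable_fun setT f -> (forall y, A m y -> (f y <= q)%R) ->
  \int[Px x]_(w in cylinder A m) (f (xi m w))%:E <= q%:E * Px x (cylinder A m).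
Proof.
move=> mA f0 mf fq; have mE := measurable_cylinder m mA.
rewrite -integral_cst//; apply: ge0_le_integral => //.
- by move=> w _; rewrite lee_fin.
- by apply: measurable_funTS; apply/measurable_EFinP; apply: measurableT_comp.
- by move=> w Ew; rewrite lee_fin; apply: fq; exact: Ew.
Qed.

(** Boole's inequality sums over the exit time, and the telescoped drift bounds all partial sums
    alike. The factor [Px x (cylinder A m)] allows a further summation over disjoint histories. *)
Lemma maximal_ineq x A m (C H : set R) (f : R -> R) (q : R) : X x ->
  (forall i, measurable (A i)) -> measurable C -> measurable H -> A m `<=` C ->
  C `&` H = set0 ->
  (forall y, (0 <= f y)%R) -> measurable_fun setT f -> (forall y, H y -> (1 <= f y)%R) ->
  (forall y, X y -> C y -> \int[Px y]_w (f (xi 1%N w))%:E <= (f y)%:E) ->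
  (forall y, A m y -> (f y <= q)%R) ->
  Px x (\bigcup_n (cylinder (then_stay A m C) (m + n)%N `&` [set w | H (xi (m + n).+1 w)])) <=
  q%:E * Px x (cylinder A m).
Proof.
move=> Xx mA mC mH AC CH f0 mf fH fC fq.
have mA' i : measurable (then_stay A m C i) by rewrite /then_stay; case: ifP.
set F := fun n => _ `&` _.
have mF n : measurable (F n).
  by apply: measurableI; [exact: measurable_cylinder|exact: measurable_xi].
have fC' y : X y -> C y -> \int[Px y]_w (f (xi 1%N w))%:E + 0%:E <= (f y)%:E + 0%:E.
  by move=> Xy Cy; rewrite !adde0; exact: fC.
have := generalized_Boole_inequality (Px x) mF (bigcupT_measurable _ mF).
move=> /le_trans; apply; apply: lime_le; first exact: is_cvg_nneseries.
apply: nearW => N.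
have := telescoped_drift_le Xx mA mC mH AC CH f0 mf (lexx 0%R) (lexx 0%R) fH fC' N.
rewrite mul0rn mul0e adde0 => h.
apply: le_trans (integral_le_cylinder x mA f0 mf fq).
apply: le_trans h; rewrite -[leLHS]adde0; apply: leeD; last first.
  by apply: integral_ge0 => w _; rewrite lee_fin.
have sh (G : nat -> \bar R) : \sum_(m <= n < m + N) G n = \sum_(0 <= i < N) G (m + i)%N.
  by rewrite -{1}[m]add0n (addnC m N) big_addn addnK; apply: eq_bigr => i _; rewrite addnC.
by rewrite sh; apply: lee_sum => i _; rewrite mul0e adde0.
Qed.

(** [f] starts at 0, grows by at most [h] per step on average and is at least 1 outside [C], so
    given the history the chain leaves [C] within [N] steps with probability at most [N h]. *)
Lemma stay_lower x A m (C : set R) (f : R -> R) (h : R) : X x ->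
  (forall i, measurable (A i)) -> measurable C -> A m `<=` C ->
  (forall y, (0 <= f y)%R) -> measurable_fun setT f -> (0 <= h)%R ->
  (forall y, ~ C y -> (1 <= f y)%R) ->
  (forall y, X y -> C y -> \int[Px y]_w (f (xi 1%N w))%:E <= (f y)%:E + h%:E) ->
  (forall y, A m y -> (f y <= 0)%R) ->
  forall N, Px x (cylinder A m) <= Px x (cylinder (then_stay A m C) (m + N)%N) +
    (h *+ N)%:E * Px x (cylinder A m).
Proof.
move=> Xx mA mC AC f0 mf h0 fH fC fq N.
have mA' i : measurable (then_stay A m C i) by rewrite /then_stay; case: ifP.
have mE n : measurable (cylinder (then_stay A m C) n) by exact: measurable_cylinder.
have fC' y : X y -> C y -> \int[Px y]_w (f (xi 1%N w))%:E + 0%:E <= (f y)%:E + h%:E.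
  by move=> Xy Cy; rewrite adde0; exact: fC.
have CC : C `&` ~` C = set0 by rewrite setICr.
have Em : cylinder (then_stay A m C) m = cylinder A m.
  by apply/seteqP; split => w Ew i im; have := Ew i im; rewrite /then_stay im.
have M := telescoped_drift_le Xx mA mC (measurableC mC) AC CC f0 mf (lexx 0%R) h0 fH fC' N.
have i0 : \int[Px x]_(w in cylinder A m) (f (xi m w))%:E <= 0.
  by have := integral_le_cylinder x mA f0 mf fq; rewrite mul0e.
have S : \sum_(m <= n < m + N) Px x (cylinder (then_stay A m C) n `&` [set w | (~` C) (xi n.+1 w)])
    <= (h *+ N)%:E * Px x (cylinder A m).
  have : \int[Px x]_(w in cylinder A m) (f (xi m w))%:E + (h *+ N)%:E * Px x (cylinder A m)
    <= (h *+ N)%:E * Px x (cylinder A m) by rewrite -[leRHS]add0e leeD2r.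
  apply: le_trans; apply: le_trans M; rewrite -[leLHS]adde0; apply: leeD; last first.
    by apply: integral_ge0 => w _; rewrite lee_fin.
  by apply: lee_sum => i _; rewrite mul0e adde0.
apply: (@le_trans _ _ (Px x (cylinder (then_stay A m C) (m + N)%N) +
  \sum_(m <= n < m + N) Px x (cylinder (then_stay A m C) n `&` [set w | (~` C) (xi n.+1 w)])));
  last by rewrite leeD2l.
elim: {M S} N => [|N IH]; first by rewrite addn0 big_geq// adde0 Em.
apply: (le_trans IH); rewrite addnS big_nat_recr ?leq_addr//= addeA [leRHS]addeAC leeD2r//.
apply: (@le_trans _ _ (Px x (cylinder (then_stay A m C) (m + N).+1 `|`
   (cylinder (then_stay A m C) (m + N) `&` [set w | (~` C) (xi (m + N).+1 w)])))).
  apply: le_measure; rewrite ?inE//.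
    by apply: measurableU => //; apply: measurableI => //; apply: measurable_xi; exact: measurableC.
  move=> w Ew; have [Cw|Cw] := pselect (C (xi (m + N).+1 w)); [left|right]; last by split.
  by rewrite cylinderS; split => //=; rewrite /then_stay leqNgt ltnS leq_addr.
by apply: measureU2 => //; apply: measurableI => //; apply: measurable_xi; exact: measurableC.
Qed.

(** Foster's argument: each step started in [C] costs on average one unit of [f]. *)
Lemma sum_stay_le x (C : set R) (f : R -> R) : X x -> measurable C -> C x ->
  (forall y, (0 <= f y)%R) -> measurable_fun setT f ->
  (forall y, X y -> C y -> \int[Px y]_w (f (xi 1%N w))%:E + 1 <= (f y)%:E) ->
  \sum_(n <oo) Px x (cylinder (fun=> C) n) <= (f x)%:E.
Proof.
move=> Xx mC Cx f0 mf fC; apply: lime_le; first exact: is_cvg_nneseries.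
apply: nearW => N.
have fC' y : X y -> C y -> \int[Px y]_w (f (xi 1%N w))%:E + 1%:E <= (f y)%:E + 0%:E.
  by move=> Xy Cy; rewrite adde0; exact: fC.
have E : cylinder (then_stay (fun=> C) 0 C) = cylinder (fun=> C).
  by apply/funext => n; apply/seteqP; split => w Ew i im;
    have := Ew i im; rewrite /then_stay; case: ifP.
have := telescoped_drift_le (A := fun=> C) (m := 0%N) (H := set0) Xx (fun=> mC) mC
  measurable0 (@subset_refl _ C) (setI0 C) f0 mf ler01 (lexx 0%R) (fun y => False_ind _) fC' N.
rewrite mul0rn mul0e adde0 E add0n => h.
have h2 : \int[Px x]_(w in cylinder (fun=> C) 0) (f (xi 0 w))%:E <= (f x)%:E.
  have mE := @measurable_cylinder (fun=> C) 0 (fun=> mC).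
  apply: (@le_trans _ _ (\int[Px x]_w (f (xi 0%N w))%:E)).
    apply: ge0_subset_integral => //; last by move=> w _; rewrite lee_fin.
    by apply/measurable_EFinP; apply: measurableT_comp.
  rewrite (@ae_eq_integral _ _ _ (Px x) setT (cst (f x)%:E))//.
  - by rewrite integral_cst//= probability_setT mule1.
  - by apply/measurable_EFinP; apply: measurableT_comp.
  - by have := xi0_ae Xx; apply: filterS => w -> _.
apply: le_trans h2; apply: le_trans h; rewrite -[leLHS]adde0; apply: leeD; last first.
  by apply: integral_ge0 => w _; rewrite lee_fin.
by apply: lee_sum => i _; rewrite mul1e leeDr.
Qed.

Definition outside (a : R) : set R := [set y | (a < `|y|)%R].

Lemma measurable_outside a : measurable (outside a).
Proof.
have := measurable_fun_ltr (measurable_cst a) (@normr_measurable R setT).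
by move=> /(_ measurableT [set true]); rewrite setTI; apply.
Qed.

(** [tau > n] holds exactly on the [n]-th cylinder. Without any visit, the infimum of the empty set
    and the series of ones are both infinite. *)
Lemma tauE a w : tau xi a w = \sum_(n <oo) (\1_(cylinder (fun=> outside a) n) w)%:E.
Proof.
set E := cylinder (fun=> outside a).
have i0 n : 0 <= (\1_(E n) w)%:E :> \bar R by rewrite lee_fin.
apply/eqP; rewrite eq_le; apply/andP; split; last first.
  apply: le_ereal_inf_tmp => _ [k /= ka <-].
  apply: lime_le; first by apply: is_cvg_nneseries => n _ _; exact: i0.
  apply: nearW => N.
  apply: (@le_trans _ _ (\sum_(0 <= n < N) (n < k)%N%:R%:E)).
    apply: lee_sum => n _; rewrite lee_fin indicE.
    have [nk|kn] := ltnP n k; first by rewrite lern1; case: (_ \in _).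
    rewrite memNset// => Ew; have := Ew k kn; rewrite /outside/=.
    by rewrite ltNge ka.
  rewrite sumEFin lee_fin -natr_sum ler_nat.
  rewrite -big_mkcond/= sum1_count.
  elim: N => [|N IH]; first by rewrite /index_iota.
  rewrite /index_iota subn0 -[N.+1]addn1 iotaD add0n count_cat/= addn0.
  have [Nk|kN] := ltnP N k; last by move: IH; rewrite addn0 /index_iota subn0.
  rewrite (leq_trans _ Nk)// addn1 ltnS (leq_trans (count_size _ _))// size_iota//.
have [[k ka]|nk] := pselect (exists k, (`|xi k w| <= a)%R).
  have [k0 k0a km] := ex_minnP (ex_intro (fun k => (`|xi k w| <= a)%R) k ka).
  apply: (@le_trans _ _ k0%:R%:E); first by apply: ereal_inf_lbound; exists k0.
  apply: le_trans (nneseries_lim_ge k0 (fun n _ _ => i0 n)).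
  rewrite (eq_big_nat _ _ (F2 := fun=> 1%:E)); last first.
    move=> n /andP[_ nk0]; rewrite indicE mem_set// => i ni; rewrite /outside/= ltNge.
    by apply/negP => ia; have := km _ ia; rewrite leqNgt (leq_ltn_trans ni nk0).
  by rewrite sumEFin big_const_nat subn0 iter_addr addr0 -[leRHS]/((1 *+ k0)%:E).
have -> : \sum_(n <oo) (\1_(E n) w)%:E = +oo :> \bar R; last by rewrite leey.
apply/eqyP => B B0.
apply: (@le_trans _ _ (Num.truncn B).+1%:R%:E).
  by rewrite lee_fin ltW// truncnS_gt.
apply: le_trans (nneseries_lim_ge (Num.truncn B).+1 (fun n _ _ => i0 n)).
rewrite (eq_big_nat _ _ (F2 := fun=> 1%:E)); last first.
  move=> n _; rewrite indicE mem_set// => i ni; rewrite /outside/= ltNge.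
  by apply/negP => ia; apply: nk; exists i.
by rewrite sumEFin big_const_nat subn0 iter_addr addr0.
Qed.

Lemma integral_tau x a :
  \int[Px x]_w tau xi a w = \sum_(n <oo) Px x (cylinder (fun=> outside a) n).
Proof.
have mE n := @measurable_cylinder (fun=> outside a) n (fun=> measurable_outside a).
under eq_integral do rewrite tauE.
rewrite integral_nneseries//.
- by apply: eq_eseriesr => n _; rewrite integral_indic// setIT.
- by move=> n; apply/measurable_EFinP; exact: measurable_indic.
Qed.

End chain.

(** * Lyapunov criteria *)

Section limsup_aux.
Context {R : realType}.
Implicit Type u : nat -> R.

Lemma limn_esup_pinfty u : limn_esup (fun n => (u n)%:E) = +oo%E ->
  forall (N : R) m, exists2 n, (m <= n)%N & N < u n.
Proof.
move=> h N m.
have : (+oo <= ereal_sup ((fun n => (u n)%:E) @` [set k | (m <= k)%N]))%E.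
  rewrite -h; apply: ereal_inf_lbound; exists [set k | (m <= k)%N] => //.
  by exists m.
rewrite leye_eq => /eqP e.
have : (N%:E < ereal_sup ((fun n => (u n)%:E) @` [set k | (m <= k)%N]))%E by rewrite e ltry.
by move=> /ereal_sup_gt[_ [n /= mn <-]]; rewrite lte_fin => Nu; exists n.
Qed.

Lemma limn_einf_le u (r : R) : (forall m, exists2 n, (m <= n)%N & u n <= r) ->
  (limn_einf (fun n => (u n)%:E) <= r%:E)%E.
Proof.
move=> h; rewrite /limn_einf leeNl; apply: le_ereal_inf_tmp => _ [V [m _ mV] <-].
have [n mn un] := h m.
apply: (@le_trans _ _ (- (u n)%:E)%E); first by rewrite leeN2 lee_fin.
by apply: ereal_sup_ubound; exists n => //; exact: mV.
Qed.

Lemma first_passage u m (N : R) : (exists2 n, (m <= n)%N & N <= u n) ->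
  exists n, [/\ (m <= n)%N, N <= u n & forall i, (m <= i < n)%N -> u i < N].
Proof.
move=> [n mn Nn]; have ex : exists n, (m <= n)%N && (N <= u n) by exists n; rewrite mn.
have [k /andP[mk Nk] kmin] := ex_minnP ex; exists k; split=> // i /andP[mi ik].
by rewrite ltNge; apply/negP => Ni; have := kmin i; rewrite mi Ni leqNgt ik => /(_ isT).
Qed.

End limsup_aux.

Section lyapunov_criteria.
Context {R : realType} (d : measure_display) (Omega : measurableType d)
  (X : set R) (K : R.-pker R ~> R) (Px : R -> probability Omega R)
  (xi : nat -> Omega -> R).
Hypothesis mX : measurable X.
Hypothesis mc : is_markov_chain X K Px xi.

Let mxi n : measurable_fun setT (xi n). Proof. by have [h _] := mc. Qed.

(** The value 1 at 0 keeps the factor of modulus one everywhere. *)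
Definition sg (x : R) : R := if 0 <= x then 1 else -1.

Lemma sgM (x : R) : sg x * x = `|x|.
Proof.
rewrite /sg; have [x0|] := boolP (0 <= x); first by rewrite mul1r ger0_norm.
by rewrite -ltNge => x0; rewrite ltr0_norm// mulN1r.
Qed.

Lemma normr_sgM (x y : R) : `|sg x * y| = `|y|.
Proof. by rewrite /sg; case: ifP => _; rewrite ?mul1r// mulN1r normrN. Qed.

Definition outjump (x : R) (w : Omega) : R := sg x * theta xi w.

Lemma measurable_outjump x : measurable_fun setT (outjump x).
Proof. by apply: measurable_funM => //; exact: measurable_funB. Qed.

Lemma xi1E_ae x : X x -> {ae Px x, forall w, sg x * xi 1%N w = `|x| + outjump x w}.
Proof.
move=> Xx; have := xi0_ae mc Xx; apply: filterS => w h.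
by rewrite /outjump /theta h mulrBr sgM; ring.
Qed.

Lemma integral_xi1 x (f : R -> R) : X x -> (forall y, 0 <= f y) -> measurable_fun setT f ->
  (\int[Px x]_w (f (sg x * xi 1%N w))%:E = \int[Px x]_w (f (`|x| + outjump x w))%:E)%E.
Proof.
move=> Xx f0 mf; apply: ge0_ae_eq_integral => //.
- apply/measurable_EFinP; apply: (measurableT_comp mf); exact: measurable_funM.
- apply/measurable_EFinP; apply: (measurableT_comp mf); apply: measurable_funD => //.
  exact: measurable_outjump.
- by move=> w _; rewrite lee_fin.
- by move=> w _; rewrite lee_fin.
- by have := xi1E_ae Xx; apply: filterS => w -> _.
Qed.

Lemma integral_norm_xi1 x (f : R -> R) : X x -> (forall y, 0 <= f y) -> measurable_fun setT f ->
  (\int[Px x]_w (f `|xi 1%N w|)%:E = \int[Px x]_w (f `| `|x| + outjump x w|)%:E)%E.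
Proof.
move=> Xx f0 mf.
have mf' : measurable_fun setT (fun y : R => f `|y|).
  by apply: (measurableT_comp mf); exact: normr_measurable.
rewrite -(integral_xi1 Xx (fun y => f0 `|y|) mf').
by apply: eq_integral => w _; rewrite normr_sgM.
Qed.

(** A path that stays outside [r0] from time [m] on would, being unbounded, reach every level
    without return. [L] bounds its position at time [m]; the countably many pairs of [L] and [m]
    contribute one null set. *)
Lemma recurrentP (r0 : R) : condN' X Px xi -> expR 1 <= r0 ->
  (forall x, X x -> r0 <= `|x| ->
     (\int[Px x]_w (ln (Num.max `| `|x| + outjump x w| 1))%:E <= (ln `|x|)%:E)%E) ->
  recurrent X Px xi.
Proof.
move=> HN r0e dr; exists r0 => x Xx.
have r01 : 1 <= r0 by rewrite (le_trans _ r0e)// ltW// expR_gt1.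
pose f (y : R) : R := ln (Num.max `|y| 1).
have f0 y : 0 <= f y by rewrite ln_ge0// le_max lexx orbT.
have mf : measurable_fun setT f.
  apply: (measurableT_comp (@measurable_ln R)); apply: measurable_maxr => //.
have lnE (y : R) : 1 <= `|y| -> f y = ln `|y| by move=> y1; rewrite /f max_l.
pose C (N : nat) : set R := outside r0 `&` ~` [set y | N%:R <= `|y|].
pose H (N : nat) : set R := [set y | N%:R <= `|y|].
have mH N : measurable (H N).
  have := measurable_fun_ler (@measurable_cst _ _ _ _ setT (N%:R : R)) (@normr_measurable R setT).
  by move=> /(_ measurableT [set true]); rewrite setTI; apply.
have mC N : measurable (C N) by apply: measurableI; [exact: measurable_outside|apply: measurableC; exact: mH].
pose A (L m N : nat) (i : nat) : set R :=
  if i == m then C N `&` [set y | `|y| <= L%:R] else setT.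
have mLe (L : nat) : measurable [set y : R | `|y| <= L%:R].
  have := measurable_fun_ler (@normr_measurable R setT) (@measurable_cst _ _ _ _ setT (L%:R : R)).
  by move=> /(_ measurableT [set true]); rewrite setTI; apply.
have mA L m N i : measurable (A L m N i).
  by rewrite /A; case: ifP => // _; apply: measurableI.
pose B L m N := \bigcup_n (cylinder xi (then_stay (A L m N) m (C N)) (m + n)%N `&`
   [set w | H N (xi (m + n).+1 w)]).
have mB L m N : measurable (B L m N).
  apply: bigcupT_measurable => n; apply: measurableI.
    by apply: (measurable_cylinder mc) => i; rewrite /then_stay; case: ifP.
  exact: (measurable_xi mc).
have PB L m N : (2 <= N)%N -> (Px x (B L m N) <= (ln (Num.max L%:R 1) / ln N%:R)%:E)%E.
  move=> N2; have lN : 0 < ln (N%:R : R) by rewrite ln_gt0// ltr1n.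
  pose fN y := f y / ln N%:R.
  have fN0 y : 0 <= fN y by rewrite divr_ge0// ltW.
  have mfN : measurable_fun setT fN by exact: measurable_funM.
  have AC : A L m N m `<=` C N by rewrite /A eqxx => y [].
  have CH : C N `&` H N = set0 by rewrite -subset0 => y [[_]].
  have fH y : H N y -> 1 <= fN y.
    rewrite /H/= => Ny; rewrite /fN ler_pdivlMr// mul1r /f ler_ln ?posrE ?lt_max ?ltr01 ?orbT//.
      by rewrite le_max Ny.
    by rewrite ltr0n (leq_trans _ N2).
  have fC y : X y -> C N y -> (\int[Px y]_w (fN (xi 1%N w))%:E <= (fN y)%:E)%E.
    move=> Xy [Cy _]; have ry : r0 <= `|y| by exact: ltW.
    under eq_integral do rewrite EFinM muleC.
    rewrite ge0_integralZl_EFin//; last 3 first.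
    - by move=> w _; rewrite lee_fin.
    - by apply/measurable_EFinP; apply: measurableT_comp.
    - by rewrite invr_ge0 ltW.
    rewrite /fN EFinM muleC; apply: lee_wpmul2r; first by rewrite lee_fin invr_ge0 ltW.
    rewrite (lnE y); last exact: le_trans ry.
    have mg : measurable_fun setT (fun y : R => ln (Num.max y 1)).
      by apply: (measurableT_comp (@measurable_ln R)); exact: measurable_maxr.
    have g0 (z : R) : 0 <= ln (Num.max z 1) by rewrite ln_ge0// le_max lexx orbT.
    by rewrite /f (integral_norm_xi1 Xy g0 mg); exact: dr.
  have fq y : A L m N m y -> fN y <= ln (Num.max L%:R 1) / ln N%:R.
    rewrite /A eqxx => -[_ /= yL]; rewrite /fN ler_pM2r ?invr_gt0// /f.
    rewrite ler_ln ?posrE ?lt_max ?ltr01 ?orbT//.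
    by rewrite ge_max !le_max lexx orbT yL.
  have := maximal_ineq mX mc Xx (mA L m N) (mC N) (mH N) AC CH fN0 mfN fH fC fq.
  move=> /le_trans; apply; rewrite -[leRHS]mule1; apply: lee_wpmul2l.
    by rewrite lee_fin divr_ge0 ?(ltW lN)// ln_ge0// le_max lexx orbT.
  by apply: probability_le1; apply: (measurable_cylinder mc) => i.
(* The level [L + N.+2] exceeds [L], so that its passage comes strictly after [m], and is at least
   2, so that its logarithm is positive. *)
have PB0 L m : Px x (\bigcap_N B L m (L + N.+2)%N) = 0%E.
  apply/eqP; rewrite eq_le measure_ge0 andbT; apply/lee_addgt0Pr => e e0; rewrite add0e.
  set l := ln (Num.max L%:R 1) : R.
  have l0 : 0 <= l by rewrite ln_ge0// le_max lexx orbT.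
  pose N := Num.truncn (expR (l / e)).
  have NN : expR (l / e) < (L + N.+2)%:R.
    by rewrite (lt_le_trans (truncnS_gt _))// ler_nat (leq_trans (leqnSn _) (leq_addl _ _)).
  have lN : l / e <= ln (L + N.+2)%:R.
    by rewrite -{1}(expRK (l / e)) ler_ln ?posrE ?expR_gt0 ?ltr0n ?addnS// ltW// -addnS -addnS.
  apply: (@le_trans _ _ (Px x (B L m (L + N.+2)%N))).
    apply: le_measure; rewrite ?inE//; first exact: bigcapT_measurable.
    by move=> w; apply.
  apply: (le_trans (PB L m (L + N.+2)%N _)); first by rewrite addnS addnS.
   rewrite lee_fin -/l.
  by rewrite ler_pdivrMr ?ln_gt0 ?ltr1n ?addnS// -addnS -addnS mulrC -ler_pdivrMr.
have hB : {ae Px x, forall w, forall L m, ~ (\bigcap_N B L m (L + N.+2)%N) w}.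
  apply/ae_foralln => L; apply/ae_foralln => m.
  exists (\bigcap_N B L m (L + N.+2)%N); split.
  - exact: bigcapT_measurable.
  - exact: PB0.
  - by move=> w /= /contrapT.
have hN := HN x Xx.
apply: filterS2 hB hN => w hBw hNw.
apply: limn_einf_le => m; apply: contrapT => nex.
have hout n : (m <= n)%N -> r0 < `|xi n w|.
  by move=> mn; rewrite ltNge; apply/negP => le; apply: nex; exists n.
pose L := (Num.truncn `|xi m w|).+1.
have LL : `|xi m w| < L%:R by rewrite truncnS_gt.
apply: (hBw L m) => N _; set N' := (L + N.+2)%N.
have LN : (L%:R : R) <= N'%:R by rewrite ler_nat leq_addr.
have [|n [mn Nn nmin]] := @first_passage _ (fun n => `|xi n w|) m N'%:R.
  by have [n mn Nn] := limn_esup_pinfty hNw N'%:R m; exists n => //; exact: ltW.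
have mn' : (m < n)%N.
  rewrite ltn_neqAle mn andbT; apply/eqP => e.
  by move: Nn; rewrite -e leNgt (lt_le_trans LL).
have ne : (m + (n - m).-1).+1 = n by rewrite -addnS prednK ?subn_gt0// subnKC.
exists (n - m).-1 => //; split; last by rewrite /= ne.
move=> i ilt; have iN : (i < n)%N by rewrite -ne ltnS.
rewrite /then_stay /A; have [im|mi] := leqP i m.
  case: eqP => // e; subst i; split; last by rewrite /= ltW.
  split; first exact: hout.
  by apply/negP; rewrite -ltNge (lt_le_trans LL).
split; first by apply: hout; exact: ltnW.
by apply/negP; rewrite -ltNge; apply: nmin; rewrite (ltnW mi).
Qed.

(** After the first passage of [N], a fall to [A] as seen from the side reached has probability of
    order [(N / A)^-nu]. Letting [N] grow, almost surely for each [A] in a sequence some passage is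
    followed by no such fall, so the path ends up beyond every [A]. *)
Lemma directionalP (nu A0 : R) : condN' X Px xi -> 0 < nu -> 1 <= A0 ->
  (forall A, A0 <= A -> forall x, X x -> A <= `|x| ->
     (\int[Px x]_w (outpow nu A (`|x| + outjump x w))%:E <= ((`|x| / A) `^ (- nu))%:E)%E) ->
  directional_transient X Px xi.
Proof.
move=> HN nu0 A01 dr x Xx.
pose sn (b : bool) : R := if b then 1 else -1.
have snE (b : bool) (y : R) : 0 < sn b * y -> sg y = sn b.
  rewrite /sn /sg; case: b; first by rewrite mul1r => y0; rewrite ltW.
  by rewrite mulN1r oppr_gt0 => y0; rewrite leNgt y0.
pose C b A : set R := [set y | A < sn b * y].
pose H b A : set R := [set y | sn b * y <= A].
have msn b : measurable_fun setT (fun y : R => sn b * y) by exact: measurable_funM.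
have mC b A : measurable (C b A).
  have := measurable_fun_ltr (@measurable_cst _ _ _ _ setT A) (msn b).
  by move=> /(_ measurableT [set true]); rewrite setTI; apply.
have mH b A : measurable (H b A).
  have := measurable_fun_ler (msn b) (@measurable_cst _ _ _ _ setT A).
  by move=> /(_ measurableT [set true]); rewrite setTI; apply.
(* Here [m] is the first time at absolute value [N] or more, and [b] the side. For fixed [b] the
   histories are disjoint in [m], so their probabilities sum to at most 1. *)
pose hist (b : bool) (N : R) (m i : nat) : set R :=
  if i == m then [set y | N <= sn b * y] else [set y | `|y| < N].
have mhist b N m i : measurable (hist b N m i).
  rewrite /hist; case: ifP => _.
    have := measurable_fun_ler (@measurable_cst _ _ _ _ setT N) (msn b).
    by move=> /(_ measurableT [set true]); rewrite setTI; apply.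
  have := measurable_fun_ltr (@normr_measurable R setT) (@measurable_cst _ _ _ _ setT N).
  by move=> /(_ measurableT [set true]); rewrite setTI; apply.
pose B b A N m := \bigcup_n (cylinder xi (then_stay (hist b N m) m (C b A)) (m + n)%N `&`
   [set w | H b A (xi (m + n).+1 w)]).
have mB b A N m : measurable (B b A N m).
  apply: bigcupT_measurable => n; apply: measurableI.
    by apply: (measurable_cylinder mc) => i; rewrite /then_stay; case: ifP.
  exact: (measurable_xi mc).
have PB b A N m : A0 <= A -> A < N ->
    (Px x (B b A N m) <= ((N / A) `^ (- nu))%:E * Px x (cylinder xi (hist b N m) m))%E.
  move=> AA AN; have A00 : 0 < A by lra.
  pose f y := outpow nu A (sn b * y).
  have f0 y : 0 <= f y by exact: outpow_ge0.
  have mf : measurable_fun setT f.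
    by apply: (measurableT_comp (@measurable_outpow _ nu A)); exact: msn.
  have AC : hist b N m m `<=` C b A.
    by rewrite /hist eqxx => y /= /(lt_le_trans AN).
  have CH : C b A `&` H b A = set0.
    by rewrite -subset0 => y [/= h1 h2]; move: (lt_le_trans h1 h2); rewrite ltxx.
  have fH y : H b A y -> 1 <= f y by rewrite /H/= /f /outpow => ->.
  have fC y : X y -> C b A y -> (\int[Px y]_w (f (xi 1%N w))%:E <= (f y)%:E)%E.
    move=> Xy Cy; have sy0 : 0 < sn b * y by exact: lt_trans Cy.
    have sy := snE _ _ sy0.
    rewrite /f -sy (integral_xi1 Xy (@outpow_ge0 _ nu A) (@measurable_outpow _ nu A)).
    have yE : sg y * y = `|y| by exact: sgM.
    rewrite /C/= -sy yE in Cy.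
    have -> : outpow nu A (sg y * y) = (`|y| / A) `^ (- nu) by rewrite yE /outpow leNgt Cy.
    by apply: dr => //; exact: ltW.
  have fq y : hist b N m m y -> f y <= (N / A) `^ (- nu).
    rewrite /hist eqxx => /= Ny; have -> : f y = (sn b * y / A) `^ (- nu).
      by rewrite /f /outpow leNgt (lt_le_trans AN Ny).
    rewrite !powRN lef_pV2 ?posrE ?powR_gt0 ?divr_gt0//; [|lra..].
    have N00 : 0 <= N by lra.
    have s0 : 0 <= sn b * y by apply: le_trans Ny.
    rewrite ge0_ler_powR ?(ltW nu0) ?nnegrE ?divr_ge0 ?(ltW A00)//.
    by rewrite ler_pM2r ?invr_gt0.
  exact: (maximal_ineq mX mc Xx (mhist b N m) (mC b A) (mH b A) AC CH f0 mf fH fC fq).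
pose V A N := (\bigcup_m B true A N m) `|` (\bigcup_m B false A N m).
have mU b A N : measurable (\bigcup_m B b A N m) by exact: bigcupT_measurable.
have mV A N : measurable (V A N) by exact: measurableU.
have PU b A N : A0 <= A -> A < N -> (Px x (\bigcup_m B b A N m) <= ((N / A) `^ (- nu))%:E)%E.
  move=> AA AN.
  have := generalized_Boole_inequality (Px x) (mB b A N) (mU b A N).
  move=> /le_trans; apply.
  have mcyl m : measurable (cylinder xi (hist b N m) m) by exact: (measurable_cylinder mc).
  apply: (@le_trans _ _ (\sum_(m <oo) ((N / A) `^ (- nu))%:E * Px x (cylinder xi (hist b N m) m))%E).
    by apply: lee_nneseries => // m _; exact: PB.
  rewrite nneseriesZl//.
  rewrite -[leRHS]mule1; apply: lee_wpmul2l; first by rewrite lee_fin powR_ge0.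
  have tr : trivIset setT (fun m => cylinder xi (hist b N m) m).
    apply/trivIsetP => i j _ _; wlog ij : i j / (i < j)%N => [hw|_].
      move=> ij; have [h|h|e] := ltngtP i j; [exact: hw| |by rewrite e eqxx in ij].
      by rewrite setIC; apply: hw; rewrite // eq_sym.
    rewrite -subset0 => w [/(_ i (leqnn i)) + /(_ i (ltnW ij))].
    rewrite /hist eqxx (ltn_eqF ij)/= => h1 h2.
    have : sn b * xi i w <= `|xi i w|.
      by rewrite /sn; case: (b); rewrite ?mul1r ?mulN1r ?ler_norm// -normrN ler_norm.
    lra.
  rewrite -measure_semi_bigcup//; last exact: bigcupT_measurable.
  exact/probability_le1/bigcupT_measurable.
have PV0 A : A0 <= A -> Px x (\bigcap_n V A (A + 1 + n%:R)) = 0%E.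
  move=> AA; have A00 : 0 < A by lra.
  apply/eqP; rewrite eq_le measure_ge0 andbT; apply/lee_addgt0Pr => e e0; rewrite add0e.
  have e2 : 0 < e / 2 by rewrite divr_gt0.
  have [R1 [R11 hR1]] := powRN_eventually_le nu0 e2.
  pose n := (Num.truncn (A * R1)).+1; pose N := A + 1 + n%:R.
  have nA : A * R1 < n%:R by exact: truncnS_gt.
  have AN : A < N by rewrite /N; have := ler0n R n; lra.
  have NR : R1 <= N / A by rewrite ler_pdivlMr// /N; lra.
  have q := hR1 _ NR.
  apply: (@le_trans _ _ (Px x (V A N))).
    apply: le_measure; rewrite ?inE//; first exact: bigcapT_measurable.
    by move=> w; apply.
  apply: (le_trans (measureU2 (Px x) (mU true A N) (mU false A N))).
  have -> : e%:E = ((e / 2)%:E + (e / 2)%:E)%E by rewrite -EFinD; congr EFin; field.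
  by apply: leeD; apply: (le_trans (PU _ _ _ AA AN)); rewrite lee_fin.
have hV : {ae Px x, forall w, forall k : nat, ~ (\bigcap_n V (A0 + k%:R) (A0 + k%:R + 1 + n%:R)) w}.
  apply/ae_foralln => k; exists (\bigcap_n V (A0 + k%:R) (A0 + k%:R + 1 + n%:R)); split.
  - exact: bigcapT_measurable.
  - by apply: PV0; rewrite lerDl.
  - by move=> w /= /contrapT.
apply: filterS2 hV (HN x Xx) => w hVw hNw.
have ev (k : nat) : exists b m, forall i, (m <= i)%N -> A0 + k%:R < sn b * xi i w.
  have [n nV] : exists n, ~ V (A0 + k%:R) (A0 + k%:R + 1 + n%:R) w.
    by apply: contrapT => h; apply: (hVw k) => n _; apply: contrapT => h'; apply: h; exists n.
  set A := A0 + k%:R in nV *; set N := A + 1 + n%:R in nV.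
  have AN : A < N by rewrite /N; have := ler0n R n; lra.
  have [|m [_ Nm mmin]] := @first_passage _ (fun n => `|xi n w|) 0 N.
    by have [i _ Ni] := limn_esup_pinfty hNw N 0; exists i => //; exact: ltW.
  pose b := 0 <= xi m w; exists b, m => i mi.
  have sb : sn b * xi m w = `|xi m w| by rewrite -sgM.
  rewrite ltNge; apply/negP => iA; apply: nV.
  (* The first fall to [A] is a first passage of the negated path at level [- A]. *)
  have [|n' [mn' An' nmin]] := @first_passage _ (fun i => - (sn b * xi i w)) m (- A).
    by exists i => //; rewrite lerN2.
  have mltn : (m < n')%N.
    rewrite ltn_neqAle mn' andbT; apply/eqP => e.
    by move: An'; rewrite -e sb lerN2; lra.
  have ne : (m + (n' - m).-1).+1 = n' by rewrite -addnS prednK ?subn_gt0// subnKC.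
  have Bw : (\bigcup_m B b A N m) w.
    exists m => //; exists (n' - m).-1 => //; split; last by rewrite /= ne /H/= -lerN2.
    move=> j jlt; have jn : (j < n')%N by rewrite -ne ltnS.
    rewrite /then_stay /hist; have [jm|mj] := leqP j m.
      case: eqP => [->|/eqP e]; first by rewrite /= sb.
      by apply: mmin; rewrite /= ltn_neqAle e jm.
    by rewrite /C/= -ltrN2; apply: nmin; rewrite (ltnW mj).
  by move: Bw; case: (b) => ?; [left|right].
have [b0 [m0 h0]] := ev 0.
(* All [k] give the same side: at a common late time both signed positions are positive, because
   [A0 >= 1]. *)
have evb (k : nat) : exists m, forall i, (m <= i)%N -> A0 + k%:R < sn b0 * xi i w.
  have [b [m h]] := ev k; exists m => i mi.
  suff -> : b0 = b by exact: h.
  have i0 := h0 (maxn m m0) (leq_maxr _ _); have i1 := h (maxn m m0) (leq_maxl _ _).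
  move: i0 i1; rewrite addr0; have := ler0n R k.
  by rewrite /sn; case: (b0); case: (b); rewrite ?mul1r ?mulN1r//; lra.
have evr (r : R) : \forall i \near \oo, r <= sn b0 * xi i w.
  have [m hm] := evb (Num.truncn r).+1; exists m => // i /= /hm.
  by have := truncnS_gt r; lra.
move: evr; rewrite /sn; case: (b0) => evr; [left|right].
  by apply/cvgryPge => r; apply: filterS (evr r) => i; rewrite mul1r.
apply/cvgrNyPle => r; apply: filterS (evr (- r)) => i; rewrite mulN1r lerN2; exact.
Qed.

Lemma positiveP (nu a0 : R) : 0 < a0 ->
  (forall x, X x -> a0 <= `|x| ->
     (\int[Px x]_w (`| `|x| + outjump x w| `^ nu)%:E + 1 <= (`|x| `^ nu)%:E)%E) ->
  positive_recurrent X Px xi.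
Proof.
move=> a00 dr; exists a0 => a aa x Xx; rewrite (integral_tau mc).
have [xa|ax] := leP `|x| a.
  suff -> : (\sum_(n <oo) Px x (cylinder xi (fun=> outside a) n) = 0)%E by exact: ltry.
  apply: eseries0 => n _ _; apply/negligibleP.
    by apply: (measurable_cylinder mc) => i; exact: measurable_outside.
  have := xi0_ae mc Xx; apply: negligibleS => w /= h e.
  by move: (h 0%N (leq0n n)); rewrite /outside/= e ltNge xa.
pose f (y : R) := `|y| `^ nu.
have f0 y : 0 <= f y by exact: powR_ge0.
have mp : measurable_fun setT (fun y : R => y `^ nu) by exact: measurable_powR.
have mf : measurable_fun setT f by apply: (measurableT_comp mp); exact: normr_measurable.
apply: (@le_lt_trans _ _ (f x)%:E); last exact: ltry.
apply: (sum_stay_le mX mc Xx (measurable_outside a) ax f0 mf).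
move=> y Xy ay; rewrite /f (integral_norm_xi1 Xy (fun y => powR_ge0 y nu) mp).
by apply: dr => //; rewrite (le_trans aa)// ltW.
Qed.

Lemma nullP (al C k z0 a0 : R) : 0 < al -> 0 < C -> 0 < k -> 1 <= z0 -> 0 < a0 ->
  (forall z, z0 <= z -> forall x, X x -> z / 2 <= `|x| ->
    (\int[Px x]_w (phi (`| `|x| + outjump x w| / z))%:E <=
       (phi (`|x| / z) + C * z `^ (- al))%:E)%E) ->
  (forall z, z0 <= z -> forall x, X x -> a0 <= `|x| ->
     k * z `^ (- al) <= fine (Px x [set w | z < outjump x w])) ->
  forall a, a0 <= a -> forall x, X x -> a < `|x| ->
    (\int[Px x]_w tau xi a w)%E = +oo%E.
Proof.
move=> al0 C0 k0 z01 a00 dr tl a aa x Xx ax; rewrite (integral_tau mc).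
set E := cylinder xi (fun=> outside a).
have mE n : measurable (E n) by apply: (measurable_cylinder mc) => i; exact: measurable_outside.
pose q n := fine (Px x (E n)).
have qE n : Px x (E n) = (q n)%:E by rewrite /q fineK// fin_num_measure.
have q0 n : 0 <= q n by exact: fine_ge0.
(* Half of the jump probability [k z^-al], taken at [z^al = 2 C (n + 1)], equals [k' / (n + 1)]. *)
pose k' := k / (4 * C).
have k'0 : 0 < k' by rewrite divr_gt0// mulr_gt0.
(* Once [2 C n >= D], the level [z] is at least [z0] and [2 a]; the latter ensures that a path above
   [z / 2] stays outside [a]. *)
pose D := (Num.max z0 (2 * a)) `^ al.
have lower n : D / (2 * C) <= n%:R -> k' * n.+1%:R^-1 <= q n.+1.
  move=> Dn; have n0 : 0 < n.+1%:R :> R by rewrite ltr0n.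
  pose z := (2 * C * n.+1%:R) `^ al^-1.
  have zz0 : 0 <= 2 * C * n.+1%:R by rewrite !mulr_ge0// ltW.
  have zal : z `^ al = 2 * C * n.+1%:R by rewrite /z -powRrM mulVf ?gt_eqF// powRr1.
  have zp : 0 < z by rewrite powR_gt0// !mulr_gt0.
  have znal : z `^ (- al) = (2 * C * n.+1%:R)^-1 by rewrite powRN zal.
  have zD : Num.max z0 (2 * a) <= z.
    rewrite leNgt; apply/negP => h.
    have : z `^ al < D by rewrite gt0_ltr_powR ?nnegrE ?(ltW zp)// le_max (le_trans ler01 z01).
    rewrite zal; move: Dn; rewrite ler_pdivrMr ?mulr_gt0// -natr1; nra.
  move: zD; rewrite ge_max => /andP[zz z2a].
  pose A i : set R := if i == 0%N then outside a else [set y | z <= `|y|].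
  have mge : measurable [set y : R | z <= `|y|].
    have := measurable_fun_ler (@measurable_cst _ _ _ _ setT z) (@normr_measurable R setT).
    by move=> /(_ measurableT [set true]); rewrite setTI; apply.
  have mA i : measurable (A i).
    by rewrite /A; case: ifP => // _; exact: measurable_outside.
  have AC : A 1%N `<=` outside (z / 2) by rewrite /A /outside => y /=; lra.
  pose f (y : R) := phi (`|y| / z).
  have f0 y : 0 <= f y by exact: phi_ge0.
  have mphi : measurable_fun setT (@phi R).
    apply: measurable_minr => //; apply: measurable_funM => //; apply: measurable_funX.
    by apply: measurable_maxr => //; exact: measurable_funB.
  have mp : measurable_fun setT (fun y : R => phi (y / z)).
    by apply: (measurableT_comp mphi); exact: measurable_funM.
  have mf : measurable_fun setT f by apply: (measurableT_comp mp); exact: normr_measurable.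
  have fH y : ~ outside (z / 2) y -> 1 <= f y.
    rewrite /outside/= => /negP; rewrite -leNgt => yz.
    by rewrite /f phi_eq1// ler_pdivrMr//; lra.
  have fA y : A 1%N y -> f y <= 0.
    by rewrite /A/= => zy; rewrite /f phi_eq0// ler_pdivlMr// mul1r.
  have h0 : 0 <= C * z `^ (- al) by rewrite mulr_ge0 ?powR_ge0// ltW.
  have fC y : X y -> outside (z / 2) y ->
      (\int[Px y]_w (f (xi 1%N w))%:E <= (f y)%:E + (C * z `^ (- al))%:E)%E.
    move=> Xy zy; rewrite /f (integral_norm_xi1 Xy (fun y => phi_ge0 (y / z)) mp).
    by rewrite -EFinD; apply: dr => //; exact: ltW.
  have st := stay_lower mX mc Xx mA (measurable_outside _) AC f0 mf h0 fH fC fA n.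
  have mcA : measurable (cylinder xi A 1) by exact: (measurable_cylinder mc).
  set E' := cylinder xi (then_stay A 1 (outside (z / 2))) (1 + n)%N in st.
  have mE' : measurable E'.
    apply: (measurable_cylinder mc) => i; rewrite /then_stay; case: ifP => // _.
    exact: measurable_outside.
  have E'E : E' `<=` E n.+1.
    move=> w E'w i ni; have := E'w i ni; rewrite /then_stay /A /outside.
    by case: ifP => _ /=; [case: ifP => _ /=|]; lra.
  have p1 : k * z `^ (- al) <= fine (Px x (cylinder xi A 1)).
    apply: (le_trans (tl _ zz _ Xx (le_trans aa (ltW ax)))).
    have mo : measurable [set w | z < outjump x w].
      exact: (measurable_gt (measurable_outjump x)).
    (* The jump is measured from [xi 0], which equals [x] only almost surely, so the inclusion of
       events holds up to the null set [M]. *)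
    have [M [mM M0 Msub]] : {ae Px x, forall w, xi 0%N w = x /\ sg x * xi 1%N w = `|x| + outjump x w}.
      by apply: filterS2 (xi0_ae mc Xx) (xi1E_ae Xx) => w.
    rewrite -lee_fin !fineK ?fin_num_measure//.
    apply: (@le_trans _ _ (Px x (cylinder xi A 1 `|` M))).
      apply: le_measure; rewrite ?inE//; first exact: measurableU.
      move=> w zw; have [Mw|Mw] := pselect (M w); [by right|left].
      have [e0 e1] : xi 0%N w = x /\ sg x * xi 1%N w = `|x| + outjump x w.
        by apply: contrapT => h; apply: Mw; exact: Msub.
      move=> [_|[_|//]]; first by rewrite /A/= e0.
      rewrite /A/= -(normr_sgM x) e1; have := normr_ge0 x; move: zw => /=.
      by have := ler_norm (`|x| + outjump x w); lra.
    by apply: (le_trans (measureU2 _ mcA mM)); rewrite [X in (_ + X)%E]M0 adde0.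
  have p2 : fine (Px x E') <= q n.+1.
    by rewrite -lee_fin -qE fineK ?fin_num_measure// le_measure ?inE.
  move: st; rewrite -[Px x (cylinder xi A 1)]fineK ?fin_num_measure//.
  rewrite -[Px x E']fineK ?fin_num_measure// -EFinM -EFinD lee_fin.
  rewrite -[_ *+ n]mulr_natl znal.
  have -> : n%:R * (C / (2 * C * n.+1%:R)) = n%:R / n.+1%:R / 2 :> R.
    by field; rewrite !gt_eqF.
  have nn : n%:R / n.+1%:R <= 1 :> R by rewrite ler_pdivrMr// mul1r ler_nat.
  move=> st.
  have pA0 : 0 <= fine (Px x (cylinder xi A 1)) by exact: fine_ge0.
  have : fine (Px x (cylinder xi A 1)) / 2 <= q n.+1.
    have := ler_wpM2r pA0 nn; rewrite mul1r; move: st p2.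
    by move: (n%:R / n.+1%:R) (fine _) (fine _) => t e1 e2; lra.
  apply: le_trans; apply: (@le_trans _ _ (k * z `^ (- al) / 2)); last by rewrite ler_pM2r.
  by rewrite znal /k' le_eqVlt; apply/orP; left; apply/eqP; field; rewrite !gt_eqF.
pose N0 := (Num.truncn (D / (2 * C))).+1.
have lower' n : (N0 <= n)%N -> k' * n.+1%:R^-1 <= q n.+1.
  move=> Nn; apply: lower; apply: (@le_trans _ _ N0%:R); last by rewrite ler_nat.
  exact/ltW/truncnS_gt.
have hdv : series (@harmonic R) @ \oo --> +oo.
  apply: nondecreasing_dvgn_lt; last exact: dvg_harmonic.
  by apply: nondecreasing_series => n _ _; exact: ltW (harmonic_gt0 _).
apply/eqyP => b b0.
have [M NM hM] : exists2 M, (N0 <= M)%N & b / k' + series (@harmonic R) N0 <= series harmonic M.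
  have /cvgryPge/(_ (b / k' + series (@harmonic R) N0))[M _ hM] := hdv.
  by exists (maxn M N0); [exact: leq_maxr|apply: hM; exact: leq_maxl].
apply: le_trans (nneseries_lim_ge M.+1 (fun n _ _ => measure_ge0 _ _)).
rewrite big_nat_recl//=; rewrite (big_cat_nat (leq0n N0) NM)//=.
have hs : b <= \sum_(N0 <= i < M) q i.+1.
  apply: (@le_trans _ _ (\sum_(N0 <= i < M) k' * harmonic i)).
    rewrite -big_distrr/= -ler_pdivrMl// mulrC.
    have -> : \sum_(N0 <= i < M) (@harmonic R) i = series harmonic M - series harmonic N0.
      by rewrite sub_series NM.
    lra.
  by apply: ler_sum_nat => i /andP[Ni _]; exact: lower'.
apply: (@le_trans _ _ (\sum_(N0 <= i < M) Px x (E i.+1))%E).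
  rewrite (eq_bigr (fun i => (q i.+1)%:E)); last by move=> i _; exact: qE.
  by rewrite sumEFin lee_fin.
rewrite addeA leeDr// adde_ge0//.
by apply: sume_ge0 => i _.
Qed.

Lemma within_pinfty (f : R -> \bar R) (b : R) : f @ within X (pinfty_nbhs R) --> b%:E ->
  forall eps : R, 0 < eps -> exists r1 : R, forall x, X x -> r1 < x ->
    forall v : R, f x = v%:E -> `|v - b| <= eps.
Proof.
move=> fb eps eps0; have /fb[r1 [_ h]] : nbhs b%:E [set y : \bar R | forall v : R, y = v%:E -> `|v - b| <= eps].
  exists eps => //= v /=; rewrite distrC => h _ [<-]; exact: ltW.
by exists r1 => x Xx rx; apply: h.
Qed.

Lemma within_ninfty (f : R -> \bar R) (b : R) : f @ within X (ninfty_nbhs R) --> b%:E ->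
  forall eps : R, 0 < eps -> exists r1 : R, forall x, X x -> x < r1 ->
    forall v : R, f x = v%:E -> `|v - b| <= eps.
Proof.
move=> fb eps eps0; have /fb[r1 [_ h]] : nbhs b%:E [set y : \bar R | forall v : R, y = v%:E -> `|v - b| <= eps].
  exists eps => //= v /=; rewrite distrC => h _ [<-]; exact: ltW.
by exists r1 => x Xx rx; apply: h.
Qed.

(** Reflection changes the sign of [mu] on the negative side, so both halves of the drift condition
    make the same statement about the outward mean. *)
Lemma outjump_mean gamma b : condD' X Px xi gamma b -> forall eps : R, 0 < eps ->
  exists r1 : R, 0 < r1 /\ forall x, X x -> r1 <= `|x| ->
    (Px x).-integrable setT (EFin \o outjump x) -> forall m : R,
    (\int[Px x]_w (outjump x w)%:E = m%:E)%E -> `| `|x| `^ gamma * m - b| <= eps.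
Proof.
move=> [_ [hp hn]] eps eps0.
have [rp hrp] := within_pinfty hp eps0; have [rn hrn] := within_ninfty hn eps0.
exists (Num.max 1 (Num.max (rp + 1) (1 - rn))).
split; first by rewrite lt_max ltr01.
move=> x Xx; rewrite !ge_max => /and3P[x1 xp xn] ix m.
have [x0|x0] := leP 0 x.
  have e : forall w, outjump x w = theta xi w by move=> w; rewrite /outjump /sg x0 mul1r.
  under eq_integral do rewrite e.
  move=> mE; apply: (hrp x Xx); first by rewrite ger0_norm// in xp; lra.
  by rewrite /mu mE ger0_norm.
have e : forall w, theta xi w = - outjump x w.
  by move=> w; rewrite /outjump /sg leNgt x0/= mulN1r opprK.
move=> mE; apply: (hrn x Xx); first by rewrite ltr0_norm// in xn; lra.
rewrite /mu; under eq_integral do rewrite e EFinN.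
have -> : (\int[Px x]_w - (outjump x w)%:E = - m%:E)%E by rewrite -mE integralN//; exact: integrable_add_def ix.
by rewrite muleN oppeK.
Qed.

End lyapunov_criteria.

(** * Outward jumps under the tail and drift conditions *)

Lemma sin_pi_lt0 (R : realType) (al : R) : 1 < al < 2 -> sin (pi * al) < 0.
Proof.
move=> /andP[a1 a2]; rewrite -[al](subrK 1) mulrDr mulr1 sinDpi oppr_lt0.
apply: sin_gt0_pi; rewrite mulr_gt0 ?pi_gt0//=; last by lra.
by rewrite -[ltRHS]mulr1 ltr_pM2l ?pi_gt0//; lra.
Qed.

Lemma JcE (R : realType) (al : R) : 1 < al < 2 -> Jc al = pi / `|sin (pi * al)|.
Proof.
move=> al12; rewrite /Jc fine_JintE; last by lra.
rewrite ltr0_norm ?sin_pi_lt0//; congr (_ / _).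
by rewrite mulrBr addrC mulr_natr sinD2pi sinN.
Qed.

Section outward_jumps.
Context {R : realType} (d : measure_display) (Omega : measurableType d)
  (X : set R) (K : R.-pker R ~> R) (Px : R -> probability Omega R)
  (xi : nat -> Omega -> R).
Hypothesis mX : measurable X.
Hypothesis mc : is_markov_chain X K Px xi.

(** Reflection merges both half-lines into one family. The exponent [be] is cut down to at most 2,
    as the comparisons of [v^2] with [|v|^be] require; the price is the 1 added to the moment
    bound. *)
Lemma outjump_family (al be c : R) : condTout X Px xi al be c ->
  [/\ 1 < al < 2, 0 < c & exists be' x0 M : R,
   [/\ al < be' <= 2,
    forall eps : R, 0 < eps -> exists Y : R, forall y, Y <= y ->
      forall x, [set x | X x /\ x0 <= `|x|] x ->
      `|y `^ al * fine (Px x [set w | y < outjump xi x w]) - c| <= eps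
    & forall x, [set x | X x /\ x0 <= `|x|] x ->
      (\int[Px x]_w (negT (outjump xi x) w `^ be')%:E <= M%:E)%E]].
Proof.
move=> [al12 [albe [c0 [x0 [x00 [tp [tn [[M1 h1] [M2 h2]]]]]]]]]; split=> //.
have [mxi _] := mc; have [al1 al2] := andP al12.
have mth : measurable_fun setT (theta xi) by exact: measurable_funB.
exists (Num.min be 2), x0, (1 + Num.max M1 M2); split.
- by rewrite lt_min albe al2 ge_min lexx orbT.
- move=> eps eps0; have [Y1 t1] := tp _ eps0; have [Y2 t2] := tn _ eps0.
  (* The events for the jump and for its positive part coincide once [y >= 0]. *)
  exists (Num.max 0 (Num.max Y1 Y2)) => y; rewrite !ge_max => /and3P[y0 y1 y2] x [Xx xx].
  have [xp|xn] := leP 0 x.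
    suff -> : [set w | y < outjump xi x w] = [set w | y < posp (theta xi w)].
      by apply: t1 => //; rewrite ger0_norm// in xx.
    apply/seteqP; split=> w /=; rewrite /outjump /sg xp mul1r /posp; case: ifP => // h; lra.
  suff -> : [set w | y < outjump xi x w] = [set w | y < negp (theta xi w)].
    by apply: t2 => //; rewrite ltr0_norm// in xx; lra.
  apply/seteqP; split=> w /=; rewrite /outjump /sg leNgt xn/= mulN1r /negp; case: ifP => // h; lra.
have b'0 : 0 < Num.min be 2 by rewrite lt_min; lra.
have b0 : 0 < be by lra.
have pw (t : R) : 0 <= t -> t `^ Num.min be 2 <= 1 + t `^ be.
  move=> t0; have [t1|t1] := leP t 1.
    apply: (@le_trans _ _ 1); last by rewrite lerDl powR_ge0.
    have e1 : 1 `^ Num.min be 2 = 1 :> R by rewrite powR1.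
    by rewrite -[leRHS]e1 ge0_ler_powR ?nnegrE// ltW.
  by rewrite ler_wpDl// ler_powR// ?ge_min ?lexx//; exact: ltW.
have key x (g : Omega -> R) : measurable_fun setT g -> (forall w, 0 <= g w) ->
    (\int[Px x]_w (g w `^ be)%:E <= (Num.max M1 M2)%:E)%E ->
    (\int[Px x]_w (g w `^ Num.min be 2)%:E <= (1 + Num.max M1 M2)%:E)%E.
  move=> mg g0 h; apply: (@le_trans _ _ (\int[Px x]_w (1 + (g w `^ be)%:E))%E).
    apply: ge0_le_integral => //.
    - by move=> w _; rewrite lee_fin powR_ge0.
    - by apply/measurable_EFinP; exact: measurableT_comp (measurable_powR _) mg.
    - by apply/measurable_EFinP; apply: measurable_funD => //; exact: measurableT_comp (measurable_powR _) mg.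
    - by move=> w _; rewrite -EFinD lee_fin pw.
  rewrite ge0_integralD//.
  - by rewrite (integral_cst _ _ 1)// mul1e -[X in (X + _)%E]/(Px x setT) probability_setT EFinD leeD2l.
  - by move=> w _; rewrite lee_fin powR_ge0.
  - by apply/measurable_EFinP; exact: measurableT_comp (measurable_powR _) mg.
move=> x [Xx xx]; apply: key.
- apply: measurable_maxr => //; apply: measurableT_comp => //.
  exact: (measurable_outjump mc).
- by move=> w; rewrite le_max lexx orbT.
have [xp|xn] := leP 0 x.
  under eq_integral.
    move=> w _.
    have -> : negT (outjump xi x) w = negp (theta xi w).
      rewrite /negT /outjump /sg xp mul1r /negp; case: ltP => h; first by rewrite max_l//; lra.
      by rewrite max_r//; lra.
    over.
  apply: (le_trans (h1 x Xx _)); first by rewrite ger0_norm// in xx.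
  by rewrite lee_fin le_max lexx.
under eq_integral.
  move=> w _.
  have -> : negT (outjump xi x) w = posp (theta xi w).
    by rewrite /negT /outjump /sg leNgt xn/= mulN1r opprK /posp; case: leP.
  over.
apply: (le_trans (h2 x Xx _)); first by rewrite ltr0_norm// in xx; lra.
by rewrite lee_fin le_max lexx orbT.
Qed.

Variables (al be c M x0 gamma b : R).
Let D := [set x | X x /\ x0 <= `|x|].
Hypothesis al12 : 1 < al < 2.
Hypothesis albe : al < be <= 2.
Hypothesis c0 : 0 < c.
Hypothesis tail : forall eps : R, 0 < eps -> exists Y : R, forall y, Y <= y ->
  forall x, D x -> `|y `^ al * fine (Px x [set w | y < outjump xi x w]) - c| <= eps.
Hypothesis neg_moment : forall x, D x ->
  (\int[Px x]_w (negT (outjump xi x) w `^ be)%:E <= M%:E)%E.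
Hypothesis HN : condN' X Px xi.
Hypothesis HD : condD' X Px xi gamma b.

Let mT x : measurable_fun setT (outjump xi x). Proof. exact: (measurable_outjump mc). Qed.

Lemma mean_asymp (eps : R) : 0 < eps -> exists r1 : R, 1 <= r1 /\
  forall x, X x -> r1 <= `|x| -> D x /\ exists2 m : R,
    (\int[Px x]_w (outjump xi x w)%:E = m%:E)%E & `| `|x| `^ gamma * m - b| <= eps.
Proof.
move=> /(outjump_mean HD)[r1 [r10 h]]; exists (Num.max 1 (Num.max r1 x0)).
split; first by rewrite le_max lexx.
move=> x Xx; rewrite !ge_max => /and3P[x1 xr xx].
have Dx : D x by [].
have [ix [m mE]] := T_integrable mT al12 albe c0 tail neg_moment Dx.
by split=> //; exists m => //; exact: h.
Qed.

Lemma recurrent_outjump (kappa r1 : R) : kappa < c * Jc al ->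
  (forall x, X x -> r1 <= `|x| -> D x /\ exists2 m : R,
     (\int[Px x]_w (outjump xi x w)%:E = m%:E)%E & `|x| `^ (al - 1) * m <= kappa) ->
  recurrent X Px xi.
Proof.
move=> kJ h; have [R0 [R01 dr]] := drift_ln mT al12 albe c0 tail neg_moment kJ.
apply: (recurrentP mX mc (r0 := Num.max (expR 1) (Num.max r1 R0))) => //.
  by rewrite le_max lexx.
move=> x Xx; rewrite !ge_max => /and3P[_ xr xR].
by have [Dx [m mE mk]] := h x Xx xr; exact: dr mE mk.
Qed.

Lemma directional_outjump (kappa r1 : R) : c * Jc al < kappa -> 0 < kappa ->
  (forall x, X x -> r1 <= `|x| -> D x /\ exists2 m : R,
     (\int[Px x]_w (outjump xi x w)%:E = m%:E)%E & kappa <= `|x| `^ (al - 1) * m) ->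
  directional_transient X Px xi.
Proof.
move=> kJ k0 h; have [b1 b2] := andP albe.
pose s := c * Jc al.
have s0 : 0 <= s.
  rewrite mulr_ge0 ?(ltW c0)//; apply: fine_ge0; apply: integral_ge0 => x _.
  by rewrite lee_fin Jfun_ge0.
(* The three entries serve the three conditions of the drift estimate; the last gives
   [s nu < kappa - s], and [s + 1] keeps its denominator positive. *)
pose nu := Num.min 1 (Num.min ((be - al) / 2) ((kappa - s) / (2 * (s + 1)))).
have nu0 : 0 < nu.
  by rewrite !lt_min ltr01/= !divr_gt0 ?subr_gt0// mulr_gt0// ltr_wpDl.
have nu1 : nu <= 1 by rewrite ge_min lexx.
have nub : nu < be - al.
  apply: (@le_lt_trans _ _ ((be - al) / 2)); last by lra.
  by rewrite !ge_min lexx orbT.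
have nuk : s * (1 + nu) < kappa.
  have : nu <= (kappa - s) / (2 * (s + 1)) by rewrite !ge_min lexx !orbT.
  rewrite ler_pdivlMr; last by lra.
  have : s < kappa by [].
  nra.
have nu01 : 0 < nu <= 1 by rewrite nu0.
have [R0 [R01 dr]] := drift_powRN mT al12 albe c0 tail neg_moment nu01 nub nuk.
apply: (directionalP mX mc (nu := nu) (A0 := Num.max r1 R0)) => //.
  by rewrite le_max R01 orbT.
move=> A; rewrite ge_max => /andP[Ar AR] x Xx Ax.
have [Dx [m mE mk]] := h x Xx (le_trans Ar Ax).
exact: dr AR Ax _ Dx _ mE mk.
Qed.

Lemma null_outjump : al - 1 <= gamma -> recurrent X Px xi -> null_recurrent X Px xi.
Proof.
move=> ag rec; split=> //; have [al1 al2] := andP al12.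
have [r1 [r11 h]] := mean_asymp ltr01.
have B0 : 0 <= `|b| + 1 by rewrite addr_ge0.
have [C [R0 [C0 R01 dr]]] := drift_phi mT al12 albe c0 tail neg_moment B0.
have c2 : 0 < c / 2 by rewrite divr_gt0.
have [Y Y0 hY] := tail_pos tail c2.
(* The entry [2 * r1] turns [|x| >= z / 2] into [|x| >= r1], where the mean is controlled; [Y] gives
   the tail its lower bound with constant [c / 2]. *)
pose z0 := Num.max (2 * r1) (Num.max R0 Y); pose a0 := Num.max 1 x0.
exists a0; apply: (@nullP _ _ _ _ _ _ _ mX mc al C (c / 2) z0 a0) => //.
- lra.
- by rewrite !le_max R01 orbT.
- by rewrite lt_max ltr01.
- move=> z; rewrite !ge_max => /and3P[zr zR zY] x Xx zx.
  have xr : r1 <= `|x| by lra.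
  have [Dx [m mE mb]] := h x Xx xr.
  apply: dr mE _ => //.
  have x0' : 0 < `|x| by lra.
  have hm : `|x| `^ gamma * `|m| <= `|b| + 1.
    rewrite -[X in X * _](ger0_norm (powR_ge0 _ _)) -normrM.
    by rewrite -[X in `|X|](subrK b) (le_trans (ler_normD _ _))// addrC lerD2l.
  have hp : `|x| `^ (al - 1) <= `|x| `^ gamma by rewrite ler_powR//; lra.
  have -> : 1 - al = - (al - 1) by ring.
  rewrite powRN ler_pdivlMr ?powR_gt0// mulrC.
  by apply: le_trans hm; rewrite ler_wpM2r.
move=> z; rewrite !ge_max => /and3P[zr zR zY] x Xx; rewrite ge_max => /andP[x1 xx].
have z00 : 0 < z by lra.
have := hY z zY x (conj Xx xx); rewrite ler_distl => /andP[h1 _].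
rewrite powRN ler_pdivrMr ?powR_gt0// mulrC; lra.
Qed.

Lemma mean_powE (x m : R) (s : R) : 0 < `|x| ->
  `|x| `^ s * m = `|x| `^ (s - gamma) * (`|x| `^ gamma * m).
Proof. by move=> xp; rewrite mulrA -powRD ?subrK// (gt_eqF xp) implybT. Qed.

Lemma positive_outjump : gamma < al - 1 -> b < 0 -> positive_recurrent X Px xi.
Proof.
move=> ga b0; have [al1 al2] := andP al12; have [g0 _] := HD.
(* Midway between [1 + gamma] and [al]: above the first, the drift of order [b r^(nu - 1 - gamma)]
   tends to minus infinity and beats the constant [C]; below the second, the outward moment is
   finite. *)
pose nu := (1 + gamma + al) / 2.
have nu1al : 1 < nu < al by rewrite /nu; lra.
have nug : 0 < nu - 1 - gamma by rewrite /nu; lra.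
have [C hC] := drift_powR mT al12 albe c0 tail neg_moment nu1al.
have b2 : 0 < - b / 2 by lra.
have [r1 [r11 h]] := mean_asymp b2.
have [R0 [R01 hR]] := powR_eventually_ge (2 * (`|C| + 1) / - b) nug.
apply: (positiveP mX mc (nu := nu) (a0 := Num.max r1 R0)).
  by rewrite lt_max; apply/orP; left; lra.
move=> x Xx; rewrite ge_max => /andP[xr xR].
have x1 : 1 <= `|x| by lra.
have [Dx [m mE mb]] := h x Xx xr.
have x0' : 0 < `|x| by lra.
apply: (le_trans (leeD2r _ (hC _ x1 x Dx m mE))).
rewrite -EFinD lee_fin -addrA -addrA gerDl -mulrA (mean_powE _ (nu - 1))//.
move: mb; rewrite ler_distl => /andP[_ mb].
have := hR _ xR; rewrite ler_pdivrMr; last by lra.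
have : 0 <= `|x| `^ (nu - 1 - gamma) by exact: powR_ge0.
have : C <= `|C| by exact: ler_norm.
have [nu1 _] := andP nu1al.
have mb' : `|x| `^ gamma * m <= b / 2 by lra.
move: (`|x| `^ (nu - 1 - gamma)) (`|x| `^ gamma * m) mb' => p q qb Cn p0 pb.
have pq : p * q <= p * (b / 2) by rewrite ler_wpM2l.
have : p * q <= - (`|C| + 1) by lra.
have := normr_ge0 C; nra.
Qed.

(** In both cases [r^(al - 1) m] ends up below a level smaller than [c * Jc al]: it tends to 0 in
    the first and to [b] in the second. *)
Lemma subcritical_outjump : al - 1 < gamma \/ al - 1 = gamma /\ b < c * Jc al ->
  0 < Jc al -> null_recurrent X Px xi.
Proof.
move=> hg J0; have cJ : 0 < c * Jc al by rewrite mulr_gt0.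
apply: null_outjump; first by case: hg => [/ltW//|[-> _]].
case: hg => [ag|[ag bJ]].
  have [r1 [r11 h]] := mean_asymp ltr01.
  have ag' : 0 < gamma - (al - 1) by lra.
  have e0 : 0 < c * Jc al / 2 / (`|b| + 1) by rewrite !divr_gt0// ltr_wpDl.
  have [R0 [R01 hR]] := powRN_eventually_le ag' e0.
  apply: (@recurrent_outjump (c * Jc al / 2) (Num.max r1 R0)); first lra.
  move=> x Xx; rewrite ge_max => /andP[xr xR]; have [Dx [m mE mb]] := h x Xx xr.
  split=> //; exists m => //; rewrite mean_powE; last by lra.
  rewrite -opprB; move: mb; rewrite ler_distl => /andP[_ mb].
  have mb' : `|x| `^ gamma * m <= `|b| + 1 by rewrite (le_trans mb)// lerD2r ler_norm.
  apply: (le_trans (ler_wpM2l (powR_ge0 _ _) mb')).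
  by rewrite -ler_pdivlMr ?ltr_wpDl//; exact: hR.
have e0 : 0 < (c * Jc al - b) / 2 by lra.
have [r1 [r11 h]] := mean_asymp e0.
apply: (@recurrent_outjump ((c * Jc al + b) / 2) r1); first lra.
move=> x Xx xr; have [Dx [m mE mb]] := h x Xx xr; split=> //; exists m => //.
by rewrite ag; move: mb; rewrite ler_distl => /andP[_ mb]; lra.
Qed.

(** Here [r^(al - 1) m] tends to infinity or to [b], and ends up above a level larger than
    [c * Jc al]. *)
Lemma supercritical_outjump :
  gamma < al - 1 /\ 0 < b \/ gamma = al - 1 /\ c * Jc al < b ->
  0 < Jc al -> directional_transient X Px xi.
Proof.
move=> hg J0; have cJ : 0 < c * Jc al by rewrite mulr_gt0.
case: hg => [[ag b0]|[ag bJ]].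
  have e0 : 0 < b / 2 by lra.
  have [r1 [r11 h]] := mean_asymp e0.
  have ag' : 0 < al - 1 - gamma by lra.
  have [R0 [R01 hR]] := powR_eventually_ge ((c * Jc al + 1) / (b / 2)) ag'.
  apply: (@directional_outjump (c * Jc al + 1) (Num.max r1 R0)); [lra|lra|].
  move=> x Xx; rewrite ge_max => /andP[xr xR]; have [Dx [m mE mb]] := h x Xx xr.
  split=> //; exists m => //; rewrite mean_powE; last by lra.
  move: mb; rewrite ler_distl => /andP[mb _].
  have mb' : b / 2 <= `|x| `^ gamma * m by lra.
  apply: le_trans (ler_wpM2l (powR_ge0 _ _) mb').
  by rewrite -ler_pdivrMr//; exact: hR.
have e0 : 0 < (b - c * Jc al) / 2 by lra.
have [r1 [r11 h]] := mean_asymp e0.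
apply: (@directional_outjump ((c * Jc al + b) / 2) r1); [lra|lra|].
move=> x Xx xr; have [Dx [m mE mb]] := h x Xx xr; split=> //; exists m => //.
by rewrite -ag; move: mb; rewrite ler_distl => /andP[mb _]; lra.
Qed.

End outward_jumps.

Theorem theorem2p3 (R : realType) (d : measure_display) (Omega : measurableType d)
  (X : set R) (K : R.-pker R ~> R) (Px : R -> probability Omega R)
  (xi : nat -> Omega -> R) (alpha beta c gamma b : R) :
  measurable X -> ~ finite_set X -> (forall M : R, exists2 x, X x & M < `|x|) ->
  is_markov_chain X K Px xi ->
  condN' X Px xi -> condTout X Px xi alpha beta c -> condD' X Px xi gamma b ->
  [/\ alpha - 1 < gamma -> null_recurrent X Px xi,
      gamma < alpha - 1 -> b < 0 -> positive_recurrent X Px xi,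
      gamma < alpha - 1 -> 0 < b -> directional_transient X Px xi,
      gamma = alpha - 1 -> b < c * pi / `|sin (pi * alpha)| -> null_recurrent X Px xi
    & gamma = alpha - 1 -> c * pi / `|sin (pi * alpha)| < b ->
        directional_transient X Px xi].
Proof.
move=> mX _ _ mc HN HT HD.
have [al12 c0 [be [x0 [M [albe tail neg]]]]] := outjump_family mc HT.
have J0 : 0 < Jc alpha. by rewrite JcE// divr_gt0 ?pi_gt0// normr_gt0 lt_eqF// sin_pi_lt0.
rewrite -mulrA -JcE//; split.
- by move=> ag; apply: (subcritical_outjump mX mc al12 albe c0 tail neg HN HD _ J0); left.
- by move=> ga b0; exact: (positive_outjump mX mc al12 albe c0 tail neg HD ga b0).
- by move=> ga b0; apply: (supercritical_outjump mX mc al12 albe c0 tail neg HN HD _ J0); left.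
- by move=> ga bJ; apply: (subcritical_outjump mX mc al12 albe c0 tail neg HN HD _ J0); right.
- by move=> ga bJ; apply: (supercritical_outjump mX mc al12 albe c0 tail neg HN HD _ J0); right.
Qed.
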